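(* Let $n=2$, so $(G,G')=(SL(3,\mathbb R),SL(2,\mathbb R))$. For $(\alpha,\beta;\lambda,\nu)\in\{\pm\}^2\times\mathbb C^2$ the following three conditions are equivalent. (i) $\mathrm{Diff}_{G'}(I(\mathrm{triv},\lambda)^\alpha,J(\mathrm{triv},\nu)^\beta)\neq\{0\}$. (ii) $\dim\mathrm{Diff}_{G'}(I(\mathrm{triv},\lambda)^\alpha,J(\mathrm{triv},\nu)^\beta)\in\{1,2\}$. (iii) There is $m\in\mathbb Z_{\ge0}$ with $\beta=\alpha+m$ and $\nu=\lambda+m$. Moreover, the dimension is two if and only if there exist $m\in\mathbb Z_{\ge0}$ and $\ell\in1+\mathbb Z_{\ge0}$ such that $\beta=\alpha+m$, $\lambda=1-(m+\ell)$ and $\nu=1+\ell$.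
   Context: Groups: $G=SL(3,\mathbb R)$, $G'=\{\mathrm{diag}(g',1):g'\in SL(2,\mathbb R)\}\subset G$. With matrix units $E_{i,j}$ put $N_j^\pm$: $N_j^+=E_{1,j+1}$, $N_j^-=E_{j+1,1}$ ($j=1,2$), $\widetilde H_0=\frac12\mathrm{diag}(2,-1,-1)$, $\widetilde H_0'=\mathrm{diag}(1,-1,0)$. Let $N_+=\exp(\mathbb RN_1^++\mathbb RN_2^+)$, $N_+'=\exp(\mathbb RN_1^+)$, $A=\exp(\mathbb R\widetilde H_0)$, $A'=\exp(\mathbb R\widetilde H_0')$, $M=\{\mathrm{diag}(\det(g)^{-1},g):g\in SL^\pm(2,\mathbb R)\}$ where $SL^\pm(2,\mathbb R)=\{\det=\pm1\}$, $M'=\{\mathrm{diag}(\epsilon,\epsilon,1):\epsilon=\pm1\}$. Then $P=MAN_+$, $P'=M'A'N'_+$ are parabolic subgroups of $G$, $G'$ with $G/P\simeq\mathbb{RP}^2$, $G'/P'\simeq\mathbb{RP}^1$, $P'\subset P$. Signs: $\{\pm\}\equiv\{\pm1\}$; for $\delta\in\{\pm\}$, $k\in\mathbb Z_{\ge0}$, $\delta+k$ denotes the sign $\delta\cdot(-1)^k$. Representations: $\mathbb C_\lambda$ is the character $\exp(t\widetilde H_0)\mapsto e^{\lambda t}$ of $A$, $\mathbb C_\nu$ the character $\exp(t\widetilde H'_0)\mapsto e^{\nu t}$ of $A'$. $\mathrm{sgn}^+$ is trivial; $\mathrm{sgn}^-$ is $\mathrm{diag}(\det(g)^{-1},g)\mapsto\det(g)$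 on $M$ and $\mathrm{diag}(\epsilon,\epsilon,1)\mapsto\epsilon$ on $M'$. $I(\mathrm{triv},\lambda)^\alpha=\mathrm{Ind}_P^G(\mathrm{sgn}^\alpha\boxtimes\mathbb C_\lambda)$ and $J(\mathrm{triv},\nu)^\beta=\mathrm{Ind}_{P'}^{G'}(\mathrm{sgn}^\beta\boxtimes\mathbb C_\nu)$ are unnormalized smooth induced representations ($N_+,N'_+$ acting trivially): $\mathrm{Ind}_P^G(\sigma)=\{f\in C^\infty(G):f(gp)=\sigma(p)^{-1}f(g)\ \forall p\in P\}$ with left translation, viewed as sections of line bundles over $G/P$, $G'/P'$. $\mathrm{Diff}_{G'}(I,J)$ is the space of $G'$-intertwining differential operators $I\to J$ (differential symmetry breaking operators), where, for the inclusion $\iota:G'/P'\hookrightarrow G/P$, a continuous linear map $\mathbb D$ between spaces of smooth sections is a differential operator if $\iota(\mathrm{Supp}(\mathbb Df))\subset\mathrm{Supp}(f)$ for all $f$ (equivalently, locally a partial differential operator followed by restriction to $G'/P'$). *)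

(* Defs.v *)
From HB Require Import structures.
From mathcomp Require Import all_boot all_order all_algebra.
From mathcomp Require Import complex.
From mathcomp Require Import all_classical all_reals all_analysis.

Set Implicit Arguments.
Unset Strict Implicit.
Unset Printing Implicit Defensive.

Import Order.TTheory GRing.Theory Num.Theory.
Import numFieldNormedType.Exports.

Local Open Scope classical_set_scope.
Local Open Scope complex_scope.
Local Open Scope ring_scope.

Section LinearAlgebra.

Definition has_dim (K : fieldType) (V : lmodType K) (W : set V) (d : nat) :=
  exists e : 'I_d -> V,
    (forall c : 'I_d -> K, \sum_(i < d) c i *: e i = 0 -> forall i, c i = 0) /\
    W = [set \sum_(i < d) c i *: e i | c in [set: 'I_d -> K]].

End LinearAlgebra.

Section Exponentials.
Variable R : realType.

Definition cexp (z : R[i]) : R[i] :=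
  (expR (complex.Re z))%:C * (cos (complex.Im z) +i* sin (complex.Im z)).

Definition expm n (X : 'M[R]_n) : 'M[R]_n :=
  limn (series (fun k => (k`!%:R)^-1 *: X ^+ k)).

End Exponentials.

Section SpecialLinearGroup.
Variables (R : realType) (n : nat).

(* As a [set_type], [SL R n] carries the topology induced by ['M[R]_n]. *)
Definition SLset : set 'M[R]_n := [set g | \det g = 1].
Definition SL : Type := SLset.

HB.instance Definition _ := Topological.copy SL SLset.

Definition SLmx (g : SL) : 'M[R]_n := set_val g.

Definition mkSL (g : 'M[R]_n) (hg : \det g = 1) : SL :=
  exist _ g (mem_set (hg : SLset g)).

Lemma mkSLE (g : 'M[R]_n) (hg : \det g = 1) : SLmx (mkSL hg) = g.
Proof. by []. Qed.

Lemma det_SL (g : SL) : \det (SLmx g) = 1.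
Proof. by case: g => x hx; exact: set_mem hx. Qed.

Lemma SLmx_inj : injective SLmx.
Proof. exact: val_inj. Qed.

Definition SL_one : SL := mkSL (det1 R n).

Fact SL_mul_subproof (g h : SL) : \det (SLmx g *m SLmx h) = 1.
Proof. by rewrite det_mulmx !det_SL mulr1. Qed.
Definition SL_mul (g h : SL) : SL := mkSL (SL_mul_subproof g h).

Fact SL_inv_subproof (g : SL) : \det (invmx (SLmx g)) = 1.
Proof. by rewrite det_inv det_SL invr1. Qed.
Definition SL_inv (g : SL) : SL := mkSL (SL_inv_subproof g).

Fact SL_mulA : associative SL_mul.
Proof. by move=> x y z; apply: SLmx_inj; rewrite !mkSLE mulmxA. Qed.
Fact SL_mul1 : left_id SL_one SL_mul.
Proof. by move=> x; apply: SLmx_inj; rewrite !mkSLE mul1mx. Qed.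
Fact SL_mulr1 : right_id SL_one SL_mul.
Proof. by move=> x; apply: SLmx_inj; rewrite !mkSLE mulmx1. Qed.
Fact SL_unit (x : SL) : SLmx x \in unitmx.
Proof. by rewrite unitmxE det_SL unitr1. Qed.
Fact SL_mulV : left_inverse SL_one SL_inv SL_mul.
Proof. by move=> x; apply: SLmx_inj; rewrite !mkSLE mulVmx // SL_unit. Qed.
Fact SL_mulrV : right_inverse SL_one SL_inv SL_mul.
Proof. by move=> x; apply: SLmx_inj; rewrite !mkSLE mulmxV // SL_unit. Qed.

HB.instance Definition _ :=
  isGroup.Build SL SL_mulA SL_mul1 SL_mulr1 SL_mulV SL_mulrV.

End SpecialLinearGroup.

Section SmoothFunctions.
Variable R : realType.

(* [F] is of class C^k on the open set [U]: all its iterated directional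
   derivatives of order at most [k] exist and are continuous on [U]. *)
Fixpoint Ck_on (V : normedModType R) (U : set V) (k : nat) (F : V -> R) : Prop :=
  (forall x, U x -> {for x, continuous F}) /\
  (if k is k'.+1 then
     forall v, (forall x, U x -> derivable F x v) /\
               Ck_on U k' (fun x => 'D_v F x)
   else True).

Variable n : nat.

(* C^oo functions on the embedded submanifold SL(n,R) of the space of matrices:
   locally restrictions of C^oo functions of the ambient space. *)
Definition smooth (f : SL R n -> R[i]^o) : Prop :=
  forall g, exists U : set 'M[R]_n, [/\ open U, U (SLmx g) &
    exists Fre Fim : 'M[R]_n -> R,
      [/\ forall k, Ck_on U k Fre, forall k, Ck_on U k Fim &
          forall h, U (SLmx h) -> f h = Fre (SLmx h) +i* Fim (SLmx h)]].

Definition sl : set 'M[R]_n := [set X | \tr X = 0].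

Definition extend0 (f : SL R n -> R[i]^o) (x : 'M[R]_n) : R[i] :=
  if pselect (\det x = 1) is left hx then f (mkSL hx) else 0.

(* (X f)(g) = d/dt f(g exp(tX)) at t = 0. For X in sl(n), g exp(tX) stays in
   SL(n,R), so the values of [extend0 f] off SL(n,R) play no role. *)
Definition lie_derive (X : 'M[R]_n) (f : SL R n -> R[i]^o) : SL R n -> R[i]^o :=
  fun g =>
    let phi (t : R) := extend0 f (SLmx g *m expm (t *: X)) in
    derive1 (fun t => complex.Re (phi t)) 0 +i*
    derive1 (fun t => complex.Im (phi t)) 0.

Definition lie_jet (f : SL R n -> R[i]^o) :
    {ptws seq sl -> {family compact, SL R n -> R[i]^o}} :=
  fun w => foldr (fun X : sl => lie_derive (set_val X)) f w.

(* Restricted to smooth functions, this is the usual Frechet topology of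
   C^oo(SL(n,R)): uniform convergence on compact sets of all the iterated
   derivatives along left-invariant vector fields. *)
Definition Coo_topology : topologicalType := initial_topology lie_jet.

Definition ltranslate (g : SL R n) (f : SL R n -> R[i]^o) : SL R n -> R[i]^o :=
  fun x => f (g^-1 * x)%g.

End SmoothFunctions.

Section InducedRepresentations.
Variables (R : realType) (n : nat).

(* The subgroup M A N with A = exp(R H). *)
Definition parabolic (M : set (SL R n)) (H : 'M[R]_n) (N : set (SL R n)) :
    set (SL R n) :=
  [set p | exists m a u, [/\ M m, exists t : R, SLmx a = expm (t *: H), N u &
                            p = (m * a * u)%g]].

(* Ind (chi x C_lam x 1) for the character exp(tH) |-> e^(lam t) of A. *)
Definition Ind (M : set (SL R n)) (H : 'M[R]_n) (N : set (SL R n))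
    (chi : SL R n -> R[i]) (lam : R[i]) : set (SL R n -> R[i]^o) :=
  [set f | smooth f /\
    forall g m a u (t : R), M m -> SLmx a = expm (t *: H) -> N u ->
      f (g * (m * a * u))%g = (chi m * cexp (lam * t%:C))^-1 * f g].

Definition left_coset (P : set (SL R n)) (g : SL R n) : set (SL R n) :=
  [set (g * p)%g | p in P].

(* Open sets of the quotient SL(n,R)/P, whose points are the left cosets. *)
Definition quotient_open (P : set (SL R n)) (U : set (set (SL R n))) : Prop :=
  open [set g | U (left_coset P g)].

(* The support, in SL(n,R)/P, of the section given by a P-equivariant [f]: the
   closure of the set of cosets on which [f] does not vanish. *)
Definition support (P : set (SL R n)) (f : SL R n -> R[i]^o) :
    set (set (SL R n)) :=
  [set x | range (left_coset P) x /\
    forall U, quotient_open P U -> U x ->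
      exists g, U (left_coset P g) /\ f g <> 0].

End InducedRepresentations.

Section SymmetryBreaking.
Variable R : realType.

Definition H0 : 'M[R]_3 :=
  2^-1 *: diag_mx (\row_(j < 3) (if j == 0 then 2 else -1)).

Definition MG : set (SL R 3) :=
  [set m | exists h : 'M[R]_2, (\det h = 1 \/ \det h = -1) /\
    SLmx m = block_mx ((\det h)^-1)%:M 0 0 h :> 'M[R]_(1 + 2)].

Definition NG : set (SL R 3) :=
  [set u | exists x : 'I_2 -> R,
    SLmx u = expm (\sum_(j < 2) x j *: delta_mx ord0 (lift ord0 j))].

(* Signs are booleans, with [true] for -; thus delta + k is [delta (+) odd k].
   [sgnM alpha (diag(det(h)^-1, h))] is det(h) if alpha = - and 1 otherwise. *)
Definition sgnM (alpha : bool) (m : SL R 3) : R[i] :=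
  ((\det (drsubmx (SLmx m : 'M[R]_(1 + 2)))) ^+ alpha)%:C.

(* G' is SL(2,R), its elements g' standing for diag(g',1). *)
Definition H0' : 'M[R]_2 := diag_mx (\row_(j < 2) (if j == 0 then 1 else -1)).

Definition MG' : set (SL R 2) :=
  [set m | exists eps : R, (eps = 1 \/ eps = -1) /\ SLmx m = eps%:M].

Definition NG' : set (SL R 2) :=
  [set u | exists x : R, SLmx u = expm (x *: delta_mx 0 1)].

Definition sgnM' (beta : bool) (m : SL R 2) : R[i] := ((SLmx m 0 0) ^+ beta)%:C.

Definition PG : set (SL R 3) := parabolic MG H0 NG.
Definition PG' : set (SL R 2) := parabolic MG' H0' NG'.

Definition I_triv (lam : R[i]) (alpha : bool) : set (SL R 3 -> R[i]^o) :=
  Ind MG H0 NG (sgnM alpha) lam.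
Definition J_triv (nu : R[i]) (beta : bool) : set (SL R 2 -> R[i]^o) :=
  Ind MG' H0' NG' (sgnM' beta) nu.

Fact embed_subproof (g : SL R 2) :
  \det (block_mx (SLmx g) 0 0 1 : 'M[R]_(2 + 1)) = 1.
Proof. by rewrite det_ublock det_SL det1 mulr1. Qed.
Definition embed (g : SL R 2) : SL R 3 := mkSL (embed_subproof g).

(* An operator I -> J is encoded as a map on all functions which vanishes off
   I, so that two operators are equal iff they agree on I. *)
Definition Diff (I : set (SL R 3 -> R[i]^o)) (J : set (SL R 2 -> R[i]^o)) :
    set ((SL R 3 -> R[i]^o) -> (SL R 2 -> R[i]^o)) :=
  [set D | [/\ forall f, I f -> J (D f),
     forall f, ~ I f -> D f = 0,
     forall (c : R[i]) f1 f2, I f1 -> I f2 ->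
       D (c *: f1 + f2) = c *: D f1 + D f2,
     {within (I : set (Coo_topology R 3)), continuous
       (D : Coo_topology R 3 -> Coo_topology R 2)} &
     (forall f g, I f -> D (ltranslate (embed g) f) = ltranslate g (D f)) /\
     (* the image of Supp(D f) in G/P is contained in Supp(f) *)
     (forall f g, I f -> support PG' (D f) (left_coset PG' g) ->
        support PG f (left_coset PG (embed g)))]].

End SymmetryBreaking.

(* Main.v *)
(* Elements of I(triv, lam)^alpha are functions of the first column of g, homogeneous of
   degree - lam and parity alpha; in the chart y E_21 + z E_31 of G/P the submanifold
   G'/P' is z = 0. A symmetry breaking operator D is determined by the functional
   f |-> (D f)(1), which depends only on the germ of f at 0. Apply it to
   phi(r^2 y, r z): by equivariance under A' the value is r^(nu - lam) times a constant
   for r > 0, and it is smooth in r by continuity of D. Hence it vanishes unless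
   nu - lam = k is a natural number, and then it is the r^k-term, a combination of the
   d_y^a d_z^b phi(0) with 2 a + b = k. This replaces Peetre's theorem.
   Equivariance under -1 gives beta = alpha + b, and equivariance under N'_+, tested on
   y^(a - 1) z^b, gives a = 0 or lam = 1 - (a + b). Conversely, d_z^b is always
   intertwining, and for lam = 1 - (a + b) the section d_z^b f restricted to G'/P' has
   weight 1 - a, so that d_y^a intertwines it by Bol's identity. For given k there is at
   most one admissible a > 0, hence the dimension is at most two. *)

Require Import Defs.
From HB Require Import structures.
From mathcomp Require Import all_boot all_order all_algebra.
From mathcomp Require Import complex.
From mathcomp Require Import all_classical all_reals all_analysis.
From mathcomp Require Import zify ring lra.

Set Implicit Arguments.
Unset Strict Implicit.
Unset Printing Implicit Defensive.

Import Order.TTheory GRing.Theory Num.Theory.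
Import numFieldNormedType.Exports.

Local Open Scope classical_set_scope.
Local Open Scope complex_scope.
Local Open Scope ring_scope.

(** Two obstacles shape the proof. First, an element of [Diff] is only a continuous operator with a
    support condition, so no finite order is known beforehand. The substitution (r^2 y, r z) is the
    orbit of the torus of G' in the chart, and differentiating the scaling law in the group
    parameter gives Euler's equation in r with exponent nu - lam, for all real r including 0. The
    k-th r-derivative at r = 0 is D applied to a polynomial in y and z whose coefficients are jets
    of phi; this is how finitely many derivatives come out. It requires global sections with
    prescribed germ, hence bump functions, and differentiation of D in a parameter, hence
    convergence of difference quotients in every seminorm of [Coo_topology]. Second, [Ck_on] speaks
    of directional derivatives, which alone give neither a chain rule nor the symmetry of second
    derivatives; smoothness is therefore transferred to Frechet differentiability of germs ([Dk]).
    Calculus is done over [R], so complex sections are carried along as pairs of real and imaginary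
    parts. *)

(** * Frechet differentiability and germs of smooth functions *)

Section Differentiability.
Variable R : realType.
Implicit Types V W : normedModType R.

Lemma differentiable_littleo V W (f : V -> W) (x : V) (L : {linear V -> W}) :
  continuous L ->
  (forall e : R, 0 < e -> \forall h \near (0 : V), `|f (h + x) - f x - L h| <= e * `|h|) ->
  differentiable f x /\ 'd f x = L :> (V -> W).
Proof.
move=> Lc H.
have E : f \o shift x = cst (f x) + L +o_ (0 : V) id.
  apply/eqaddoP => e e0; near=> h.
  rewrite /= !fctE/= opprD addrA.
  by near: h; exact: H.
have dE := diff_unique Lc E; split=> //.
by apply/diff_locallyP; rewrite dE.
Unshelve. all: by end_near. Qed.

Lemma near_eq_differentiable V W (f g : V -> W) (x : V) :
  (\near x, f x = g x) -> differentiable f x -> differentiable g x.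
Proof.
move=> fg df.
have [||//] := @differentiable_littleo V W g x ('d f x).
  exact: diff_continuous.
move=> e e0.
have H2 : \forall h \near (0 : V), `|(f \o shift x - (cst (f x) + 'd f x)) h| <= e * `|h|.
  by have /diff_locally/eqaddoP/(_ e e0) := df.
have : \forall h \near (0 : V), f (h + x) = g (h + x).
  by move: fg; rewrite (near_shift 0 x)/=; apply: filterS => h; rewrite /= subr0.
move=> H1; apply: filterS2 H1 H2 => h h1.
by rewrite -h1 -(nbhs_singleton fg) /= !fctE/= opprD addrA.
Qed.

Lemma differentiable_bigsum V W (I : finType) (f : I -> V -> W) (x : V) :
  (forall i, differentiable (f i) x) -> differentiable (fun y => \sum_i f i y) x.
Proof.
move=> df; rewrite (_ : (fun _ => _) = \sum_i f i); last first.
  by apply/funext => y; rewrite fct_sumE.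
by elim/big_ind : _ => // g h dg dh; exact: differentiableD.
Qed.

Lemma is_derive_bigsum V W (I : finType) (f : I -> V -> W) (df : I -> W) (x v : V) :
  (forall i, is_derive x v (f i) (df i)) ->
  is_derive x v (fun y => \sum_i f i y) (\sum_i df i).
Proof.
move=> H; rewrite (_ : (fun _ => _) = \sum_i f i); last first.
  by apply/funext => y; rewrite fct_sumE.
elim/big_ind2 : _ => // [|g dg h dh Hg Hh]; first exact: is_derive_cst.
exact: is_deriveD.
Qed.

Lemma derive_bigsum V W (I : finType) (f : I -> V -> W) (x v : V) :
  (forall i, differentiable (f i) x) ->
  'D_v (fun y => \sum_i f i y) x = \sum_i 'D_v (f i) x.
Proof.
move=> H; have := @is_derive_bigsum _ _ I f (fun i => 'D_v (f i) x) x v.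
case=> // i; exact/derivableP/diff_derivable.
Qed.

End Differentiability.

Section SmoothGerms.
Variable R : realType.
Implicit Types V W : normedModType R.

(* A pointwise form of being of class C^k; on open sets it agrees with [Ck_on]
   up to a shift of the order by one. *)
Fixpoint Dk V (k : nat) (F : V -> R) (x : V) : Prop :=
  if k is k'.+1 then
    (\forall y \near x, differentiable F y) /\ forall v, Dk k' ('D_v F) x
  else True.

Definition smooth_at V (F : V -> R) (x : V) := forall k, Dk k F x.

Lemma near_eq_Dk V k (F G : V -> R) x :
  (\near x, F x = G x) -> Dk k F x -> Dk k G x.
Proof.
elim: k F G => // k IH F G FG [dF DF]; split.
  by apply: filterS2 (near_join FG) dF => y; exact: near_eq_differentiable.
move=> v; apply: IH (DF v).
by apply: filterS (near_join FG) => y; exact: near_eq_derive.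
Qed.

Lemma DkW V k (F : V -> R) x : Dk k.+1 F x -> Dk k F x.
Proof.
elim: k F => // k IH F [dF DF]; split => // v; exact/IH/DF.
Qed.

Lemma Dk_cst V k (c : R) (x : V) : Dk k (fun=> c) x.
Proof.
elim: k c => // k IH c; split; first by near=> y; exact: differentiable_cst.
move=> v; rewrite (_ : 'D_v _ = fun=> 0) //.
by apply/funext => y; rewrite -[fun=> c]/(cst c) derive_cst.
Unshelve. all: by end_near. Qed.

Lemma DkD V k (F G : V -> R) x : Dk k F x -> Dk k G x -> Dk k (fun y => F y + G y) x.
Proof.
elim: k F G => // k IH F G [dF DF] [dG DG]; split.
  by apply: filterS2 dF dG => y; exact: differentiableD.
move=> v; apply: near_eq_Dk (IH _ _ (DF v) (DG v)).
by apply: filterS2 dF dG => y dF dG; rewrite deriveD//; exact: diff_derivable.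
Qed.

Lemma DkM V k (F G : V -> R) x : Dk k F x -> Dk k G x -> Dk k (fun y => F y * G y) x.
Proof.
elim: k F G => // k IH F G HF HG; have [dF DF] := HF; have [dG DG] := HG; split.
  by apply: filterS2 dF dG => y; exact: differentiableM.
move=> v; apply: (@near_eq_Dk _ _ (fun y => F y * 'D_v G y + G y * 'D_v F y)).
  by apply: filterS2 dF dG => y dF dG; rewrite deriveM//; exact: diff_derivable.
by apply: DkD; apply: IH; [exact: DkW|exact: DG|exact: DkW|exact: DF].
Qed.

Lemma Dk_sum V k (I : finType) (F : I -> V -> R) x :
  (forall i, Dk k (F i) x) -> Dk k (fun y => \sum_i F i y) x.
Proof.
move=> DF; rewrite (_ : (fun _ => _) = \sum_i F i); last first.
  by apply/funext => y; rewrite fct_sumE.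
by elim/big_ind : _ => [|g h dg dh|//]; [exact: Dk_cst|exact: DkD].
Qed.

(** The inner map is given by scalar coordinates along fixed vectors because [Dk] concerns
    real-valued functions only. By the chain rule its derivative is a sum of products of 'D_v (G i)
    with 'D_(e i) F composed with the same inner map, so the induction on k closes. *)
Lemma Dk_comp (I : finType) V W k (F : W -> R) (G : I -> V -> R) (e : I -> W) x :
  Dk k F (\sum_i G i x *: e i) -> (forall i, Dk k (G i) x) ->
  Dk k (fun y => F (\sum_i G i y *: e i)) x.
Proof.
elim: k F => // k IH F [dF DF] HG.
pose H y := \sum_i G i y *: e i.
have dG : \forall y \near x, forall i, differentiable (G i) y.
  by apply: filter_forall => i; exact: (HG i).1.
have dGe y : (forall i, differentiable (G i) y) ->
    forall i, differentiable (fun y => G i y *: e i) y.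
  by move=> dGy i; exact: differentiableZl.
have dH : \forall y \near x, differentiable H y.
  by apply: filterS dG => y dGy; apply: differentiable_bigsum; exact: dGe.
have cH : {for x, continuous H}.
  exact/differentiable_continuous/(nbhs_singleton dH).
have dFH : \forall y \near x, differentiable F (H y) by exact: (cH _ dF).
split.
  by apply: filterS2 dH dFH => y dHy dFy; exact: differentiable_comp.
move=> v.
apply: (@near_eq_Dk _ _ (fun y => \sum_i 'D_v (G i) y * 'D_(e i) F (H y))).
  apply: filterS3 dG dH dFH => y dGy dHy dFy.
  rewrite [RHS]deriveE; last exact: differentiable_comp.
  rewrite (diff_comp dHy dFy)/= -[in RHS](deriveE _ dHy).
  rewrite (derive_bigsum _ (dGe _ dGy)) linear_sum/=; apply: eq_bigr => i _.
  have -> : 'D_v (fun y => G i y *: e i) y = 'D_v (G i) y *: e i.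
    rewrite !deriveE//; last exact: dGe.
    by have /(congr1 (fun f => f v)) := diffZl (e i) (dGy i).
  by rewrite linearZ/= -(deriveE _ dFy).
apply: Dk_sum => i; apply: DkM; first exact: (HG i).2.
apply: (IH ('D_(e i) F)); first exact: DF.
by move=> j; apply/DkW/HG.
Qed.

End SmoothGerms.

Section MeanValue.
Variable R : realType.
Implicit Types V W : normedModType R.

Lemma derive_line V W (F : V -> W) (y v : V) (t : R) :
  derivable F (t *: v + y) v ->
  is_derive t 1 (fun s => F (s *: v + y)) ('D_v F (t *: v + y)).
Proof.
have E : (fun h => h^-1 *: (((fun s => F (s *: v + y)) \o shift t) (h *: 1) - F (t *: v + y)))
  = (fun h : R => h^-1 *: ((F \o shift (t *: v + y)) (h *: v) - F (t *: v + y))).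
  by apply/funext => h /=; rewrite [_%:A]mulr1 scalerDl addrA.
move=> dF; apply: DeriveDef; first by rewrite /derivable E.
by rewrite /derive E.
Qed.

Lemma derive_shiftr V W (F : V -> W) (k y v : V) :
  derivable F (y + k) v ->
  is_derive y v (fun z => F (z + k)) ('D_v F (y + k)).
Proof.
have E : (fun h => h^-1 *: (((fun z => F (z + k)) \o shift y) (h *: v) - F (y + k)))
  = (fun h : R => h^-1 *: ((F \o shift (y + k)) (h *: v) - F (y + k))).
  by apply/funext => h /=; rewrite addrA.
move=> dF; apply: DeriveDef; first by rewrite /derivable E.
by rewrite /derive E.
Qed.

Lemma MVT_line V (F : V -> R) (y v : V) (a : R) :
  (forall t : R, `|t| <= `|a| -> derivable F (t *: v + y) v) ->
  exists c : R, `|c| <= `|a| /\ F (a *: v + y) - F y = 'D_v F (c *: v + y) * a.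
Proof.
move=> dF; pose G s := F (s *: v + y).
have dG (t : R) : `|t| <= `|a| -> is_derive t 1 G ('D_v F (t *: v + y)).
  by move=> ta; apply: derive_line; exact: dF.
have G0 : G 0 = F y by rewrite /G scale0r add0r.
have [a0|a0|->] := ltgtP a 0; last first.
- by exists 0; rewrite lexx scale0r add0r subrr mulr0.
- have [t||c] := @MVT_segment R G (fun t => 'D_v F (t *: v + y)) 0 a (ltW a0).
  + by rewrite in_itv/= => /andP[t0 ta]; apply: dG; rewrite !gtr0_norm// ltW.
  + apply: derivable_within_continuous => t; rewrite in_itv/= => /andP[t0 ta].
    by have [] := dG t; rewrite // !ger0_norm// ltW.
  rewrite in_itv/= => /andP[c0 ca]; rewrite subr0 G0 => E; exists c; split=> //.
  by rewrite !ger0_norm// ltW.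
- have [t||c] := @MVT_segment R G (fun t => 'D_v F (t *: v + y)) a 0 (ltW a0).
  + rewrite in_itv/= => /andP[t0 ta]; apply: dG; rewrite !ltr0_norm// lerN2; exact: ltW.
  + apply: derivable_within_continuous => t; rewrite in_itv/= => /andP[t0 ta].
    by have [] := dG t; rewrite // !ler0_norm// ?lerN2// ltW.
  rewrite in_itv/= => /andP[c0 ca]; rewrite sub0r G0 => E; exists c; split=> //.
    by rewrite !ler0_norm// ?lerN2// ltW.
  by rewrite -opprB E mulrN opprK.
Qed.

Lemma near_ball_norm V (x : V) (P : V -> Prop) : (\forall y \near x, P y) ->
  exists2 r : R, 0 < r & forall h, `|h| < r -> P (h + x).
Proof.
move=> /nbhs_normP[r /= r0 H]; exists r => // h hr; apply: H => /=.
by rewrite opprD addrCA subrr addr0 normrN.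
Qed.

(** As a function of the step in v the second difference is an increment of H y = F (y + t w) - F y.
    One mean value theorem reduces it to increments of 'D_v F, and the differentiability of 'D_v F
    at the single point x estimates these. *)
Lemma second_difference V (F : V -> R) (x v : V) :
  (\forall y \near x, differentiable F y) -> differentiable ('D_v F) x ->
  forall w e, 0 < e -> exists2 d : R, 0 < d & forall t : R, `|t| < d ->
    `|F (t *: v + t *: w + x) - F (t *: v + x) - F (t *: w + x) + F x
      - t ^+ 2 * 'D_w ('D_v F) x| <= e * t ^+ 2.
Proof.
move=> /near_ball_norm[r r0 Hr] dD w e e0.
set L := 'd ('D_v F) x.
(* For |c| <= |t| the norms of c v + t w and c v add up to at most |t| C; the summand 1 makes C
   positive. *)
pose C := 2 * `|v| + `|w| + 1.
have C0 : 0 < C by rewrite ltr_wpDl// addr_ge0// mulr_ge0.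
have [r' r'0 Hr'] : exists2 r' : R, 0 < r' & forall h : V, `|h| < r' ->
    `|'D_v F (h + x) - 'D_v F x - L h| <= (e / C) * `|h|.
  have : \forall h \near (0 : V),
      `|('D_v F \o shift x - (cst ('D_v F x) + L)) h| <= (e / C) * `|h|.
    by have /diff_locally/eqaddoP/(_ (e / C)) := dD; apply; rewrite divr_gt0.
  move=> /near_ball_norm[r' r'0 H]; exists r' => // h /H.
  by rewrite addr0 !fctE/= opprD addrA.
exists (Num.min r r' / C); first by rewrite divr_gt0// lt_min r0.
move=> t; rewrite ltr_pdivlMr// lt_min => /andP[tr tr'].
pose H y := F (y + t *: w) - F y.
have nB (a b : R) : `|a| <= `|t| -> `|b| <= `|t| -> `|a *: v + b *: w| <= `|t| * C.
  move=> at_ bt; rewrite (le_trans (ler_normD _ _))// !normrZ.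
  have := normr_ge0 v; have := normr_ge0 w; have := normr_ge0 t.
  rewrite /C; nra.
have nB0 (a : R) : `|a| <= `|t| -> `|a *: v| <= `|t| * C.
  by move=> at_; have := nB a 0 at_; rewrite scale0r addr0 normr0; apply.
have dF1 (c : R) : `|c| <= `|t| -> differentiable F (c *: v + x).
  by move=> ct; apply: Hr; exact: le_lt_trans (nB0 _ ct) tr.
have dF2 (c : R) : `|c| <= `|t| -> differentiable F (c *: v + x + t *: w).
  move=> ct; rewrite addrAC; apply: Hr; exact: le_lt_trans (nB _ _ ct (lexx _)) tr.
have dH (c : R) : `|c| <= `|t| -> is_derive (c *: v + x) v H
    ('D_v F (c *: v + x + t *: w) - 'D_v F (c *: v + x)).
  move=> ct; apply: is_deriveB.
    by apply: derive_shiftr; apply: diff_derivable; exact: dF2.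
  by apply/derivableP/diff_derivable; exact: dF1.
have [c [ct E]] : exists c : R, `|c| <= `|t| /\ H (t *: v + x) - H x = 'D_v H (c *: v + x) * t.
  by apply: MVT_line => c /dH[].
rewrite (_ : _ - _ + F x = H (t *: v + x) - H x); last first.
  by rewrite /H [t *: v + t *: w + x]addrAC [t *: w + x]addrC; ring.
have [_ dHE] := dH c ct; rewrite E dHE.
have -> : 'D_w ('D_v F) x = L w by rewrite deriveE.
have L1 : L (c *: v + t *: w) - L (c *: v) = t * L w.
  by rewrite linearD/= addrAC subrr add0r linearZ.
have -> : ('D_v F (c *: v + x + t *: w) - 'D_v F (c *: v + x)) * t - t ^+ 2 * L w
  = (('D_v F (c *: v + t *: w + x) - 'D_v F x - L (c *: v + t *: w))
    - ('D_v F (c *: v + x) - 'D_v F x - L (c *: v))) * t.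
  by rewrite expr2 -mulrA -L1 [c *: v + x + t *: w]addrAC; ring.
rewrite normrM (le_trans (ler_wpM2r (normr_ge0 t) (ler_normB _ _)))//.
have H1 := Hr' _ (le_lt_trans (nB _ _ ct (lexx _)) tr').
have H2 := Hr' _ (le_lt_trans (nB0 _ ct) tr').
have -> : e * t ^+ 2 = (e / C) * (`|t| * C) * `|t|.
  by rewrite -(real_normK (num_real t)); field; rewrite gt_eqF.
apply: ler_wpM2r => //.
apply: (le_trans (lerD H1 H2)); rewrite -mulrDr ler_wpM2l//.
  by rewrite ltW// divr_gt0.
rewrite (le_trans (lerD (ler_normD _ _) (lexx _)))// !normrZ.
have := normr_ge0 v; have := normr_ge0 w; have := normr_ge0 t.
rewrite /C; nra.
Qed.

(** Schwarz's theorem: the second difference is symmetric in v and w, and divided by t^2 it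
    approximates both mixed derivatives. *)
Lemma derive_comm V (F : V -> R) (x v w : V) :
  (\forall y \near x, differentiable F y) ->
  differentiable ('D_v F) x -> differentiable ('D_w F) x ->
  'D_w ('D_v F) x = 'D_v ('D_w F) x.
Proof.
move=> dF dv dw; apply/eqP; rewrite -subr_eq0 -normr_le0; apply/ler_addgt0Pl => e e0.
have e20 : 0 < e / 2 by rewrite divr_gt0.
have [d1 d10 H1] := second_difference dF dv w e20.
have [d2 d20 H2] := second_difference dF dw v e20.
pose t := Num.min d1 d2 / 2.
have t0 : 0 < t by rewrite divr_gt0// lt_min d10.
have tm : t < Num.min d1 d2.
  by rewrite ltr_pdivrMr// ltr_pMr ?ltr1n// lt_min d10.
move: (tm); rewrite lt_min => /andP[td1 td2].
move: (H1 t) (H2 t); rewrite gtr0_norm// => /(_ td1) h1 /(_ td2) h2.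
rewrite addr0 -(ler_pM2r (exprn_gt0 2 t0)).
rewrite -[X in `|_| * X](ger0_norm (exprn_ge0 2 (ltW t0))) -normrM.
set A := 'D_w _ x in h1 *; set B := 'D_v _ x in h2 *.
have -> : (A - B) * t ^+ 2 =
 (F (t *: w + t *: v + x) - F (t *: w + x) - F (t *: v + x) + F x - t ^+ 2 * B)
 - (F (t *: v + t *: w + x) - F (t *: v + x) - F (t *: w + x) + F x - t ^+ 2 * A).
  by rewrite [t *: w + t *: v]addrC; ring.
rewrite (le_trans (ler_normB _ _))// (le_trans (lerD h2 h1))// -mulrDl -splitr//.
Qed.

End MeanValue.

Section CkMatrix.
Variables (R : realType) (m n : nat).
Implicit Types (U : set 'M[R]_(m, n)) (F : 'M[R]_(m, n) -> R).

Lemma normr_coord_le (h : 'M[R]_(m, n)) i j : `|h i j| <= `|h|.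
Proof.
rewrite [leRHS]/Num.Def.normr/= mx_normrE.
exact: (le_bigmax _ (fun p : 'I_m * 'I_n => `|h p.1 p.2|) (i, j)).
Qed.

Lemma norm_delta_mx_le i j : `|delta_mx i j : 'M[R]_(m, n)| <= 1.
Proof.
rewrite [leLHS]/Num.Def.normr/= mx_normrE bigmax_le// => p _.
by rewrite mxE; case: (_ && _); rewrite ?normr1 ?normr0.
Qed.

Lemma sum_delta_mx (h : 'M[R]_(m, n)) :
  \sum_(p : 'I_m * 'I_n) h p.1 p.2 *: delta_mx p.1 p.2 = h.
Proof.
by rewrite [RHS]matrix_sum_delta pair_big.
Qed.

(** The classical passage from continuous partial derivatives to differentiability: entries of the
    matrix are changed one at a time, each by the mean value theorem. The list s records the entries
    already changed, which is what the induction runs over. *)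
Lemma Ck1_increment U F x (s : seq ('I_m * 'I_n)) : open U -> Ck_on U 1 F -> U x ->
  forall e, 0 < e -> exists2 d : R, 0 < d & forall h : 'M[R]_(m, n), `|h| < d ->
  `|F (\sum_(p <- s) h p.1 p.2 *: delta_mx p.1 p.2 + x) - F x
    - \sum_(p <- s) h p.1 p.2 * 'D_(delta_mx p.1 p.2) F x| <= e * `|h|.
Proof.
move=> oU [Fc CF] Ux; elim: s => [|p s IH] e e0.
  exists 1 => // h _; rewrite !big_nil add0r !subrr normr0.
  by rewrite mulr_ge0// ltW.
have e20 : 0 < e / 2 by rewrite divr_gt0.
have [d d0 Hd] := IH _ e20.
set v : 'M[R]_(m, n) := delta_mx p.1 p.2.
have [dFv CFv] := CF v.
have [r r0 Hr] := near_ball_norm (open_nbhs_nbhs (conj oU Ux)).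
have [r' r'0 Hr'] : exists2 r' : R, 0 < r' & forall h : 'M[R]_(m, n), `|h| < r' ->
    `|'D_v F (h + x) - 'D_v F x| <= e / 2.
  have /cvgrPdist_le /(_ _ e20) := CFv.1 _ Ux.
  by move=> /near_ball_norm[r' r'0 H]; exists r' => // h /H; rewrite distrC.
(* Each matrix unit has norm at most 1, so the intermediate points lie within |h| C of x. *)
pose C := (size s).+1%:R : R.
have C0 : 0 < C by rewrite ltr0n.
exists (Num.min d (Num.min r r' / C)); first by rewrite lt_min d0 divr_gt0// lt_min r0.
move=> h; rewrite lt_min ltr_pdivlMr// lt_min => /and3P[hd hr hr'].
set y := \sum_(q <- s) h q.1 q.2 *: delta_mx q.1 q.2.
have ny : `|y| <= `|h| * (size s)%:R.
  rewrite /y; elim: s {IH Hd C C0 hr hr' y} => [|q s IH].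
    by rewrite big_nil normr0 mulr0.
  rewrite big_cons /= -natr1 mulrDr mulr1 [leRHS]addrC (le_trans (ler_normD _ _))//.
  rewrite lerD// normrZ (le_trans (ler_wpM2l _ (norm_delta_mx_le _ _)))//.
  by rewrite mulr1 normr_coord_le.
have nc (c : R) : `|c| <= `|h p.1 p.2| -> `|c *: v + y| <= `|h| * C.
  move=> ch; rewrite (le_trans (ler_normD _ _))// /C -natr1 mulrDr mulr1 [leRHS]addrC lerD//.
  rewrite normrZ (le_trans (ler_wpM2l _ (norm_delta_mx_le _ _)))//.
  by rewrite mulr1 (le_trans ch)// normr_coord_le.
rewrite !big_cons -/y -/v.
have [c [ch E]] : exists c : R, `|c| <= `|h p.1 p.2| /\
    F (h p.1 p.2 *: v + (y + x)) - F (y + x) = 'D_v F (c *: v + (y + x)) * h p.1 p.2.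
  by apply: MVT_line => t th; apply: dFv; rewrite addrA; apply/Hr/le_lt_trans/hr/nc.
have -> : F (h p.1 p.2 *: v + y + x) - F x -
    (h p.1 p.2 * 'D_v F x + \sum_(q <- s) h q.1 q.2 * 'D_(delta_mx q.1 q.2) F x)
  = ('D_v F (c *: v + y + x) - 'D_v F x) * h p.1 p.2
    + (F (y + x) - F x - \sum_(q <- s) h q.1 q.2 * 'D_(delta_mx q.1 q.2) F x).
  move: E; rewrite !addrA => E; rewrite mulrBl -E; ring.
rewrite (le_trans (ler_normD _ _))// [e in leRHS]splitr [leRHS]mulrDl lerD//; last exact: Hd.
rewrite normrM ler_pM ?normr_coord_le//; apply: Hr'.
exact: le_lt_trans (nc _ ch) hr'.
Qed.

Lemma Ck1_differentiable U F x : open U -> Ck_on U 1 F -> U x -> differentiable F x.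
Proof.
move=> oU CF Ux.
pose L (h : 'M[R]_(m, n)) := \sum_(p : 'I_m * 'I_n) h p.1 p.2 * 'D_(delta_mx p.1 p.2) F x.
have Llin : linear L.
  move=> a h1 h2; rewrite /L scaler_sumr -big_split/=; apply: eq_bigr => p _.
  by rewrite !mxE mulrDl -mulrA.
pose LM := GRing.isLinear.Build _ _ _ _ _ Llin.
pose LL : {linear _ -> _} := HB.pack L LM.
have Lc : continuous LL.
  move=> h; apply: differentiable_continuous; apply: differentiable_bigsum => p.
  apply: differentiableM; [exact: differentiable_coord|exact: differentiable_cst].
have [|//] := @differentiable_littleo R _ _ F x LL Lc.
move=> e e0; have [d d0 H] := Ck1_increment (index_enum _) oU CF Ux e0.
apply/nbhs_normP; exists d => //= h /=; rewrite sub0r normrN => /H.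
by rewrite sum_delta_mx.
Qed.

Lemma Ck_onW (V : normedModType R) (U : set V) (k : nat) (F : V -> R) :
  Ck_on U k.+1 F -> Ck_on U k F.
Proof.
by elim: k F => [|k IH] F [cF DF]; split => // v; split; [exact: (DF v).1|exact/IH/(DF v).2].
Qed.

Lemma Ck_on_le (V : normedModType R) (U : set V) (j k : nat) (F : V -> R) :
  (j <= k)%N -> Ck_on U k F -> Ck_on U j F.
Proof.
move=> /subnK <-; elim: (k - j)%N => // i IH CF; exact/IH/Ck_onW.
Qed.

Lemma Ck_on_Dk U F k x : open U -> U x -> Ck_on U k F -> Dk k F x.
Proof.
move=> oU; elim: k F => // k IH F Ux CF; split.
  apply: filterS (open_nbhs_nbhs (conj oU Ux)) => y; apply: Ck1_differentiable => //.
  exact: Ck_on_le CF.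
by move=> v; apply: IH => //; exact: (CF.2 v).2.
Qed.

End CkMatrix.

Lemma Dk_Ck_on (R : realType) (V : normedModType R) (U : set V) (F : V -> R) k :
  (forall x, U x -> Dk k.+1 F x) -> Ck_on U k F.
Proof.
elim: k F => [|k IH] F DF.
  by split=> // x /DF[/nbhs_singleton dF _]; exact: differentiable_continuous.
split=> [x /DF[/nbhs_singleton dF _]|v]; first exact: differentiable_continuous.
split=> [x /DF[/nbhs_singleton dF _]|]; first exact: diff_derivable.
by apply: IH => x /DF[_]; apply.
Qed.

Section BasicSmooth.
Variable R : realType.
Implicit Types V W : normedModType R.

Lemma Dk_linear V (L : V -> R) k x : linear L -> continuous L -> Dk k L x.
Proof.
move=> Llin cL.
pose LM := GRing.isLinear.Build _ _ _ _ _ Llin.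
pose LL : {linear _ -> _} := HB.pack L LM.
have dL y : differentiable L y by exact: (@linear_differentiable _ _ _ LL).
case: k => // k; split; first by near=> y; exact: dL.
move=> v; rewrite (_ : 'D_v _ = fun=> L v); first exact: Dk_cst.
by apply/funext => y; rewrite deriveE// (@diff_lin _ _ _ LL).
Unshelve. all: by end_near. Qed.

Lemma Dk_id k (x : R) : Dk k (fun y : R => y) x.
Proof. by apply: Dk_linear => // y. Qed.

Lemma Dk_coord m n k (x : 'M[R]_(m, n)) i j : Dk k (fun y : 'M[R]_(m, n) => y i j) x.
Proof.
apply: Dk_linear; first by move=> a u v; rewrite !mxE.
exact: coord_continuous.
Qed.

Lemma Dk_comp1 V (p : R -> R) (G : V -> R) k x :
  Dk k p (G x) -> Dk k G x -> Dk k (fun y => p (G y)) x.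
Proof.
move=> Dp DG; have E y : \sum_(i < 1) G y *: (1 : R) = G y.
  by rewrite big_ord1 [LHS]mulr1.
have := @Dk_comp R 'I_1 V R k p (fun=> G) (fun=> 1) x.
rewrite E => /(_ Dp (fun=> DG)).
by under [fun y => _]eq_fun do rewrite E.
Qed.

Lemma Dk_comp2 V (F : R * R -> R) (A B : V -> R) k x :
  Dk k F (A x, B x) -> Dk k A x -> Dk k B x -> Dk k (fun y => F (A y, B y)) x.
Proof.
move=> DF DA DB; pose G (b : bool) := if b then A else B.
pose e (b : bool) : R * R := if b then (1, 0) else (0, 1).
have E y : \sum_b G b y *: e b = (A y, B y).
  rewrite big_bool/=; congr pair; rewrite /= ?scaler0 ?addr0 ?add0r; exact: mulr1.
have := @Dk_comp R bool V (R * R)%type k F G e x; rewrite E => /(_ DF).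
under [fun y => F _]eq_fun do rewrite E.
by apply=> -[].
Qed.

(** On the line 'D_v p is v times the ordinary derivative, so inductions for elementary functions
    need to follow one derivative only. *)
Lemma DkS1 (p : R -> R) k x : (\forall y \near x, differentiable p y) ->
  Dk k (derive1 p) x -> Dk k.+1 p x.
Proof.
move=> dp Dp'; split=> // v.
apply: (@near_eq_Dk _ _ _ (fun y => v * derive1 p y)); last first.
  by apply: DkM => //; exact: Dk_cst.
apply: filterS dp => y dp; rewrite deriveE// derive1E' //.
by rewrite -[RHS]/('d p y v) -{2}[v]mulr1 linearZ.
Qed.

Lemma Dk_opp V k (F : V -> R) x : Dk k F x -> Dk k (fun y => - F y) x.
Proof.
move=> DF; apply: (@near_eq_Dk _ _ _ (fun y => -1 * F y)).
  by near=> y; rewrite mulN1r.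
by apply: DkM => //; exact: Dk_cst.
Unshelve. all: by end_near. Qed.

Lemma DkB V k (F G : V -> R) x : Dk k F x -> Dk k G x -> Dk k (fun y => F y - G y) x.
Proof. by move=> DF DG; apply: DkD => //; exact: Dk_opp. Qed.

Lemma Dk_exp V k (F : V -> R) n x : Dk k F x -> Dk k (fun y => F y ^+ n) x.
Proof.
move=> DF; elim: n => [|n IH]; first exact: (Dk_cst _ 1).
by under [fun y => _]eq_fun do rewrite exprS; exact: DkM.
Qed.

Lemma Dk_inv k (x : R) : x != 0 -> Dk k (fun y : R => y^-1) x.
Proof.
move=> x0; elim: k => // k IH.
have nx : \forall y \near x, y != 0 by apply: open_nbhs_nbhs; split => //; exact: open_neq.
apply: DkS1.
  by apply: filterS nx => y y0; exact: differentiable_Rinv.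
apply: (@near_eq_Dk _ _ _ (fun y : R => - (y^-1 * y^-1))); last exact/Dk_opp/DkM.
apply: filterS nx => y y0; rewrite derive1E' ?diff_Rinv//; last exact: differentiable_Rinv.
by rewrite [RHS]mulr1 expr2 invfM.
Qed.

Lemma Dk_expR k (x : R) : Dk k (@expR R) x.
Proof.
elim: k x => // k IH x; apply: DkS1.
  by near=> y; apply/derivable1_diffP/derivable_expR.
rewrite (_ : derive1 _ = @expR R) //; apply/funext => y.
by rewrite derive1E; have /(congr1 (fun f => f y)) := derive_expR R.
Unshelve. all: by end_near. Qed.

Lemma Dk_sin_cos k (x : R) : Dk k (@sin R) x /\ Dk k (@cos R) x.
Proof.
elim: k x => // k IH x; split; apply: DkS1.
- by near=> y; apply/derivable1_diffP; exact: ex_derive.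
- rewrite (_ : derive1 _ = @cos R); first exact: (IH x).2.
  by apply/funext => y; rewrite derive1E derive_val.
- by near=> y; apply/derivable1_diffP; exact: ex_derive.
- rewrite (_ : derive1 _ = fun y => - @sin R y); first by apply: Dk_opp; exact: (IH x).1.
  by apply/funext => y; rewrite derive1E derive_val.
Unshelve. all: by end_near. Qed.

Lemma Dk_ln k (x : R) : 0 < x -> Dk k (@ln R) x.
Proof.
move=> x0; case: k => // k.
have nx : \forall y \near x, 0 < y by exact: lt_nbhsr.
apply: DkS1.
  by apply: filterS nx => y y0; apply/derivable1_diffP; have [] := is_derive1_ln y0.
apply: (@near_eq_Dk _ _ _ (fun y : R => y^-1)); last by apply: Dk_inv; rewrite gt_eqF.
by apply: filterS nx => y y0; rewrite derive1E; have [_ ->] := is_derive1_ln y0.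
Qed.

End BasicSmooth.

(** * Determinants of size two and three, and the matrix exponential *)

Section SmallDeterminants.
Variable R : comRingType.

Lemma det2_nat (f : nat -> nat -> R) :
  \det (\matrix_(i < 2, j < 2) f i j) = f 0 0 * f 1 1 - f 0 1 * f 1 0.
Proof.
rewrite (expand_det_row _ ord0) !big_ord_recl big_ord0 /cofactor !det_mx11 !mxE /=.
rewrite /bump /= !addn0 !add0n /=; ring.
Qed.

Lemma det3_nat (f : nat -> nat -> R) :
  \det (\matrix_(i < 3, j < 3) f i j) =
  f 0 0 * (f 1 1 * f 2 2 - f 1 2 * f 2 1) - f 0 1 * (f 1 0 * f 2 2 - f 1 2 * f 2 0)
  + f 0 2 * (f 1 0 * f 2 1 - f 1 1 * f 2 0).
Proof.
have E j : \det (row' ord0 (col' j (\matrix_(i < 3, j < 3) f i j))) =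
    f 1 (bump j 0) * f 2 (bump j 1) - f 1 (bump j 1) * f 2 (bump j 0).
  rewrite -(det2_nat (fun i k => f i.+1 (bump j k))); congr (\det _).
  by apply/matrixP => i k; rewrite !mxE.
rewrite (expand_det_row _ ord0) !big_ord_recl big_ord0 /cofactor !E.
rewrite !mxE /= /bump /= !addn0 !add0n /=; ring.
Qed.

Lemma det3 (M : 'M[R]_3) : let i0 := inord 0 in let i1 := inord 1 in let i2 := inord 2 in
  \det M = M i0 i0 * (M i1 i1 * M i2 i2 - M i1 i2 * M i2 i1)
    - M i0 i1 * (M i1 i0 * M i2 i2 - M i1 i2 * M i2 i0)
    + M i0 i2 * (M i1 i0 * M i2 i1 - M i1 i1 * M i2 i0).
Proof.
rewrite /= -(det3_nat (fun i j => M (inord i) (inord j))); congr (\det _).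
by apply/matrixP => i j; rewrite !mxE !inord_val.
Qed.

End SmallDeterminants.

Section MatrixExponential.
Variable R : realType.

Lemma cvg_mx_coord (T : Type) (F : set_system T) (FF : Filter F) m n (u : T -> 'M[R]_(m, n)) (L : 'M[R]_(m, n)) :
  (forall i j, u x i j @[x --> F] --> L i j) -> u x @[x --> F] --> L.
Proof.
move=> H A [P HP sPA]; rewrite nbhs_filterE.
have : \forall x \near F, forall i j, P i j (u x i j).
  by apply: filter_forall => i; apply: filter_forall => j; exact: (H i j _ (HP i j)).
by apply: filterS => x Hx; apply: sPA.
Qed.

Lemma expm_sq0 n (X : 'M[R]_n) : X *m X = 0 -> expm X = 1%:M + X.
Proof.
move=> X2; rewrite /expm; apply: lim_near_cst => //.
exists 2%N => // k /= k2; rewrite /series/= -(subnKC k2) big_nat_recl// big_nat_recl//.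
rewrite fact0 factS fact0 muln1 invr1 !scale1r expr0 expr1 big1_seq ?addr0// => i _.
by rewrite !exprS mulrA (_ : X * X = 0) ?mul0r ?scaler0.
Qed.

Lemma expm_diag n (d : 'rV[R]_n) : expm (diag_mx d) = diag_mx (map_mx (@expR R) d).
Proof.
rewrite /expm; apply/cvg_lim => //; apply: cvg_mx_coord => i j.
have Xk k : (diag_mx d) ^+ k = diag_mx (map_mx (fun x => x ^+ k) d).
  elim: k => [|k IH].
    by apply/matrixP => a b; rewrite !mxE expr0.
  rewrite exprS IH; apply/matrixP => a b; rewrite !mxE.
  rewrite (bigD1 a)//= big1 ?addr0 ?mxE ?eqxx ?mulr1n; last first.
    by move=> c ca; rewrite !mxE eq_sym (negbTE ca) mul0r.
  by rewrite mulrnAr exprS.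
rewrite (_ : (fun _ => _) = (fun k => (series (exp_coeff (d 0 i)) k) *+ (i == j))); last first.
  apply/funext => k; rewrite /series/= summxE -sumrMnl; apply: eq_bigr => l _.
  by rewrite Xk !mxE mulrnAr mulrC.
rewrite !mxE; case: (eqVneq i j) => [ij|ij]; last first.
  by rewrite (_ : (fun _ => _) = fun=> 0)//; exact: cvg_cst.
exact: is_cvg_series_exp_coeff.
Qed.

Section Curve.
Variables (n : nat) (X : 'M[R]_n).

(** [P d i j] is the entry (i, j) of X^d exp(t X) as a scalar power series. Keeping d as a parameter
    makes termwise differentiation a shift of d. *)
Let coef (d : nat) i j (k : nat) : R := (k`!%:R)^-1 * (X ^+ (k + d)) i j.
Let P d i j (t : R) := limn (pseries (coef d i j) t).

Let normX_bound k i j : `|(X ^+ k) i j| <= (n%:R * `|X|) ^+ k.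
Proof.
elim: k i j => [|k IH] i j.
  by rewrite expr0 mxE expr0; case: (_ == _); rewrite ?normr1 ?normr0.
rewrite exprS mxE (le_trans (ler_norm_sum _ _ _))//.
rewrite exprS (le_trans (ler_sum _ (G := fun=> `|X| * (n%:R * `|X|) ^+ k) _))//.
  by move=> l _; rewrite normrM ler_pM// normr_coord_le.
by rewrite sumr_const card_ord -[leLHS]mulr_natl mulrA.
Qed.

Let cvg_coef d i j t : cvgn (pseries (coef d i j) t).
Proof.
apply: normed_cvg.
set b := n%:R * `|X|.
have b0 : 0 <= b by rewrite mulr_ge0.
apply: (@series_le_cvg _ _ (fun k => b ^+ d * exp_coeff (b * `|t|) k)).
- by move=> k; exact: normr_ge0.
- by move=> k; rewrite mulr_ge0 ?exprn_ge0// exp_coeff_ge0// mulr_ge0.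
- move=> k; rewrite /coef/exp_coeff/= !normrM normrX.
  rewrite (@ger0_norm _ (_^-1)) ?invr_ge0//.
  apply: (@le_trans _ _ ((k`!%:R)^-1 * b ^+ (k + d) * `|t| ^+ k)).
    by rewrite ler_wpM2r ?exprn_ge0// ler_wpM2l ?invr_ge0// normX_bound.
  by rewrite exprD [(b * _) ^+ k]exprMn le_eqVlt; apply/orP; left; apply/eqP; ring.
- have := @is_cvg_series_exp_coeff _ (b * `|t|).
  by move=> h; exact: (@is_cvg_seriesZ _ _ (b ^+ d) h).
Qed.

Let exprZmx (t : R) k : (t *: X) ^+ k = t ^+ k *: X ^+ k.
Proof.
elim: k => [|k IH]; first by rewrite !expr0 scale1r.
by rewrite !exprS IH -[LHS]/(_ *m _) -scalemxAl -scalemxAr scalerA.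
Qed.

Let expmE t : expm (t *: X) = \matrix_(i, j) P 0 i j t.
Proof.
rewrite /expm; apply/cvg_lim => //; apply: cvg_mx_coord => i j; rewrite mxE.
rewrite (_ : (fun _ => _) = pseries (coef 0 i j) t); first exact: cvg_coef.
apply/funext => k; rewrite /pseries /series/= summxE; apply: eq_bigr => l _.
by rewrite exprZmx scalerA mxE /coef addn0 mulrAC.
Qed.

Lemma is_cvg_expm : cvgn (series (fun k => (k`!%:R)^-1 *: X ^+ k)).
Proof.
apply/cvg_ex; exists (\matrix_(i, j) P 0 i j 1); apply: cvg_mx_coord => i j; rewrite mxE.
rewrite (_ : (fun _ => _) = pseries (coef 0 i j) 1); first exact: cvg_coef.
apply/funext => k; rewrite /pseries /series/= summxE; apply: eq_bigr => l _.
by rewrite mxE expr1n mulr1 /coef addn0.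
Qed.

Let P_derive d i j (t : R) : is_derive t 1 (P d i j) (P d.+1 i j t).
Proof.
have E e : pseries_diffs (coef e i j) = coef e.+1 i j.
  apply/funext => k; rewrite /pseries_diffs /coef addnS mulrA; congr (_ * _).
  by rewrite factS natrM invfM mulrA divff ?mul1r// pnatr_eq0.
have := @pseries_snd_diffs R (coef d i j) (`|t| + 1) t; rewrite !E; apply.
- exact: cvg_coef.
- exact: cvg_coef.
- exact: cvg_coef.
- by rewrite [ltRHS]ger0_norm ?ltrDl// addr_ge0.
Qed.

Let P_mul d i j t : P d.+1 i j t = \sum_l P d i l t * X l j.
Proof.
rewrite /P; apply/cvg_lim => //.
rewrite (_ : pseries (coef d.+1 i j) t =
    fun k => \sum_l pseries (coef d i l) t k * X l j); last first.
  apply/funext => k; rewrite /pseries/series/=.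
  under [RHS]eq_bigr do rewrite mulr_suml.
  rewrite exchange_big/=; apply: eq_bigr => m _.
  rewrite /coef addnS exprSr mxE mulr_sumr mulr_suml; apply: eq_bigr => l _.
  by ring.
apply: cvg_big => [|l _]; first exact: add_continuous.
by apply: cvgMr_tmp; exact: cvg_coef.
Qed.

Lemma is_derive_expm_coord i j (t : R) :
  is_derive t 1 (fun s => expm (s *: X) i j) ((expm (t *: X) *m X) i j).
Proof.
rewrite (_ : (fun s => _) = P 0 i j); last by apply/funext => s; rewrite expmE mxE.
rewrite (_ : (_ *m _) i j = P 1 i j t)//.
by rewrite P_mul mxE; apply: eq_bigr => l _; rewrite expmE mxE.
Qed.

Lemma expm0 : expm (0 *: X) = 1%:M.
Proof. by rewrite scale0r expm_sq0 ?addr0// mul0mx. Qed.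

End Curve.

(** Jacobi's formula: the derivative of det exp(s X) is tr X times the determinant, hence zero, and
    the value at 0 is 1. With the determinant written as a polynomial in the entries, the formula is
    an identity for [ring]. *)
Lemma det_expm3 (X : 'M[R]_3) (t : R) : \tr X = 0 -> \det (expm (t *: X)) = 1.
Proof.
move=> trX; pose e i j (s : R) := expm (s *: X) (inord i) (inord j).
pose D (s : R) := e 0 0 s * (e 1 1 s * e 2 2 s - e 1 2 s * e 2 1 s)
    - e 0 1 s * (e 1 0 s * e 2 2 s - e 1 2 s * e 2 0 s)
    + e 0 2 s * (e 1 0 s * e 2 1 s - e 1 1 s * e 2 0 s).
pose x i j : R := X (inord i) (inord j).
have de i j (s : R) : is_derive s 1 (e i j) (e i 0 s * x 0 j + e i 1 s * x 1 j + e i 2 s * x 2 j).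
  have := is_derive_expm_coord X (inord i) (inord j) s.
  rewrite mxE (eq_bigr (fun l : 'I_3 => e i l s * x l j)); last first.
    by move=> l _; rewrite /e /x !inord_val.
  by rewrite !big_ord_recl big_ord0 addr0 addrA.
have trx : x 0 0 + x 1 1 + x 2 2 = 0.
  rewrite -trX /mxtrace (eq_bigr (fun l : 'I_3 => x l l)); last first.
    by move=> l _; rewrite /x !inord_val.
  by rewrite !big_ord_recl big_ord0 addr0 addrA.
have dD (s : R) : is_derive s 1 D 0.
  rewrite -(mul0r (D s)) -trx.
  apply: is_derive_eq; rewrite /D /GRing.scale/=; ring.
have -> : \det (expm (t *: X)) = D t by rewrite det3.
rewrite (is_derive_0_is_cst t 0 dD).
have -> : D 0 = \det (expm (0 *: X)) by rewrite det3.
by rewrite expm0 det1.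
Qed.

End MatrixExponential.

(** * Smooth functions and Lie derivatives on SL(n,R) *)

Section AffineComposition.
Variable R : realType.

Lemma derive_delta m n (F : 'M[R]_(m, n) -> R) (x w : 'M[R]_(m, n)) : differentiable F x ->
  'D_w F x = \sum_(p : 'I_m * 'I_n) w p.1 p.2 * 'D_(delta_mx p.1 p.2) F x.
Proof.
move=> dF; rewrite deriveE// -[in LHS](sum_delta_mx w) linear_sum/=.
by apply: eq_bigr => p _; rewrite linearZ/= deriveE.
Qed.

Lemma smooth_at_affine m n (W : normedModType R) (F : W -> R)
    (L : 'M[R]_(m, n) -> W) (e0 : W) (e : 'I_m * 'I_n -> W) x :
  (forall y, L y = e0 + \sum_p y p.1 p.2 *: e p) ->
  smooth_at F (L x) -> smooth_at (fun y => F (L y)) x.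
Proof.
move=> LE DF k.
(* The additional index carries the constant term, with coefficient function 1, so that [Dk_comp]
   covers affine maps. *)
pose e' (q : unit + 'I_m * 'I_n) := match q with inl _ => e0 | inr p => e p end.
pose G (q : unit + 'I_m * 'I_n) (y : 'M[R]_(m, n)) : R :=
  match q with inl _ => 1 | inr p => y p.1 p.2 end.
have E y : \sum_q G q y *: e' q = L y.
  by rewrite LE big_sumType/= (big_pred1 tt) ?scale1r// => -[].
have := @Dk_comp R _ _ W k F G e' x; rewrite E => /(_ (DF k)).
under [fun y => F _]eq_fun do rewrite E.
by apply=> -[u|p]; [exact: Dk_cst|exact: Dk_coord].
Qed.

Lemma continuous_affine m n p q (L : 'M[R]_(m, n) -> 'M[R]_(p, q)) e0 e :
  (forall y, L y = e0 + \sum_p y p.1 p.2 *: e p) -> continuous L.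
Proof.
move=> LE x; apply: differentiable_continuous.
have -> : L = fun y => e0 + \sum_p y p.1 p.2 *: e p by apply/funext.
apply: differentiableD; first exact: differentiable_cst.
apply: differentiable_bigsum => r; apply: differentiableZl; exact: differentiable_coord.
Qed.

End AffineComposition.

Section SLBasics.
Variables (R : realType) (n : nat).
Implicit Types (f : SL R n -> R[i]^o) (g : SL R n) (X : 'M[R]_n).

Lemma continuous_SLmx : continuous (@SLmx R n).
Proof. exact: initial_continuous. Qed.

Lemma SLmxM g h : SLmx (g * h)%g = SLmx g *m SLmx h.
Proof. by []. Qed.

Lemma SLmx1 : SLmx (1%g : SL R n) = 1%:M.
Proof. by []. Qed.

Lemma extend0_mkSL f x (hx : \det x = 1) : extend0 f x = f (mkSL hx).
Proof.
rewrite /extend0; case: pselect => // hx'; congr f; exact: SLmx_inj.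
Qed.

Lemma extend0_SL f g : extend0 f (SLmx g) = f g.
Proof.
by rewrite (extend0_mkSL f (det_SL g)); congr f; exact: SLmx_inj.
Qed.

Lemma extend0_off f x : \det x <> 1 -> extend0 f x = 0.
Proof. by rewrite /extend0; case: pselect. Qed.

Lemma lie_derive_ltranslate X f g :
  lie_derive X (ltranslate g f) = ltranslate g (lie_derive X f).
Proof.
have E x : extend0 (ltranslate g f) x = extend0 f (invmx (SLmx g) *m x).
  have [dx|dx] := pselect (\det x = 1).
    rewrite (extend0_mkSL _ dx) /ltranslate -(extend0_SL f); congr extend0.
  rewrite extend0_off// extend0_off//.
  by rewrite det_mulmx det_inv det_SL invr1 mul1r.
by apply/funext => h; rewrite /lie_derive; under eq_fun do rewrite E mulmxA;
  under [in X in _ +i* X]eq_fun do rewrite E mulmxA.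
Qed.

Lemma lie_jet_ltranslate (w : seq (@sl R n)) f g :
  lie_jet (ltranslate g f) w = ltranslate g (lie_jet f w).
Proof. by elim: w => //= X w IH; rewrite -lie_derive_ltranslate -IH. Qed.

(** The curve g exp(t X) must stay in the group. This is kept as a hypothesis for general n, since
    the determinant of the exponential is computed in size three only. *)
Definition unimodular X := forall t : R, \det (expm (t *: X)) = 1.

Lemma is_derive_curve (g X : 'M[R]_n) :
  is_derive (0 : R) 1 (fun t => g *m expm (t *: X)) (g *m X).
Proof.
have dE i j : is_derive (0 : R) 1 (fun t => (g *m expm (t *: X)) i j) ((g *m X) i j).
  under eq_fun do rewrite mxE; rewrite mxE.
  apply: is_derive_bigsum => l.
  have := is_derive_expm_coord X l j 0; rewrite expm0 mul1mx => H.
  exact: (@is_deriveZ _ _ _ (fun s : R => expm (s *: X) l j) (g i l)).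
have dM : derivable (fun t : R => g *m expm (t *: X)) 0 1.
  by apply/derivable_mxP => i j; have [] := dE i j.
apply: DeriveDef => //; rewrite derive_mx//; apply/matrixP => i j.
by rewrite mxE; have [_ ->] := dE i j.
Qed.

Lemma derive_along_curve (g X : 'M[R]_n) (F : 'M[R]_n -> R) : differentiable F g ->
  is_derive (0 : R) 1 (fun t => F (g *m expm (t *: X))) ('D_(g *m X) F g).
Proof.
move=> dF; have [dc vc] := is_derive_curve g X.
have dc' := (derivable1_diffP _ _).1 dc.
have g0 : g *m expm (0 *: X) = g by rewrite expm0 mulmx1.
have dF' : differentiable F (g *m expm (0 *: X)) by rewrite g0.
have dFc := differentiable_comp dc' dF'.
apply: DeriveDef; first exact: diff_derivable.
rewrite deriveE// (diff_comp dc' dF')/=.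
by rewrite g0 -[in RHS]vc [RHS]deriveE// [in RHS]deriveE.
Qed.

(** The curve stays in SL(n,R), so along it [extend0 f] agrees with the ambient functions, whose
    derivative is found by the chain rule with velocity g X. *)
Lemma lie_deriveE X f g (F1 F2 : 'M[R]_n -> R) : unimodular X ->
  differentiable F1 (SLmx g) -> differentiable F2 (SLmx g) ->
  (\forall x \near SLmx g, forall h, SLmx h = x -> f h = F1 x +i* F2 x) ->
  lie_derive X f g =
    'D_(SLmx g *m X) F1 (SLmx g) +i* 'D_(SLmx g *m X) F2 (SLmx g).
Proof.
move=> uX dF1 dF2 Hf.
have cc : (fun t : R => SLmx g *m expm (t *: X)) t @[t --> 0] --> SLmx g.
  have [/derivable1_diffP/differentiable_continuous] := is_derive_curve (SLmx g) X.
  by move=> + _; rewrite /continuous_at /prop_for/= expm0 mulmx1.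
have H : \forall t \near (0 : R), extend0 f (SLmx g *m expm (t *: X)) =
    F1 (SLmx g *m expm (t *: X)) +i* F2 (SLmx g *m expm (t *: X)).
  have H0 : \forall t \near (0 : R), forall h, SLmx h = SLmx g *m expm (t *: X) ->
      f h = F1 (SLmx g *m expm (t *: X)) +i* F2 (SLmx g *m expm (t *: X)) by exact: (cc _ Hf).
  apply: filterS H0 => t Ht.
  have dt : \det (SLmx g *m expm (t *: X)) = 1 by rewrite det_mulmx det_SL uX mulr1.
  by rewrite (extend0_mkSL _ dt); exact: Ht.
rewrite /lie_derive; congr (_ +i* _); rewrite derive1E.
- have [_ <-] := derive_along_curve X dF1.
  by apply: near_eq_derive; apply: filterS H => t ->.
- have [_ <-] := derive_along_curve X dF2.
  by apply: near_eq_derive; apply: filterS H => t ->.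
Qed.

Definition local_rep f (U : set 'M[R]_n) (F1 F2 : 'M[R]_n -> R) :=
  [/\ open U, forall x, U x -> smooth_at F1 x, forall x, U x -> smooth_at F2 x &
    forall h, U (SLmx h) -> f h = F1 (SLmx h) +i* F2 (SLmx h)].

Lemma smoothP f :
  smooth f <-> forall g, exists U F1 F2, U (SLmx g) /\ local_rep f U F1 F2.
Proof.
split=> sf g.
  have [U [oU Ug [F1 [F2 [C1 C2 fE]]]]] := sf g.
  exists U, F1, F2; split=> //; split=> // x Ux k; exact: Ck_on_Dk (C1 k) || exact: Ck_on_Dk (C2 k).
have [U [F1 [F2 [Ug [oU S1 S2 fE]]]]] := sf g.
exists U; split=> //; exists F1, F2; split=> // k; apply: Dk_Ck_on => x Ux.
  exact: S1.
exact: S2.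
Qed.

Lemma smooth_at_differentiable (V : normedModType R) (F : V -> R) x :
  smooth_at F x -> differentiable F x.
Proof. by move=> /(_ 1)[/nbhs_singleton]. Qed.

Lemma local_rep_lie_deriveE X f g U F1 F2 : unimodular X -> U (SLmx g) ->
  local_rep f U F1 F2 -> lie_derive X f g =
    'D_(SLmx g *m X) F1 (SLmx g) +i* 'D_(SLmx g *m X) F2 (SLmx g).
Proof.
move=> uX Ug [oU S1 S2 fE]; apply: lie_deriveE => //.
- exact/smooth_at_differentiable/S1.
- exact/smooth_at_differentiable/S2.
- by apply: filterS (open_nbhs_nbhs (conj oU Ug)) => x Ux h hx; rewrite fE hx.
Qed.

(** The direction y X varies with the point y, while [Dk] only has fixed directions; the derivative
    is therefore expanded along the matrix units, with coefficients linear in y. *)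
Lemma smooth_at_derive_mul (U : set 'M[R]_n) X F : open U ->
  (forall x, U x -> smooth_at F x) ->
  forall x, U x -> smooth_at (fun y => 'D_(y *m X) F y) x.
Proof.
move=> oU S x Ux k.
apply: (@near_eq_Dk _ _ _ (fun y : 'M[R]_n => \sum_(p : 'I_n * 'I_n)
    (\sum_l y p.1 l * X l p.2) * 'D_(delta_mx p.1 p.2) F y)).
  apply: filterS (open_nbhs_nbhs (conj oU Ux)) => y Uy.
  rewrite [RHS]derive_delta; last exact/smooth_at_differentiable/S.
  by apply: eq_bigr => p _; rewrite mxE.
apply: Dk_sum => p; apply: DkM; last exact: (S x Ux k.+1).2.
by apply: Dk_sum => l; apply: DkM; [exact: Dk_coord|exact: Dk_cst].
Qed.

Lemma local_rep_lie_derive X f U F1 F2 : unimodular X -> local_rep f U F1 F2 ->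
  local_rep (lie_derive X f) U (fun y => 'D_(y *m X) F1 y) (fun y => 'D_(y *m X) F2 y).
Proof.
move=> uX rep; have [oU S1 S2 fE] := rep; split=> //.
- exact: smooth_at_derive_mul.
- exact: smooth_at_derive_mul.
- by move=> h Uh; exact: local_rep_lie_deriveE rep.
Qed.

Lemma smooth_lie_derive X f : unimodular X -> smooth f -> smooth (lie_derive X f).
Proof.
move=> uX /smoothP sf; apply/smoothP => g; have [U [F1 [F2 [Ug rep]]]] := sf g.
by exists U; do 2 eexists; split; [|exact: local_rep_lie_derive rep].
Qed.

Lemma local_rep_comb (c : R[i]) f f' U U' F1 F2 F1' F2' :
  local_rep f U F1 F2 -> local_rep f' U' F1' F2' ->
  local_rep (c *: f + f') (U `&` U')
    (fun x => complex.Re c * F1 x - complex.Im c * F2 x + F1' x)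
    (fun x => complex.Re c * F2 x + complex.Im c * F1 x + F2' x).
Proof.
move=> [oU S1 S2 fE] [oU' S1' S2' fE']; split.
- exact: openI.
- move=> x [Ux Ux'] k; apply: DkD; last exact: S1'.
  apply: DkB; apply: DkM; do ?exact: Dk_cst; [exact: S1|exact: S2].
- move=> x [Ux Ux'] k; apply: DkD; last exact: S2'.
  apply: DkD; apply: DkM; do ?exact: Dk_cst; [exact: S2|exact: S1].
- move=> h [Uh Uh']; rewrite fctE/= fctE/= (fE _ Uh) (fE' _ Uh').
  by case: c => a b; simpc.
Qed.

Lemma smooth_comb (c : R[i]) f f' : smooth f -> smooth f' -> smooth (c *: f + f').
Proof.
move=> /smoothP sf /smoothP sf'; apply/smoothP => g.
have [U [F1 [F2 [Ug rep]]]] := sf g; have [U' [F1' [F2' [Ug' rep']]]] := sf' g.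
exists (U `&` U'); do 2 eexists; split; [by split|exact: (local_rep_comb c rep rep')].
Qed.

Lemma lie_derive_comb X (c : R[i]) f f' : unimodular X -> smooth f -> smooth f' ->
  lie_derive X (c *: f + f') = c *: lie_derive X f + lie_derive X f'.
Proof.
move=> uX /smoothP sf /smoothP sf'; apply/funext => g.
have [U [F1 [F2 [Ug rep]]]] := sf g; have [U' [F1' [F2' [Ug' rep']]]] := sf' g.
have rep2 := local_rep_comb c rep rep'.
rewrite (local_rep_lie_deriveE uX (conj Ug Ug') rep2) fctE/= fctE/=.
rewrite (local_rep_lie_deriveE uX Ug rep) (local_rep_lie_deriveE uX Ug' rep').
have [_ S1 S2 _] := rep; have [_ S1' S2' _] := rep'.
have d1 := smooth_at_differentiable (S1 _ Ug).
have d2 := smooth_at_differentiable (S2 _ Ug).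
have d1' := smooth_at_differentiable (S1' _ Ug').
have d2' := smooth_at_differentiable (S2' _ Ug').
set w := SLmx g *m X; set x := SLmx g.
have E (a b : R) (A B C : 'M[R]_n -> R) : differentiable A x -> differentiable B x ->
    differentiable C x -> 'D_w (fun y => a * A y + b * B y + C y) x =
    a * 'D_w A x + b * 'D_w B x + 'D_w C x.
  move=> /(@diff_derivable _ _ _ _ _ w) dA /(@diff_derivable _ _ _ _ _ w) dB.
  move=> /(@diff_derivable _ _ _ _ _ w) dC.
  have Z k D : derivable D x w -> is_derive x w (k *: D) (k * 'D_w D x).
    by move=> /derivableP dD; apply: is_deriveZ.
  rewrite (_ : (fun y => _) = a *: A + b *: B + C)//.
  have := is_deriveD (is_deriveD (Z a _ dA) (Z b _ dB)) (derivableP dC).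
  by case.
have -> : (fun y => complex.Re c * F1 y - complex.Im c * F2 y + F1' y) =
    (fun y => complex.Re c * F1 y + (- complex.Im c) * F2 y + F1' y).
  by apply/funext => y; rewrite mulNr.
rewrite !E//; case: c {rep2} => a b /=.
by rewrite mulNr.
Qed.

Lemma smooth_ltranslate g f : smooth f -> smooth (ltranslate g f).
Proof.
move=> /smoothP sf; apply/smoothP => h.
have [U [F1 [F2 [Uh [oU S1 S2 fE]]]]] := sf (g^-1 * h)%g.
pose L (y : 'M[R]_n) := SLmx g^-1%g *m y.
have LE y : L y = 0 + \sum_p y p.1 p.2 *: (SLmx g^-1%g *m delta_mx p.1 p.2).
  rewrite /L add0r -[in LHS](sum_delta_mx y) mulmx_sumr.
  by apply: eq_bigr => p _; rewrite -scalemxAr.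
exists (L @^-1` U), (fun y => F1 (L y)), (fun y => F2 (L y)); split=> //; split.
- by move/continuousP : (continuous_affine LE); apply.
- by move=> x Ux; apply: (smooth_at_affine LE); exact: S1.
- by move=> x Ux; apply: (smooth_at_affine LE); exact: S2.
- by move=> k Uk; rewrite /ltranslate fE.
Qed.

End SLBasics.

(** * The topology of smooth functions through seminorms *)

Section ComplexNear.
Variable R : realType.

(** The norm of [R[i]] takes values in [R[i]]; comparing real and imaginary parts keeps every
    estimate in [R]. *)
Definition cnear (e : R) (z w : R[i]) :=
  `|complex.Re z - complex.Re w| < e /\ `|complex.Im z - complex.Im w| < e.

Lemma normc_le_ReIm (z : R[i]) :
  `|z| <= (`|complex.Re z| + `|complex.Im z|)%:C.
Proof.
rewrite {1}(complexE z) (le_trans (ler_normD _ _))// normrM rmorphD/=.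
have r (x : R) : `|x%:C| = `|x|%:C.
  by rewrite normc_def/= expr0n/= addr0 sqrtr_sqr.
rewrite !r lerD// (_ : `|'i%C : R[i]| = 1) ?mul1r//.
by rewrite normc_def/= expr0n/= add0r expr1n sqrtr1.
Qed.

Lemma normr_ReIm_le (z : R[i]) (e : R) : `|z| < e%:C ->
  `|complex.Re z| < e /\ `|complex.Im z| < e.
Proof.
rewrite normc_def ltcR => H; split; apply: le_lt_trans H; rewrite -sqrtr_sqr ler_wsqrtr//.
  by rewrite lerDl sqr_ge0.
by rewrite lerDr sqr_ge0.
Qed.

Lemma entourage_cnear (e : R) : 0 < e ->
  entourage [set p : R[i]^o * R[i]^o | cnear e p.1 p.2].
Proof.
move=> e0; rewrite -entourage_ballE; exists e%:C; first by rewrite /= ltcR.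
move=> [z w] /=; rewrite -ball_normE /= => /normr_ReIm_le.
by case: z => a b; case: w.
Qed.

Lemma entourage_cnearP (E : set (R[i]^o * R[i]^o)) : entourage E ->
  exists2 e : R, 0 < e & forall z w, cnear e z w -> E (z, w).
Proof.
rewrite -entourage_ballE => -[/= d d0 sE].
have dE : d = (complex.Re d)%:C by rewrite RRe_real// gtr0_real.
have d0' : 0 < complex.Re d by rewrite -ltcR -dE.
exists (complex.Re d / 2); first by rewrite divr_gt0.
move=> z w [H1 H2]; apply: sE => /=; rewrite -ball_normE /=.
apply: (le_lt_trans (normc_le_ReIm _)); rewrite dE ltcR [ltRHS]splitr.
by case: z w H1 H2 => [a b] [a' b'] /= H1 H2; rewrite ltrD.
Qed.

End ComplexNear.

Section SmoothTopology.
Variables (R : realType) (n : nat).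

Lemma cvg_initial (S : choiceType) (T : topologicalType) (phi : S -> T)
    (F : set_system S) (s : S) : Filter F ->
  phi @ F --> phi s -> F --> (s : initial_topology phi).
Proof.
move=> FF H A [_ [[B Bop <-] Bs sBA]]; apply: (filterS sBA).
by apply: H; exact: open_nbhs_nbhs.
Qed.

(** Unwinds the three layers of the topology: initial for [lie_jet], product over words, uniform on
    compact sets. Later continuity arguments use this form. *)
Lemma Coo_cvgP (F : set_system (Coo_topology R n)) (f : Coo_topology R n) : Filter F ->
  F --> f <-> (forall w (K : set (SL R n)) e, compact K -> 0 < e ->
    \forall h \near F, forall x, K x -> cnear e (lie_jet f w x) (lie_jet h w x)).
Proof.
move=> FF; split=> [Ff w K e cK e0|H].
  have c1 := cvg_comp _ _ Ff (@initial_continuous _ _ (@lie_jet R n) f).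
  have c2 := cvg_comp _ _ c1 (@proj_continuous _ (fun=> {family compact, SL R n -> R[i]^o}) w _).
  have /fam_cvgP/(_ K cK) c3 := c2.
  have := c3 [set h | forall x, K x -> cnear e (lie_jet f w x) (h x)].
  by apply; apply/uniform_nbhs; exists [set p | cnear e p.1 p.2]; split=> //; exact: entourage_cnear.
apply: cvg_initial; apply/cvg_sup => w; apply: cvg_initial; apply/fam_cvgP => K cK P.
move=> /uniform_nbhs[E [/entourage_cnearP[e e0 eE] sP]].
apply: filterS (H w K e cK e0) => h Hh; apply: sP => x Kx.
by apply: eE; exact: Hh.
Qed.

End SmoothTopology.

(** * Explicit matrices and the description of the induced representations by homogeneity *)

Section Mat.
Variable R : comRingType.

Definition mat2 (a b c d : R) : 'M[R]_2 :=
  \matrix_(i, j) nth 0 (nth [::] [:: [:: a; b]; [:: c; d]] i) j.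

Definition mat3 (a b c d e f g h i : R) : 'M[R]_3 :=
  \matrix_(x, y) nth 0 (nth [::] [:: [:: a; b; c]; [:: d; e; f]; [:: g; h; i]] x) y.

Definition o0 : 'I_3 := @Ordinal 3 0 isT.
Definition o1 : 'I_3 := @Ordinal 3 1 isT.
Definition o2 : 'I_3 := @Ordinal 3 2 isT.
Definition q0 : 'I_2 := @Ordinal 2 0 isT.
Definition q1 : 'I_2 := @Ordinal 2 1 isT.

Lemma ord3P (P : 'I_3 -> Prop) : P o0 -> P o1 -> P o2 -> forall i, P i.
Proof.
move=> p0 p1 p2 [[|[|[|i]]] Hi] //.
- by rewrite (_ : Ordinal Hi = o0)//; apply: val_inj.
- by rewrite (_ : Ordinal Hi = o1)//; apply: val_inj.
- by rewrite (_ : Ordinal Hi = o2)//; apply: val_inj.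
Qed.

Lemma ord2P (P : 'I_2 -> Prop) : P q0 -> P q1 -> forall i, P i.
Proof.
move=> p0 p1 [[|[|i]] Hi] //.
- by rewrite (_ : Ordinal Hi = q0)//; apply: val_inj.
- by rewrite (_ : Ordinal Hi = q1)//; apply: val_inj.
Qed.

Lemma sum3 (F : 'I_3 -> R) : \sum_i F i = F o0 + F o1 + F o2.
Proof.
rewrite !big_ord_recl big_ord0 addr0 addrA.
by congr (F _ + F _ + F _); apply: val_inj.
Qed.

Lemma sum2 (F : 'I_2 -> R) : \sum_i F i = F q0 + F q1.
Proof.
by rewrite !big_ord_recl big_ord0 addr0; congr (F _ + F _); apply: val_inj.
Qed.

Lemma mat3E (M : 'M[R]_3) : M = mat3 (M o0 o0) (M o0 o1) (M o0 o2)
  (M o1 o0) (M o1 o1) (M o1 o2) (M o2 o0) (M o2 o1) (M o2 o2).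
Proof. by apply/matrixP; apply: ord3P; apply: ord3P; rewrite !mxE. Qed.

Lemma mat2E (M : 'M[R]_2) : M = mat2 (M q0 q0) (M q0 q1) (M q1 q0) (M q1 q1).
Proof. by apply/matrixP; apply: ord2P; apply: ord2P; rewrite !mxE. Qed.

Lemma mul_mat3 a b c d e f g h i a' b' c' d' e' f' g' h' i' :
  mat3 a b c d e f g h i *m mat3 a' b' c' d' e' f' g' h' i' =
  mat3 (a * a' + b * d' + c * g') (a * b' + b * e' + c * h') (a * c' + b * f' + c * i')
       (d * a' + e * d' + f * g') (d * b' + e * e' + f * h') (d * c' + e * f' + f * i')
       (g * a' + h * d' + i * g') (g * b' + h * e' + i * h') (g * c' + h * f' + i * i').
Proof. by apply/matrixP; apply: ord3P; apply: ord3P; rewrite !mxE sum3 !mxE. Qed.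

Lemma mul_mat2 a b c d a' b' c' d' :
  mat2 a b c d *m mat2 a' b' c' d' =
  mat2 (a * a' + b * c') (a * b' + b * d') (c * a' + d * c') (c * b' + d * d').
Proof. by apply/matrixP; apply: ord2P; apply: ord2P; rewrite !mxE sum2 !mxE. Qed.

Lemma det_mat3 a b c d e f g h i : \det (mat3 a b c d e f g h i) =
  a * (e * i - f * h) - b * (d * i - f * g) + c * (d * h - e * g).
Proof.
exact: (det3_nat (fun x y => nth 0 (nth [::] [:: [:: a; b; c]; [:: d; e; f]; [:: g; h; i]] x) y)).
Qed.

Lemma det_mat2 a b c d : \det (mat2 a b c d) = a * d - b * c.
Proof.
exact: (det2_nat (fun x y => nth 0 (nth [::] [:: [:: a; b]; [:: c; d]] x) y)).
Qed.

Lemma block_mat12 x (h : 'M[R]_2) : block_mx x%:M 0 0 h =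
  mat3 x 0 0 0 (h q0 q0) (h q0 q1) 0 (h q1 q0) (h q1 q1) :> 'M[R]_(1 + 2).
Proof.
pose l := @lshift 1 2 ord0; pose r (i : 'I_2) := @rshift 1 2 i.
have -> : (block_mx x%:M 0 0 h : 'M[R]_(1 + 2)) =
  mat3 (block_mx x%:M 0 0 h l l) (block_mx x%:M 0 0 h l (r q0)) (block_mx x%:M 0 0 h l (r q1))
  (block_mx x%:M 0 0 h (r q0) l) (block_mx x%:M 0 0 h (r q0) (r q0)) (block_mx x%:M 0 0 h (r q0) (r q1))
  (block_mx x%:M 0 0 h (r q1) l) (block_mx x%:M 0 0 h (r q1) (r q0)) (block_mx x%:M 0 0 h (r q1) (r q1)).
  rewrite [LHS]mat3E.
  have -> : o0 = l by apply: val_inj.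
  have -> : o1 = r q0 by apply: val_inj.
  by have -> : o2 = r q1 by apply: val_inj.
by rewrite !block_mxEul !block_mxEur !block_mxEdl !block_mxEdr !mxE.
Qed.

Lemma block_mat21 (h : 'M[R]_2) (x : 'M[R]_1) : block_mx h 0 0 x =
  mat3 (h q0 q0) (h q0 q1) 0 (h q1 q0) (h q1 q1) 0 0 0 (x ord0 ord0) :> 'M[R]_(2 + 1).
Proof.
pose r := @rshift 2 1 ord0; pose l (i : 'I_2) := @lshift 2 1 i.
have -> : (block_mx h 0 0 x : 'M[R]_(2 + 1)) =
  mat3 (block_mx h 0 0 x (l q0) (l q0)) (block_mx h 0 0 x (l q0) (l q1)) (block_mx h 0 0 x (l q0) r)
   (block_mx h 0 0 x (l q1) (l q0)) (block_mx h 0 0 x (l q1) (l q1)) (block_mx h 0 0 x (l q1) r)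
   (block_mx h 0 0 x r (l q0)) (block_mx h 0 0 x r (l q1)) (block_mx h 0 0 x r r).
  rewrite [LHS]mat3E.
  have -> : o0 = l q0 by apply: val_inj.
  have -> : o1 = l q1 by apply: val_inj.
  by have -> : o2 = r by apply: val_inj.
by rewrite !block_mxEul !block_mxEur !block_mxEdl !block_mxEdr !mxE.
Qed.

End Mat.

Section Homogeneity.
Variable R : realType.
Implicit Types (lam : R[i]) (alpha : bool) (c d : R).

Lemma cexpD (z w : R[i]) : cexp (z + w) = cexp z * cexp w.
Proof.
case: z w => [a b] [a' b']; rewrite /cexp/= expRD cosD sinD; simpc.
by congr (_ +i* _); ring.
Qed.

Lemma cexp0 : cexp (0 : R[i]) = 1.
Proof. by rewrite /cexp/= expR0 cos0 sin0; simpc. Qed.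

Lemma cexpN_mul (z : R[i]) : cexp (- z) * cexp z = 1.
Proof. by rewrite -cexpD addNr cexp0. Qed.

Lemma cexp_neq0 (z : R[i]) : cexp z != 0.
Proof.
by apply/eqP => z0; have := cexpN_mul z; rewrite z0 mulr0 => /eqP; rewrite eq_sym oner_eq0.
Qed.

Lemma cexpN (z : R[i]) : cexp (- z) = (cexp z)^-1.
Proof. by apply: (mulIf (cexp_neq0 z)); rewrite cexpN_mul mulVf// cexp_neq0. Qed.

(* The function sgn(c)^alpha |c|^(- lam): elements of [I_triv lam alpha] are
   the functions of the first column of [g] with this homogeneity. *)
Definition hom lam alpha c : R[i] :=
  (if alpha && (c < 0) then -1 else 1) * cexp (- lam * (ln `|c|)%:C).

Lemma homM lam alpha c d : c != 0 -> d != 0 ->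
  hom lam alpha (c * d) = hom lam alpha c * hom lam alpha d.
Proof.
move=> c0 d0; rewrite /hom normrM lnM ?posrE ?normr_gt0// rmorphD mulrDr cexpD.
rewrite [RHS]mulrACA; congr (_ * _); case: alpha; last by rewrite /= mulr1.
rewrite !andTb.
have [c1|c1|c1] := ltgtP c 0; last by rewrite c1 eqxx in c0.
  rewrite nmulr_rlt0//; have [d1|d1|d1] := ltgtP d 0; last by rewrite d1 eqxx in d0.
    by change ((1 : R[i]) = -1 * -1); rewrite mulrNN mulr1.
  by change ((-1 : R[i]) = -1 * 1); rewrite mulr1.
by rewrite pmulr_rlt0// mul1r.
Qed.

Lemma hom_expR lam alpha (t : R) : hom lam alpha (expR t) = cexp (- lam * t%:C).
Proof.
by rewrite /hom ltNge expR_ge0 andbF mul1r gtr0_norm ?expR_gt0// expRK.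
Qed.

Lemma hom1 lam alpha : hom lam alpha 1 = 1.
Proof. by rewrite -expR0 hom_expR mulr0 cexp0. Qed.

Lemma homN1 lam alpha : hom lam alpha (-1) = (-1) ^+ alpha.
Proof.
rewrite /hom normrN1 ln1 mulr0 cexp0 mulr1 oppr_lt0 ltr01 andbT.
by case: alpha.
Qed.

Lemma hom_gt0 lam alpha c : 0 < c -> hom lam alpha c = cexp (- lam * (ln c)%:C).
Proof. by move=> c0; rewrite -{1}(lnK c0) hom_expR. Qed.

End Homogeneity.

Section InducedModel.
Variable R : realType.
Implicit Types (lam nu : R[i]) (alpha beta : bool).

Lemma expm_H0 (t : R) : expm (t *: H0 R) =
  mat3 (expR t) 0 0 0 (expR (- (t / 2))) 0 0 0 (expR (- (t / 2))).
Proof.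
have -> : t *: H0 R = diag_mx (\row_j (if j == 0 :> 'I_3 then t else - (t / 2))).
  apply/matrixP; apply: ord3P; apply: ord3P; rewrite !mxE/= ?mulr0n ?mulr1n ?mulr0//; lra.
rewrite expm_diag; apply/matrixP; apply: ord3P; apply: ord3P; by rewrite !mxE.
Qed.

Lemma expm_H0' (t : R) : expm (t *: H0' R) = mat2 (expR t) 0 0 (expR (- t)).
Proof.
have -> : t *: H0' R = diag_mx (\row_j (if j == 0 :> 'I_2 then t else - t)).
  apply/matrixP; apply: ord2P; apply: ord2P; by rewrite !mxE/= ?mulr0n ?mulr1n ?mulr0 ?mulr1 ?mulrN1.
rewrite expm_diag; apply/matrixP; apply: ord2P; apply: ord2P; by rewrite !mxE.
Qed.

Lemma expm_N (x : 'I_2 -> R) :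
  expm (\sum_(j < 2) x j *: delta_mx ord0 (lift ord0 j)) =
  mat3 1 (x q0) (x q1) 0 1 0 0 0 1 :> 'M[R]_3.
Proof.
have -> : \sum_(j < 2) x j *: delta_mx ord0 (lift ord0 j) = mat3 0 (x q0) (x q1) 0 0 0 0 0 0.
  apply/matrixP; apply: ord3P; apply: ord3P;
  by rewrite summxE sum2 !mxE/= ?mulr0 ?mulr1 ?addr0 ?add0r.
rewrite expm_sq0; last first.
  by rewrite mul_mat3 !mul0r !mulr0 !addr0; apply/matrixP; apply: ord3P; apply: ord3P; rewrite !mxE.
apply/matrixP; apply: ord3P; apply: ord3P; by rewrite !mxE/= ?addr0 ?add0r.
Qed.

Lemma expm_N' (x : R) : expm (x *: delta_mx 0 1) = mat2 1 x 0 1 :> 'M[R]_2.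
Proof.
have -> : x *: delta_mx 0 1 = mat2 0 x 0 0.
  by apply/matrixP; apply: ord2P; apply: ord2P; rewrite !mxE/= ?mulr0 ?mulr1.
rewrite expm_sq0; last first.
  by rewrite mul_mat2 !mul0r !mulr0 !addr0; apply/matrixP; apply: ord2P; apply: ord2P; rewrite !mxE.
apply/matrixP; apply: ord2P; apply: ord2P; by rewrite !mxE/= ?addr0 ?add0r.
Qed.

Lemma hom_eps lam alpha (eps t : R) : eps = 1 \/ eps = -1 ->
  hom lam alpha (eps * expR t) = ((eps ^+ alpha)%:C * cexp (lam * t%:C))^-1.
Proof.
move=> He; have e0 : eps != 0 by case: He => ->; rewrite ?oppr_eq0 oner_eq0.
rewrite homM//; last by rewrite gt_eqF// expR_gt0.
rewrite hom_expR invfM mulNr cexpN; congr (_ * _).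
case: He => ->; first by rewrite hom1 expr1n invr1.
by rewrite homN1; case: alpha; rewrite ?expr0 ?invr1// !expr1 rmorphN1 invrN invr1.
Qed.

Lemma sign_norm (c : R) : c != 0 -> exists eps, [/\ eps = 1 \/ eps = -1,
  c = eps * expR (ln `|c|) & eps * eps = 1].
Proof.
move=> c0; have n0 : 0 < `|c| by rewrite normr_gt0.
rewrite lnK//; have [c1|c1|c1] := ltgtP c 0; last by rewrite c1 eqxx in c0.
  by exists (-1); split; [right| rewrite ltr0_norm// mulN1r opprK|rewrite mulrNN mulr1].
by exists 1; split; [left|rewrite gtr0_norm// mul1r|rewrite mulr1].
Qed.

Lemma MG_block (m : SL R 3) (h : 'M[R]_2) alpha :
  SLmx m = block_mx ((\det h)^-1)%:M 0 0 h :> 'M[R]_(1 + 2) ->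
  sgnM alpha m = ((\det h) ^+ alpha)%:C.
Proof. by move=> mE; rewrite /sgnM mE block_mxKdr. Qed.

(** The corner entry is eps e^t: its sign goes to M and e^t to A. Since A contracts the lower block
    by e^(-t/2), the block of the factor in M is that of h multiplied by e^(t/2), which has
    determinant eps; N is then read off from the first row. *)
Lemma MG_decomp (h : SL R 3) : SLmx h o1 o0 = 0 -> SLmx h o2 o0 = 0 ->
  exists m a u (t : R) (eps : R), [/\ MG m, SLmx a = expm (t *: H0 R), NG u,
    h = (m * a * u)%g & [/\ forall alpha, sgnM alpha m = (eps ^+ alpha)%:C,
      SLmx h o0 o0 = eps * expR t & eps = 1 \/ eps = -1]].
Proof.
move=> h1 h2; have detE0 := det_SL h; rewrite [SLmx h]mat3E h1 h2 det_mat3 in detE0.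
set c := SLmx h o0 o0 in detE0 *; set p := SLmx h o1 o1 in detE0; set q := SLmx h o1 o2 in detE0.
set s := SLmx h o2 o1 in detE0; set t' := SLmx h o2 o2 in detE0; set r1 := SLmx h o0 o1 in detE0.
set r2 := SLmx h o0 o2 in detE0.
have detE : c * (p * t' - q * s) = 1 by rewrite -detE0; ring.
have c0 : c != 0.
  by apply/eqP => c0; move/eqP: detE; rewrite c0 mul0r eq_sym oner_eq0.
have [eps [He cE ee]] := sign_norm c0.
set t := ln `|c| in cE.
pose k := expR (t / 2); pose k' := expR (- (t / 2)).
have kk : k * k = expR t by rewrite -expRD; congr expR; lra.
have kk' : k * k' = 1 by rewrite -expRD subrr expR0.
have dh : \det (mat2 (p * k) (q * k) (s * k) (t' * k)) = eps.
  rewrite det_mat2 (_ : _ - _ = (k * k) * (p * t' - q * s)); last by ring.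
  rewrite kk (_ : expR t * _ = eps * (c * (p * t' - q * s))); first by rewrite detE mulr1.
  by rewrite cE !mulrA ee mul1r.
have dm : \det (mat3 eps 0 0 0 (p * k) (q * k) 0 (s * k) (t' * k)) = 1.
  by rewrite det_mat3 -ee -[X in eps * X]dh det_mat2; ring.
have da : \det (expm (t *: H0 R)) = 1.
  rewrite expm_H0 det_mat3.
  rewrite (_ : _ + _ = expR t * (expR (- (t / 2)) * expR (- (t / 2)))); last by ring.
  by rewrite -!expRD (_ : t + _ = 0) ?expR0//; lra.
have du : \det (mat3 1 (r1 / c) (r2 / c) 0 1 0 0 0 1) = 1.
  by rewrite det_mat3; ring.
exists (mkSL dm), (mkSL da), (mkSL du), t, eps; split => //.
- exists (mat2 (p * k) (q * k) (s * k) (t' * k)); rewrite dh; split=> //.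
  rewrite mkSLE block_mat12 !mxE/=; congr (mat3 _ _ _ _ _ _ _ _ _).
  by case: He => ->; rewrite ?invrN ?invr1.
- exists (fun j => if j == q0 then r1 / c else r2 / c).
  by rewrite mkSLE expm_N.
- apply: SLmx_inj; rewrite !SLmxM !mkSLE expm_H0 !mul_mat3 [LHS]mat3E h1 h2.
  rewrite -/c -/p -/q -/s -/t' -/r1 -/r2 -/k' !mul0r !mulr0 !addr0 !add0r !mulr1 -cE -!mulrA kk' !mulr1.
  by congr (mat3 _ _ _ _ _ _ _ _ _); rewrite ?mul0r ?addr0 ?add0r// mulrCA mulfV// mulr1.
- split=> // alpha; rewrite (@MG_block _ (mat2 (p * k) (q * k) (s * k) (t' * k))) ?dh//.
  rewrite mkSLE block_mat12 !mxE/=; congr (mat3 _ _ _ _ _ _ _ _ _).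
  by case: He => ->; rewrite ?invrN ?invr1.
Qed.

(** After this the factors M, A and N no longer occur: equivariance is tested on all of P at once,
    and only the corner entry of h matters. *)
Lemma I_trivP lam alpha (f : SL R 3 -> R[i]^o) : I_triv lam alpha f <->
  smooth f /\ forall g h : SL R 3, SLmx h o1 o0 = 0 -> SLmx h o2 o0 = 0 ->
    f (g * h)%g = hom lam alpha (SLmx h o0 o0) * f g.
Proof.
split=> [[sf Hf]|[sf Hf]]; split => //.
  move=> g h h1 h2; have [m [a [u [t [eps [Hm Ha Hu hE [Hs h0 He]]]]]]] := MG_decomp h1 h2.
  by rewrite h0 hE (Hf _ _ _ _ t)// Hs hom_eps.
move=> g m a u t [h [dh mE]] aE [x uE].
have [eps [He dE]] : exists eps : R, (eps = 1 \/ eps = -1) /\ \det h = eps by exists (\det h).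
have ei : eps^-1 = eps by case: He => ->; rewrite ?invrN ?invr1.
have E : SLmx (m * a * u)%g = mat3 eps 0 0 0 (h q0 q0) (h q0 q1) 0 (h q1 q0) (h q1 q1) *m
    mat3 (expR t) 0 0 0 (expR (- (t / 2))) 0 0 0 (expR (- (t / 2))) *m
    mat3 1 (x q0) (x q1) 0 1 0 0 0 1.
  by rewrite !SLmxM mE aE uE expm_H0 expm_N block_mat12 dE ei.
rewrite !mul_mat3 !mul0r !mulr0 !addr0 !mulr1 in E.
rewrite Hf E ?mxE//= (MG_block _ mE) dE hom_eps//.
Qed.

Lemma J_trivP nu beta (f : SL R 2 -> R[i]^o) : J_triv nu beta f <->
  smooth f /\ forall g h : SL R 2, SLmx h q1 q0 = 0 ->
    f (g * h)%g = hom nu beta (SLmx h q0 q0) * f g.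
Proof.
split=> [[sf Hf]|[sf Hf]]; split => //.
  move=> g h h1; have detE := det_SL h; rewrite [SLmx h]mat2E h1 det_mat2 mulr0 subr0 in detE.
  set c := SLmx h q0 q0 in detE *; set r := SLmx h q0 q1; set d := SLmx h q1 q1 in detE.
  have c0 : c != 0.
    by apply/eqP => c0; move/eqP: detE; rewrite c0 mul0r eq_sym oner_eq0.
  have [eps [He cE ee]] := sign_norm c0.
  set t := ln `|c| in cE.
  have tt : expR t * expR (- t) = 1 by rewrite -expRD subrr expR0.
  have dm : \det (eps%:M : 'M[R]_2) = 1 by rewrite det_scalar expr2.
  have da : \det (expm (t *: H0' R)) = 1 by rewrite expm_H0' det_mat2 mulr0 subr0.
  have du : \det (mat2 1 (r / c) 0 1) = 1 by rewrite det_mat2; ring.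
  have mE : eps%:M = mat2 eps 0 0 eps.
    by apply/matrixP; apply: ord2P; apply: ord2P; rewrite !mxE.
  have hE : h = (mkSL dm * mkSL da * mkSL du)%g.
    apply: SLmx_inj; rewrite !SLmxM !mkSLE expm_H0' mE !mul_mat2 [LHS]mat2E h1.
    rewrite -/c -/r -/d !mul0r !mulr0 !addr0 !add0r !mulr1 -cE.
    congr (mat2 _ _ _ _); rewrite ?mul0r ?add0r ?addr0//.
      by rewrite mulrCA mulfV// mulr1.
    apply: (mulfI c0); rewrite detE {1}cE mulrACA ee mul1r tt//.
  rewrite [in LHS]hE (Hf _ _ _ _ t)//; first last.
  - by exists (r / c); rewrite mkSLE expm_N'.
  - by exists eps.
  rewrite /sgnM' mkSLE !mxE/= -hom_eps -?cE ?mxE//.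
move=> g m a u t [eps [He mE]] aE [x uE].
have E : SLmx (m * a * u)%g = mat2 eps 0 0 eps *m mat2 (expR t) 0 0 (expR (- t)) *m mat2 1 x 0 1.
  rewrite !SLmxM mE aE uE expm_H0' expm_N'; congr (_ *m _ *m _).
  by apply/matrixP; apply: ord2P; apply: ord2P; rewrite !mxE.
rewrite !mul_mat2 !mul0r !mulr0 !addr0 !mulr1 in E.
by rewrite Hf E ?mxE//= /sgnM' mE !mxE/= hom_eps.
Qed.

End InducedModel.

(** * The chart of G/P, its Lie derivatives, and the embedding of G' *)

Section Chart.
Variable R : realType.
Implicit Types (f : SL R 3 -> R[i]^o) (g : SL R 3) (y z : R).

(* [Nmx] is a chart of the open cell, G' being the locus z = 0 up to P; in it [word a b]
   acts as d_y^a d_z^b. *)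
Fact Nmx_subproof y z : \det (mat3 1 0 0 y 1 0 z 0 1) = 1.
Proof. by rewrite det_mat3; ring. Qed.
Definition Nmx y z : SL R 3 := mkSL (Nmx_subproof y z).

Lemma NmxM y z y' z' : (Nmx y z * Nmx y' z')%g = Nmx (y + y') (z + z').
Proof.
by apply: SLmx_inj; rewrite SLmxM !mkSLE mul_mat3; congr (mat3 _ _ _ _ _ _ _ _ _); ring.
Qed.

Lemma Nmx0 : Nmx 0 0 = 1%g.
Proof.
by apply: SLmx_inj; apply/matrixP; apply: ord3P; apply: ord3P; rewrite !mxE.
Qed.

Definition E21 : 'M[R]_3 := mat3 0 0 0 1 0 0 0 0 0.
Definition E31 : 'M[R]_3 := mat3 0 0 0 0 0 0 1 0 0.

Fact E21_sl : @sl R 3 E21.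
Proof. by rewrite /sl/= /mxtrace sum3 !mxE/= !addr0. Qed.
Fact E31_sl : @sl R 3 E31.
Proof. by rewrite /sl/= /mxtrace sum3 !mxE/= !addr0. Qed.

Definition s21 : @sl R 3 := exist _ E21 (mem_set E21_sl).
Definition s31 : @sl R 3 := exist _ E31 (mem_set E31_sl).

Lemma expm_E21 (t : R) : expm (t *: E21) = SLmx (Nmx t 0).
Proof.
rewrite expm_sq0; first by apply/matrixP; apply: ord3P; apply: ord3P; rewrite !mxE/=; ring.
rewrite -scalemxAl -scalemxAr mul_mat3.
by apply/matrixP; apply: ord3P; apply: ord3P; rewrite !mxE/=; ring.
Qed.

Lemma expm_E31 (t : R) : expm (t *: E31) = SLmx (Nmx 0 t).
Proof.
rewrite expm_sq0; first by apply/matrixP; apply: ord3P; apply: ord3P; rewrite !mxE/=; ring.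
rewrite -scalemxAl -scalemxAr mul_mat3.
by apply/matrixP; apply: ord3P; apply: ord3P; rewrite !mxE/=; ring.
Qed.

Lemma lie_derive_E21 f g : lie_derive E21 f g =
  derive1 (fun t => complex.Re (f (g * Nmx t 0)%g)) 0 +i*
  derive1 (fun t => complex.Im (f (g * Nmx t 0)%g)) 0.
Proof.
rewrite /lie_derive; congr (_ +i* _); congr (derive1 _ 0); apply/funext => t;
  by rewrite expm_E21 -SLmxM extend0_SL.
Qed.

Lemma lie_derive_E31 f g : lie_derive E31 f g =
  derive1 (fun t => complex.Re (f (g * Nmx 0 t)%g)) 0 +i*
  derive1 (fun t => complex.Im (f (g * Nmx 0 t)%g)) 0.
Proof.
rewrite /lie_derive; congr (_ +i* _); congr (derive1 _ 0); apply/funext => t;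
  by rewrite expm_E31 -SLmxM extend0_SL.
Qed.

Definition word a b : seq (@sl R 3) := nseq a s21 ++ nseq b s31.

Definition iterD a b (F : R * R -> R) : R * R -> R :=
  iter a (fun G => 'D_((1 : R), (0 : R)) G) (iter b (fun G => 'D_((0 : R), (1 : R)) G) F).

Lemma derive1_fst (F : R * R -> R) y z :
  derive1 (fun t => F (y + t, z)) 0 = 'D_((1 : R), (0 : R)) F (y, z).
Proof.
rewrite /derive1 /derive; congr (lim (_ @ 0^')); apply/funext => h /=.
congr (_ *: (F _ - F _)); last by rewrite addr0.
by congr pair; rewrite /= ?scaler0 ?add0r// addr0 addrC [_%:A]mulr1.
Qed.

Lemma derive1_snd (F : R * R -> R) y z :
  derive1 (fun t => F (y, z + t)) 0 = 'D_((0 : R), (1 : R)) F (y, z).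
Proof.
rewrite /derive1 /derive; congr (lim (_ @ 0^')); apply/funext => h /=.
congr (_ *: (F _ - F _)); last by rewrite addr0.
by congr pair; rewrite /= ?scaler0 ?add0r// addr0 addrC [_%:A]mulr1.
Qed.

(** The matrices [Nmx y z] form a commutative group with additive parameters, so the left-invariant
    fields of [E21] and [E31] are the coordinate derivatives, at every base point g. *)
Lemma lie_jet_chart a b f g y z :
  lie_jet f (word a b) (g * Nmx y z)%g =
  iterD a b (fun p => complex.Re (f (g * Nmx p.1 p.2)%g)) (y, z) +i*
  iterD a b (fun p => complex.Im (f (g * Nmx p.1 p.2)%g)) (y, z).
Proof.
rewrite /word; elim: a y z => [|a IH] y z.
  rewrite cat0s; elim: b y z => [|b IH] y z; first by rewrite /=; case: (f _).
  rewrite [LHS]lie_derive_E31; congr (_ +i* _); rewrite /iterD/= -derive1_snd;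
    by congr (derive1 _ 0); apply/funext => t; rewrite -mulgA NmxM addr0 [X in complex.Re X]IH || rewrite -mulgA NmxM addr0 [X in complex.Im X]IH.
rewrite [LHS]lie_derive_E21; congr (_ +i* _); rewrite /iterD/= -derive1_fst;
  by congr (derive1 _ 0); apply/funext => t; rewrite -mulgA NmxM addr0 [X in complex.Re X]IH || rewrite -mulgA NmxM addr0 [X in complex.Im X]IH.
Qed.

(** As a matrix, [Nmx y z] is 1 + y E21 + z E31, so the chart is affine and composes with the
    ambient representatives of f. *)
Lemma smooth_chart f g p : smooth f ->
  smooth_at (fun p : R * R => complex.Re (f (g * Nmx p.1 p.2)%g)) p /\
  smooth_at (fun p : R * R => complex.Im (f (g * Nmx p.1 p.2)%g)) p.
Proof.
move=> /smoothP /(_ (g * Nmx p.1 p.2)%g)[U [F1 [F2 [Up [oU S1 S2 fE]]]]].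
pose G (i : option bool) (q : R * R) : R :=
  match i with None => 1 | Some true => q.1 | Some false => q.2 end.
pose e (i : option bool) : 'M[R]_3 :=
  match i with None => SLmx g | Some true => SLmx g *m E21 | Some false => SLmx g *m E31 end.
have LE q : \sum_i G i q *: e i = SLmx (g * Nmx q.1 q.2)%g.
  rewrite (bigD1 None)//= scale1r SLmxM.
  rewrite (_ : SLmx (Nmx q.1 q.2) = 1%:M + q.1 *: E21 + q.2 *: E31); last first.
    by apply/matrixP; apply: ord3P; apply: ord3P; rewrite !mxE/=; ring.
  rewrite !mulmxDr mulmx1 -!scalemxAr -addrA; congr (_ + _).
  by rewrite (bigD1 (Some true))//= (bigD1 (Some false))//= big1 ?addr0// => -[[]|].
have GD k i q : Dk k (G i) q.
  case: i => [[]|] /=; last exact: Dk_cst.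
    by apply: Dk_linear => // ?; exact: cvg_fst.
  by apply: Dk_linear => // ?; exact: cvg_snd.
have nU : \forall q \near p, U (SLmx (g * Nmx q.1 q.2)%g).
  have : {for p, continuous (fun q => \sum_i G i q *: e i)}.
    apply: differentiable_continuous; apply: differentiable_bigsum => i.
    by apply: differentiableZl; have [/nbhs_singleton] := GD 1%N i p.
  rewrite /prop_for /continuous_at LE => /(_ U) H.
  have : \forall q \near p, U (\sum_i G i q *: e i) by apply: H; exact: open_nbhs_nbhs.
  by apply: filterS => q; rewrite LE.
split=> k.
- apply: (@near_eq_Dk _ _ _ (fun q => F1 (\sum_i G i q *: e i))).
    by apply: filterS nU => q Uq; rewrite fE// LE.
  by apply: Dk_comp => //; rewrite LE; exact: S1.
- apply: (@near_eq_Dk _ _ _ (fun q => F2 (\sum_i G i q *: e i))).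
    by apply: filterS nU => q Uq; rewrite fE// LE.
  by apply: Dk_comp => //; rewrite LE; exact: S2.
Qed.

Lemma unimodular_sl (X : @sl R 3) : unimodular (set_val X : 'M[R]_3).
Proof.
move=> t; apply: det_expm3.
by case: X => X hX; exact: (set_mem hX).
Qed.

Lemma smooth_lie_jet f (w : seq (@sl R 3)) : smooth f -> smooth (lie_jet f w).
Proof.
by move=> sf; elim: w => //= X w IH; apply: smooth_lie_derive => //; exact: unimodular_sl.
Qed.

Lemma lie_jet_comb (c : R[i]) f f' (w : seq (@sl R 3)) : smooth f -> smooth f' ->
  lie_jet (c *: f + f') w = c *: lie_jet f w + lie_jet f' w.
Proof.
move=> sf sf'; elim: w => [//|X w IH].
rewrite -[LHS]/(lie_derive (set_val X) (lie_jet (c *: f + f') w)) IH.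
by rewrite lie_derive_comb//; [exact: unimodular_sl|exact: smooth_lie_jet|exact: smooth_lie_jet].
Qed.

End Chart.

Section Embedding.
Variable R : realType.

Lemma embedM (g h : SL R 2) : embed (g * h)%g = (embed g * embed h)%g.
Proof.
apply: SLmx_inj; rewrite SLmxM !mkSLE.
have := @mulmx_block _ 2 1 2 1 2 1 (SLmx g) 0 0 1 (SLmx h) 0 0 1.
by rewrite !mulmx0 !mul0mx !addr0 !add0r mulmx1 => <-.
Qed.

Lemma embed1 : embed (1%g : SL R 2) = 1%g.
Proof. by apply: SLmx_inj; rewrite !mkSLE -[RHS]/(1%:M) (@scalar_mx_block _ 2 1). Qed.

Lemma embedV (g : SL R 2) : embed g^-1%g = (embed g)^-1%g.
Proof. by apply: (mulgI (embed g)); rewrite -embedM !mulgV embed1. Qed.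

Lemma embedE (g : SL R 2) : SLmx (embed g) =
  mat3 (SLmx g q0 q0) (SLmx g q0 q1) 0 (SLmx g q1 q0) (SLmx g q1 q1) 0 0 0 1.
Proof. by rewrite mkSLE block_mat21 mxE. Qed.

Let L (y : 'M[R]_2) : 'M[R]_(2 + 1) := block_mx y 0 0 1.

Let LE y : L y = L 0 + \sum_p y p.1 p.2 *: (block_mx (delta_mx p.1 p.2) 0 0 0 : 'M[R]_(2 + 1)).
Proof.
rewrite {1}/L -[y in LHS]sum_delta_mx -[RHS]addrC.
have -> : \sum_p y p.1 p.2 *: (block_mx (delta_mx p.1 p.2) 0 0 0 : 'M[R]_(2 + 1)) =
   block_mx (\sum_p y p.1 p.2 *: delta_mx p.1 p.2) 0 0 0.
  elim/big_rec2 : _ => [|p A B _ ->]; first by rewrite block_mx_const.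
  by rewrite scale_block_mx !scaler0 add_block_mx !addr0.
by rewrite /L add_block_mx !addr0 add0r.
Qed.

Lemma continuous_embed : continuous (@embed R).
Proof.
move=> g A [B [[C oC CE] Bg] sBA].
have oL : open (L @^-1` C) by move/continuousP : (continuous_affine LE); apply.
have : nbhs g ((@SLmx R 2) @^-1` (L @^-1` C)).
  apply: (@continuous_SLmx R 2 g); apply: open_nbhs_nbhs; split=> //=.
  by move: Bg; rewrite -CE.
by apply: filterS => h Ch; apply: sBA; rewrite -CE.
Qed.

Lemma smooth_embed (f : SL R 3 -> R[i]^o) : smooth f ->
  smooth ((fun g => f (embed g)) : SL R 2 -> R[i]^o).
Proof.
move=> /smoothP sf; apply/smoothP => g.
have [U [F1 [F2 [Ug [oU S1 S2 fE]]]]] := sf (embed g).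
exists (L @^-1` U), (fun y => F1 (L y)), (fun y => F2 (L y)); split=> //; split.
- by move/continuousP : (continuous_affine LE); apply.
- by move=> x Ux; apply: (smooth_at_affine LE); exact: S1.
- by move=> x Ux; apply: (smooth_at_affine LE); exact: S2.
- by move=> k Uk; rewrite fE.
Qed.

Definition embed_sl_mx (X : 'M[R]_2) : 'M[R]_(2 + 1) := block_mx X 0 0 0.

Fact embed_sl_subproof (X : @sl R 2) : @sl R 3 (embed_sl_mx (set_val X)).
Proof.
rewrite /sl/=; have -> := @mxtrace_block R 2 1 (set_val X) 0 0 0; rewrite mxtrace0 addr0.
by case: X => X hX; exact: (set_mem hX).
Qed.
Definition embed_sl (X : @sl R 2) : @sl R 3 :=
  exist _ (embed_sl_mx (set_val X) : 'M[R]_3) (mem_set (embed_sl_subproof X)).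

Lemma expm_embed (X : 'M[R]_2) : expm (embed_sl_mx X) = block_mx (expm X) 0 0 1.
Proof.
rewrite /expm; apply/cvg_lim => //.
(* The lower corner of a power is 0, except for the power 0, where it is 1. *)
have Xk k : (embed_sl_mx X : 'M[R]_3) ^+ k = block_mx (X ^+ k) 0 0 (k == 0%N)%:R%:M :> 'M[R]_(2 + 1).
  elim: k => [|k IH]; first by rewrite !expr0; exact: (@scalar_mx_block R 2 1 1).
  rewrite exprS IH -[LHS]/(_ *m _) /embed_sl_mx.
  have := @mulmx_block _ 2 1 2 1 2 1 X 0 0 0 (X ^+ k) 0 0 (k == 0%N)%:R%:M.
  by rewrite !mulmx0 !mul0mx !addr0 exprS /= raddf0 => <-.
have c := @is_cvg_expm R 2 X.
(* Partial sums are compared from index 1 on, since the term of exponent 0 supplies the corner entry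
   1; the empty sum would not match. *)
have sE k : series (fun k => (k`!%:R)^-1 *: (embed_sl_mx X : 'M[R]_3) ^+ k) k.+1 =
    L (series (fun k => (k`!%:R)^-1 *: X ^+ k) k.+1).
  rewrite /series/= big_nat_recl// [in RHS]big_nat_recl//= !fact0 !invr1 !scale1r.
  rewrite !expr0.
  have -> : \sum_(0 <= i < k) (i.+1`!%:R)^-1 *: (embed_sl_mx X : 'M[R]_3) ^+ i.+1 =
    block_mx (\sum_(0 <= i < k) (i.+1`!%:R)^-1 *: X ^+ i.+1) 0 0 0 :> 'M[R]_(2 + 1).
    have Z p A : (p.+1`!%:R)^-1 *: (embed_sl_mx X : 'M[R]_3) ^+ p.+1 + (block_mx A 0 0 0 : 'M[R]_(2 + 1)) =
        block_mx ((p.+1`!%:R)^-1 *: X ^+ p.+1 + A) 0 0 0 :> 'M[R]_(2 + 1).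
      rewrite Xk /= raddf0.
      have E1 := @scale_block_mx R 2 1 2 1 (p.+1`!%:R)^-1 (X ^+ p.+1) 0 0 0.
      have E2 := @add_block_mx R 2 1 2 1 ((p.+1`!%:R)^-1 *: X ^+ p.+1) 0 0 0 A 0 0 0.
      by rewrite !scaler0 in E1; rewrite -E1 !addr0 in E2; exact: E2.
    elim/big_rec2 : _ => [|p A B _ ->]; first by rewrite (@block_mx_const R 2 1 2 1).
    exact: Z.
  have E1 : (1 : 'M[R]_3) = (block_mx 1 0 0 1 : 'M[R]_(2 + 1)) by exact: (@scalar_mx_block R 2 1 1).
  set A := \sum_(0 <= i < k) _.
  have E2 := @add_block_mx R 2 1 2 1 1 0 0 1 A 0 0 0.
  by rewrite !addr0 in E2; rewrite E1; exact: E2.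
pose u := series (fun k => (k`!%:R)^-1 *: X ^+ k).
pose v := series (fun k => (k`!%:R)^-1 *: (embed_sl_mx X : 'M[R]_3) ^+ k).
have cu : u k.+1 @[k --> \oo] --> limn u by rewrite (cvg_shiftS u); exact: c.
have cv : v k.+1 @[k --> \oo] --> (L (limn u) : 'M[R]_3).
  rewrite (_ : (fun k => v k.+1) = (fun k => L (u k.+1))); last by apply/funext => k; exact: sE.
  by apply: continuous_cvg => //; exact: (continuous_affine LE).
by move: cv; rewrite (cvg_shiftS v).
Qed.

Lemma lie_derive_embed (X : 'M[R]_2) (f : SL R 3 -> R[i]^o) :
  lie_derive X ((fun g => f (embed g)) : SL R 2 -> R[i]^o) =
  (fun g => lie_derive (embed_sl_mx X) f (embed g)) :> (SL R 2 -> R[i]^o).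
Proof.
have E y : extend0 ((fun g => f (embed g)) : SL R 2 -> R[i]^o) y = extend0 f (block_mx y 0 0 1).
  have dL : \det (block_mx y 0 0 1 : 'M[R]_(2 + 1)) = \det y by rewrite det_ublock det1 mulr1.
  have [dy|dy] := pselect (\det y = 1).
    rewrite extend0_mkSL -(extend0_SL f).
    by congr extend0; rewrite mkSLE.
  by rewrite extend0_off// extend0_off//= dL.
apply/funext => g; rewrite /lie_derive.
have Et t : extend0 ((fun g => f (embed g)) : SL R 2 -> R[i]^o) (SLmx g *m expm (t *: X)) =
    extend0 f (SLmx (embed g) *m expm (t *: embed_sl_mx X)).
  have -> : t *: embed_sl_mx X = embed_sl_mx (t *: X).
    by rewrite /embed_sl_mx scale_block_mx !scaler0.
  rewrite E expm_embed; congr extend0; rewrite mkSLE.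
  have := @mulmx_block _ 2 1 2 1 2 1 (SLmx g) 0 0 1 (expm (t *: X)) 0 0 1.
  by rewrite !mulmx0 !mul0mx !addr0 !add0r mulmx1 => <-.
by congr (_ +i* _); congr (derive1 _ 0); apply/funext => t; rewrite Et.
Qed.

Lemma lie_jet_embed (w : seq (@sl R 2)) (f : SL R 3 -> R[i]^o) :
  lie_jet ((fun g => f (embed g)) : SL R 2 -> R[i]^o) w =
  (fun g => lie_jet f (map embed_sl w) (embed g)) :> (SL R 2 -> R[i]^o).
Proof.
elim: w => [//|X w IH].
rewrite -[LHS]/(lie_derive (set_val X) (lie_jet ((fun g => f (embed g)) : SL R 2 -> R[i]^o) w)) IH.
by rewrite lie_derive_embed.
Qed.

(** In [word a b] the normal derivatives d_z act first, so that d_z^b f appears as an intermediate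
    function to which the tangential d_y^a is applied. *)
Definition Dop a b (f : SL R 3 -> R[i]^o) : SL R 2 -> R[i]^o :=
  fun g => lie_jet f (word R a b) (embed g).

End Embedding.

(** * Bol's identity and the equivariance of d_y^a d_z^b under P' *)

Section OneVariable.
Variable R : realType.
Implicit Types (F G : R -> R) (x y z c : R).

Lemma smooth_at_derivable F x : smooth_at F x -> derivable F x 1.
Proof. by move=> sF; apply: diff_derivable; exact: smooth_at_differentiable. Qed.

Lemma smooth_at_derive1 F x : smooth_at F x -> smooth_at (derive1 F) x.
Proof.
move=> sF k; have -> : derive1 F = 'D_1 F by apply/funext => y; rewrite derive1E.
exact: (sF k.+1).2.
Qed.

Lemma smooth_at_derive1n F n x : smooth_at F x -> smooth_at (derive1n n F) x.
Proof. by move=> sF; elim: n => // n IH; exact: smooth_at_derive1. Qed.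

Lemma near_eq_derive1n F G n x : (\near x, F x = G x) -> derive1n n F x = derive1n n G x.
Proof.
elim: n x => [|n IH] x FG; first exact: nbhs_singleton FG.
rewrite !derive1nS !derive1E; apply: near_eq_derive.
by apply: filterS (near_join FG) => y; exact: IH.
Qed.

Lemma is_derive_derive1 F x d : is_derive x 1 F d -> derive1 F x = d.
Proof. by move=> [_ <-]; rewrite derive1E. Qed.

Lemma is_derive_comp1 F G x d e : is_derive x 1 F d -> is_derive (F x) 1 G e ->
  is_derive x 1 (fun y => G (F y)) (e * d).
Proof.
move=> [dF vF] [dG vG]; apply: DeriveDef.
  by apply/derivable1_diffP/differentiable_comp; exact/derivable1_diffP.
have := derive1_comp dF dG; rewrite !derive1E vF vG => <-.
by [].
Qed.

Lemma is_derive_smooth F x : smooth_at F x -> is_derive x 1 F (derive1 F x).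
Proof. by move=> sF; rewrite derive1E; apply/derivableP/smooth_at_derivable. Qed.

(** Higher derivatives of an affine factor vanish, so Leibniz's rule has two terms. It serves to
    raise the power of such a factor by one, in Bol's identity as in the later test against
    unipotent elements. *)
Lemma leibniz_affine (O : set R) (a b : R) (h : R -> R) n : open O ->
  (forall y, O y -> smooth_at h y) -> forall y, O y ->
  derive1n n.+1 (fun y => (a + b * y) * h y) y =
  (a + b * y) * derive1n n.+1 h y + n.+1%:R * b * derive1n n h y.
Proof.
move=> oO sh.
have dl (y : R) : is_derive y 1 (fun y => a + b * y) b.
  by apply: is_derive_eq; rewrite /GRing.scale/=; ring.
elim: n => [|n IH] y Oy.
  rewrite /derive1n/= mul1r; apply: is_derive_derive1.
  have := is_deriveM (dl y) (is_derive_smooth (sh _ Oy)).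
  by rewrite /GRing.scale/= [h y * b]mulrC.
rewrite derive1nS.
have E : \forall y \near y, derive1n n.+1 (fun y => (a + b * y) * h y) y =
    (a + b * y) * derive1n n.+1 h y + n.+1%:R * b * derive1n n h y.
  by apply: filterS (open_nbhs_nbhs (conj oO Oy)) => z; exact: IH.
have -> : derive1 (derive1n n.+1 (fun y => (a + b * y) * h y)) y =
    derive1 (fun y => (a + b * y) * derive1n n.+1 h y + n.+1%:R * b * derive1n n h y) y.
  by rewrite !derive1E; exact: near_eq_derive.
have d1 := is_derive_smooth (smooth_at_derive1n n.+1 (sh _ Oy)).
have d0 := is_derive_smooth (smooth_at_derive1n n (sh _ Oy)).
apply: is_derive_derive1.
apply: is_derive_eq (is_deriveD (is_deriveM (dl y) d1) (is_deriveZ (n.+1%:R * b) d0)) _.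
rewrite /GRing.scale/= -!derive1nS -[in RHS]natr1; ring.
Qed.

(* Bol's identity: (d/dy)^(n+1) intertwines the weights n and - n - 2. *)
Lemma bol (x s : R) (psi : R -> R) n y : (forall z, smooth_at psi z) -> 0 < 1 + x * y ->
  derive1n n.+1 (fun y => (1 + x * y) ^+ n * psi (s * y / (1 + x * y))) y =
  s ^+ n.+1 * (1 + x * y) ^- n.+2 * derive1n n.+1 psi (s * y / (1 + x * y)).
Proof.
move=> spsi; pose O := [set y : R | 0 < 1 + x * y].
have dl (t : R) : is_derive t 1 (fun y => 1 + x * y) x.
  by apply: is_derive_eq; rewrite /GRing.scale/=; ring.
have sl k (t : R) : Dk k (fun y => 1 + x * y) t.
  by apply: DkD; [exact: Dk_cst|apply: DkM; [exact: Dk_cst|exact: Dk_id]].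
have oO : open O.
  have -> : O = (fun y => 1 + x * y) @^-1` [set u | 0 < u] by [].
  have /continuousP : continuous (fun y : R => 1 + x * y).
    by move=> z; apply: differentiable_continuous; have [/nbhs_singleton] := sl 1%N z.
  by apply; exact: open_gt.
pose w y := s * y / (1 + x * y).
have sw k (t : R) : O t -> Dk k w t.
  move=> Ot; apply: DkM; first by apply: DkM; [exact: Dk_cst|exact: Dk_id].
  by apply: Dk_comp1 => //; apply: Dk_inv; rewrite gt_eqF.
have dw (t : R) : O t -> is_derive t 1 w (s * (1 + x * t) ^- 2).
  move=> Ot; have t0 : 1 + x * t != 0 by rewrite gt_eqF.
  have dV := @is_deriveV R (fun y => 1 + x * y) t x 1 t0 (dl t).
  have dZ : is_derive t 1 (fun y : R => s * y) (s * 1) by exact: (@is_deriveZ _ _ _ id s).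
  apply: is_derive_eq (is_deriveM dZ dV) _.
  by rewrite /GRing.scale/=; field.
have sT m psi' k : (forall z, smooth_at psi' z) -> forall y, O y ->
    Dk k (fun y => (1 + x * y) ^+ m * psi' (w y)) y.
  move=> sp z Oz; apply: DkM; first exact: Dk_exp.
  apply: Dk_comp1; [exact: sp|exact: sw].
elim: n psi spsi y => [|n IH] psi spsi y Oy.
  rewrite /derive1n/= expr1.
  apply: is_derive_derive1.
  under eq_fun do rewrite expr0 mul1r.
  apply: is_derive_eq (is_derive_comp1 (dw _ Oy) (is_derive_smooth (spsi _))) _.
  by rewrite mulrC.
(* One factor 1 + x y is split off. By [leibniz_affine] only the derivatives of orders n + 1 and n +
   2 of the remaining product occur; the first is the induction hypothesis, the second its
   derivative. *)
under eq_fun do rewrite exprS -mulrA.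
have sh := fun z Oz k => sT n psi k spsi z Oz.
rewrite -/w (leibniz_affine 1 x n.+1 oO sh Oy) derive1nS.
have E : \forall y \near y, derive1n n.+1 (fun y => (1 + x * y) ^+ n * psi (w y)) y =
   s ^+ n.+1 * (1 + x * y) ^- n.+2 * derive1n n.+1 psi (w y).
  by apply: filterS (open_nbhs_nbhs (conj oO Oy)) => z Oz; exact: IH.
rewrite (nbhs_singleton E).
have -> : derive1 (derive1n n.+1 (fun y => (1 + x * y) ^+ n * psi (w y))) y =
    derive1 (fun y => s ^+ n.+1 * (1 + x * y) ^- n.+2 * derive1n n.+1 psi (w y)) y.
  by rewrite !derive1E; exact: near_eq_derive.
have y0 : 1 + x * y != 0 by rewrite gt_eqF.
have dP : is_derive y 1 (fun y => (1 + x * y) ^- n.+2) (- n.+2%:R * x * (1 + x * y) ^- n.+3).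
  have dX : is_derive y 1 (fun y => (1 + x * y) ^+ n.+2) (n.+2%:R * (1 + x * y) ^+ n.+1 * x).
    by have := is_deriveX n.+2 (dl y); rewrite exprfctE.
  have yn0 : (1 + x * y) ^+ n.+2 != 0 by rewrite expf_neq0.
  apply: is_derive_eq (@is_deriveV R (fun y => (1 + x * y) ^+ n.+2) y _ 1 yn0 dX) _.
  rewrite /GRing.scale/= !exprS; field.
  by rewrite y0 expf_neq0.
have dPsi := is_derive_comp1 (dw _ Oy)
  (is_derive_smooth (smooth_at_derive1n n.+1 (spsi (w y)))).
have dZ : is_derive y 1 (fun y => s ^+ n.+1 * (1 + x * y) ^- n.+2)
    (s ^+ n.+1 * (- n.+2%:R * x * (1 + x * y) ^- n.+3)) by exact: is_deriveZ.
rewrite (is_derive_derive1 (is_deriveM dZ dPsi)) /GRing.scale/= -!derive1nS !exprS; field.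
by rewrite y0 expf_neq0.
Qed.

End OneVariable.

Section HomShift.
Variable R : realType.
Implicit Types (lam : R[i]) (alpha : bool) (c : R).

Lemma cexp_real (t : R) : cexp t%:C = (expR t)%:C.
Proof. by rewrite /cexp/= cos0 sin0; simpc. Qed.

Lemma hom_nat lam alpha (n : nat) (u : R) : - lam = n%:R -> 0 < u ->
  hom lam alpha u = (u ^+ n)%:C.
Proof.
move=> ln u0; rewrite hom_gt0// ln.
have -> : n%:R * (exp.ln u)%:C = (n%:R * exp.ln u)%:C :> R[i] by rewrite rmorphM/= rmorph_nat.
by rewrite cexp_real expRM_natl lnK.
Qed.

Lemma hom_shift1 lam alpha c : c != 0 ->
  hom lam alpha c * (c^-1)%:C = hom (lam + 1) (~~ alpha) c.
Proof.
move=> c0; have n0 : 0 < `|c| by rewrite normr_gt0.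
have E : cexp (- (lam + 1) * (exp.ln `|c|)%:C) = cexp (- lam * (exp.ln `|c|)%:C) * (`|c|^-1)%:C.
  rewrite opprD mulrDl cexpD; congr (_ * _).
  by rewrite mulN1r -rmorphN cexp_real expRN lnK.
rewrite /hom E; move: (cexp _) => C {E}.
rewrite -!mulrA [RHS]mulrCA [LHS]mulrCA; congr (_ * _).
have [c1|c1|c1] := ltgtP c 0; last by rewrite c1 eqxx in c0.
- rewrite ltr0_norm// invrN rmorphN !andbT; case: alpha.
    by change (-1 * (c^-1)%:C = 1 * - (c^-1)%:C); rewrite mulN1r mul1r.
  by change (1 * (c^-1)%:C = -1 * - (c^-1)%:C); rewrite mulN1r mul1r opprK.
- by rewrite !andbF gtr0_norm.
Qed.

Lemma hom_shift lam alpha c (k : nat) : c != 0 ->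
  hom lam alpha c * (c ^- k)%:C = hom (lam + k%:R) (alpha (+) odd k) c.
Proof.
move=> c0; elim: k => [|k IH].
  by rewrite expr0 invr1 mulr1 addr0 addbF.
rewrite exprSr invfM rmorphM mulrA IH hom_shift1// -natr1 addrA.
by rewrite -addbN.
Qed.

End HomShift.

Section LieJetRight.
Variable R : realType.
Implicit Types (f : SL R 3 -> R[i]^o) (g : SL R 3).

Lemma smooth_line21 f g y : smooth f ->
  smooth_at (fun t => complex.Re (f (g * Nmx t 0)%g)) y /\
  smooth_at (fun t => complex.Im (f (g * Nmx t 0)%g)) y.
Proof.
move=> sf; have [s1 s2] := smooth_chart g (y, 0) sf; split=> k.
  exact: (Dk_comp2 (A := fun t : R => t) (B := fun=> 0) (s1 k) (Dk_id k y) (Dk_cst k 0 y)).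
exact: (Dk_comp2 (A := fun t : R => t) (B := fun=> 0) (s2 k) (Dk_id k y) (Dk_cst k 0 y)).
Qed.

Lemma smooth_line31 f g z : smooth f ->
  smooth_at (fun t => complex.Re (f (g * Nmx 0 t)%g)) z /\
  smooth_at (fun t => complex.Im (f (g * Nmx 0 t)%g)) z.
Proof.
move=> sf; have [s1 s2] := smooth_chart g (0, z) sf; split=> k.
  exact: (Dk_comp2 (A := fun=> 0) (B := fun t : R => t) (s1 k) (Dk_cst k 0 z) (Dk_id k z)).
exact: (Dk_comp2 (A := fun=> 0) (B := fun t : R => t) (s2 k) (Dk_cst k 0 z) (Dk_id k z)).
Qed.

Lemma cderive_mul_scale (K : R[i]) (F1 F2 : R -> R) (c : R) :
  smooth_at F1 0 -> smooth_at F2 0 ->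
  derive1 (fun z => complex.Re (K * (F1 (z * c) +i* F2 (z * c)))) 0 +i*
  derive1 (fun z => complex.Im (K * (F1 (z * c) +i* F2 (z * c)))) 0 =
  K * c%:C * (derive1 F1 0 +i* derive1 F2 0).
Proof.
move=> s1 s2; case: K => a b.
have dz : is_derive (0 : R) 1 (fun z => z * c) c.
  by apply: is_derive_eq; rewrite /GRing.scale/=; ring.
have d F : smooth_at F 0 -> is_derive (0 : R) 1 (fun z => F (z * c)) (derive1 F 0 * c).
  move=> sF; apply: is_derive_comp1.
  by rewrite mul0r; exact: is_derive_smooth.
have d1 := d _ s1; have d2 := d _ s2.
have e1 : is_derive (0 : R) 1 (fun z => a * F1 (z * c) - b * F2 (z * c))
  (a * (derive1 F1 0 * c) - b * (derive1 F2 0 * c)).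
  exact: (is_deriveB (is_deriveZ a d1) (is_deriveZ b d2)).
have e2 : is_derive (0 : R) 1 (fun z => a * F2 (z * c) + b * F1 (z * c))
  (a * (derive1 F2 0 * c) + b * (derive1 F1 0 * c)).
  exact: (is_deriveD (is_deriveZ a d2) (is_deriveZ b d1)).
rewrite /= (is_derive_derive1 e1) (is_derive_derive1 e2).
by simpc; congr (_ +i* _); ring.
Qed.

(** Moving [Nmx 0 t] to the left of q rescales t to t / c and changes the entry s of q. Each d_z
    thus contributes a factor c^(-1), and the induction needs s arbitrary although elements of P'
    have s = 0. *)
Lemma jet31_right lam alpha f b : I_triv lam alpha f ->
  forall g (q : SL R 3) (c r s d : R), SLmx q = mat3 c r 0 0 d 0 0 s 1 ->
  lie_jet f (nseq b (s31 R)) (g * q)%g =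
  hom lam alpha c * (c ^- b)%:C * lie_jet f (nseq b (s31 R)) g.
Proof.
move=> /I_trivP[sf Hf]; elim: b => [|b IH] g q c r s d qE.
  by rewrite /= Hf qE ?mxE//= invr1 mulr1.
have cd : c * d = 1 by have := det_SL q; rewrite qE det_mat3 => <-; ring.
have c0 : c != 0.
  by apply/eqP => c0; move/eqP: cd; rewrite c0 mul0r eq_sym oner_eq0.
have sfb : smooth (lie_jet f (nseq b (s31 R))) by exact: smooth_lie_jet.
have [s1 s2] := smooth_line31 g 0 sfb.
rewrite -[nseq b.+1 _]/(s31 R :: nseq b (s31 R)).
rewrite -[LHS]/(lie_derive (E31 R) (lie_jet f (nseq b (s31 R))) (g * q)%g).
rewrite -[lie_jet f (_ :: _) g]/(lie_derive (E31 R) (lie_jet f (nseq b (s31 R))) g).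
rewrite !lie_derive_E31.
have E t : lie_jet f (nseq b (s31 R)) (g * q * Nmx 0 t)%g = hom lam alpha c * (c ^- b)%:C *
    (complex.Re (lie_jet f (nseq b (s31 R)) (g * Nmx 0 (t * c^-1))%g) +i*
     complex.Im (lie_jet f (nseq b (s31 R)) (g * Nmx 0 (t * c^-1))%g)).
  have dq : \det (mat3 c r 0 0 d 0 0 (s - t / c * r) 1) = 1.
      by rewrite det_mat3 (_ : _ + _ = c * d)//; ring.
  have -> : (g * q * Nmx 0 t = g * Nmx 0 (t * c^-1) * mkSL dq)%g.
    rewrite -!mulgA; congr (_ * _)%g; apply: SLmx_inj; rewrite !SLmxM !mkSLE qE !mul_mat3.
    by congr (mat3 _ _ _ _ _ _ _ _ _); field.
  rewrite (IH _ _ c r (s - t / c * r) d)//.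
  by case: (lie_jet _ _ (g * Nmx 0 _)%g).
under [X in derive1 X 0 +i* _]eq_fun do rewrite E.
under [X in _ +i* derive1 X 0]eq_fun do rewrite E.
apply: etrans (cderive_mul_scale (hom lam alpha c * (c ^- b)%:C) c^-1 s1 s2) _; congr (_ * _).
by rewrite -mulrA -rmorphM exprSr invfM.
Qed.

Lemma derive1_shift0 (F : R -> R) y : derive1 (fun t => F (y + t)) 0 = derive1 F y.
Proof.
rewrite /derive1; congr (lim (_ @ 0^')); apply/funext => h /=.
by rewrite !addr0 [y + h]addrC.
Qed.

Lemma jet21_line (h : SL R 3 -> R[i]^o) n g y :
  iter n (lie_derive (E21 R)) h (g * Nmx y 0)%g =
  derive1n n (fun t => complex.Re (h (g * Nmx t 0)%g)) y +i*
  derive1n n (fun t => complex.Im (h (g * Nmx t 0)%g)) y.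
Proof.
elim: n y => [|n IH] y; first by rewrite /derive1n/=; case: (h _).
rewrite iterS lie_derive_E21 !derive1nS -!(derive1_shift0 (derive1n n _) y).
by congr (_ +i* _); congr (derive1 _ 0); apply/funext => t; rewrite -mulgA NmxM addr0 IH.
Qed.

Lemma lie_jet_word f a b :
  lie_jet f (word R a b) = iter a (lie_derive (E21 R)) (lie_jet f (nseq b (s31 R))).
Proof.
rewrite /word; elim: a => [//|a IH].
by rewrite iterS -IH.
Qed.

End LieJetRight.

Section DopEquivariance.
Variable R : realType.

Lemma ReM (z w : R[i]) :
  complex.Re (z * w) = complex.Re z * complex.Re w - complex.Im z * complex.Im w.
Proof. by case: z; case: w. Qed.

Lemma ImM (z w : R[i]) :
  complex.Im (z * w) = complex.Re z * complex.Im w + complex.Im z * complex.Re w.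
Proof. by case: z; case: w. Qed.

Lemma complex_mul_parts (K : R[i]) (s A B : R) :
  (s * (complex.Re K * A + - complex.Im K * B)) +i*
  (s * (complex.Im K * A + complex.Re K * B)) = K * s%:C * (A +i* B).
Proof. by case: K => a b /=; simpc; congr (_ +i* _); ring. Qed.

Lemma derive1n_comb (O : set R) (a b : R) (A B : R -> R) n : open O ->
  (forall y, O y -> smooth_at A y) -> (forall y, O y -> smooth_at B y) ->
  forall y, O y -> derive1n n (fun y => a * A y + b * B y) y =
    a * derive1n n A y + b * derive1n n B y.
Proof.
move=> oO sA sB; elim: n => [//|n IH] y Oy.
rewrite !derive1nS.
have -> : derive1 (derive1n n (fun y => a * A y + b * B y)) y =
    derive1 (fun y => a * derive1n n A y + b * derive1n n B y) y.
  rewrite !derive1E; apply: near_eq_derive.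
  by apply: filterS (open_nbhs_nbhs (conj oO Oy)) => z; exact: IH.
have dA := is_derive_smooth (smooth_at_derive1n n (sA _ Oy)).
have dB := is_derive_smooth (smooth_at_derive1n n (sB _ Oy)).
by apply: is_derive_derive1.
Qed.

Lemma Dop0_right lam alpha (f : SL R 3 -> R[i]^o) b (g p : SL R 2) :
  I_triv lam alpha f -> SLmx p q1 q0 = 0 ->
  Dop 0 b f (g * p)%g = hom lam alpha (SLmx p q0 q0) * ((SLmx p q0 q0) ^- b)%:C * Dop 0 b f g.
Proof.
move=> If p0; rewrite /Dop /word /= embedM.
by apply: (jet31_right b If); rewrite embedE p0.
Qed.

(** On the line y, translation by p acts on d_z^m f through the Moebius map s y / (1 + x y) with x =
    r / c and s = c^(-2). As - lam = m + l, homogeneity gives (1 + x y)^(m + l), and the m normal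
    derivatives divide by (1 + x y)^m. What remains is (1 + x y)^l, precisely the weight for which
    Bol's identity applies to d_y^(l + 1). *)
Lemma DopS_right lam alpha (f : SL R 3 -> R[i]^o) l m (g p : SL R 2) :
  lam = 1 - (m + l.+1)%:R ->
  I_triv lam alpha f -> SLmx p q1 q0 = 0 ->
  Dop l.+1 m f (g * p)%g = hom lam alpha (SLmx p q0 q0) *
    ((SLmx p q0 q0) ^- (2 * l.+1 + m))%:C * Dop l.+1 m f g.
Proof.
move=> lamE If p0.
have [sf _] := (I_trivP _ _ _).1 If.
set c := SLmx p q0 q0; set r := SLmx p q0 q1; set d := SLmx p q1 q1.
have cd : c * d = 1.
  by have := det_SL p; rewrite [SLmx p]mat2E det_mat2 p0 mulr0 subr0.
have c0 : c != 0.
  by apply/eqP => c0; move/eqP: cd; rewrite c0 mul0r eq_sym oner_eq0.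
have dE : d = c^-1 by apply: (mulfI c0); rewrite cd mulfV.
set fm := lie_jet f (nseq m (s31 R)).
have sfm : smooth fm by exact: smooth_lie_jet.
pose F1 y := complex.Re (fm (embed g * Nmx y 0)%g).
pose F2 y := complex.Im (fm (embed g * Nmx y 0)%g).
have sF1 y : smooth_at F1 y by have [] := smooth_line21 (embed g) y sfm.
have sF2 y : smooth_at F2 y by have [] := smooth_line21 (embed g) y sfm.
pose x := r / c; pose s := c ^- 2.
(* The derivatives are taken at 0, so a neighbourhood suffices; on it 1 + x y is positive, where
   [hom] is a plain power and the Moebius map is defined. *)
pose O := [set y : R | 0 < 1 + x * y].
have sl k (t : R) : Dk k (fun y => 1 + x * y) t.
  by apply: DkD; [exact: Dk_cst|apply: DkM; [exact: Dk_cst|exact: Dk_id]].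
have oO : open O.
  have -> : O = (fun y => 1 + x * y) @^-1` [set u | 0 < u] by [].
  have /continuousP : continuous (fun y : R => 1 + x * y).
    by move=> z; apply: differentiable_continuous; have [/nbhs_singleton] := sl 1%N z.
  by apply; exact: open_gt.
have O0 : O 0 by rewrite /O /= mulr0 addr0.
pose T (F : R -> R) y := (1 + x * y) ^+ l * F (s * y / (1 + x * y)).
have sT F : (forall y, smooth_at F y) -> forall y, O y -> smooth_at (T F) y.
  move=> sF y Oy k; apply: DkM; first exact: Dk_exp.
  apply: Dk_comp1; first exact: sF.
  apply: DkM; first by apply: DkM; [exact: Dk_cst|exact: Dk_id].
  by apply: Dk_comp1 => //; apply: Dk_inv; rewrite gt_eqF.
pose K := hom lam alpha c * (c ^- m)%:C.
have key y : O y -> fm (embed (g * p) * Nmx y 0)%g = K * (T F1 y +i* T F2 y).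
  move=> Oy; have u0 : 1 + x * y != 0 by rewrite gt_eqF.
  have cu : c + r * y = c * (1 + x * y) by rewrite /x; field.
  have cu0 : c + r * y != 0 by rewrite cu mulf_neq0.
  pose y' := s * y / (1 + x * y).
  have dq : \det (mat3 (c + r * y) r 0 0 (d - y' * r) 0 0 0 1) = 1.
    rewrite det_mat3 (_ : _ + _ = (c + r * y) * (d - y' * r)); last by ring.
    rewrite /y' /s dE cu /x; field.
    by rewrite c0/= (_ : c + r * y = c * (1 + x * y)) ?mulf_neq0.
  have -> : (embed (g * p) * Nmx y 0 = embed g * Nmx y' 0 * mkSL dq)%g.
    rewrite embedM -!mulgA; congr (_ * _)%g; apply: SLmx_inj.
    rewrite !SLmxM embedE !mkSLE p0 -/c -/r -/d !mul_mat3.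
    congr (mat3 _ _ _ _ _ _ _ _ _); try by ring.
    rewrite /y' /s cu dE; field.
    by rewrite c0/= u0.
  rewrite /fm (@jet31_right R lam alpha f m If _ (mkSL dq) (c + r * y) r 0 (d - y' * r) (mkSLE dq)).
  have hn : hom lam alpha (1 + x * y) = ((1 + x * y) ^+ (m + l))%:C.
    by apply: hom_nat => //; rewrite lamE addnS -natr1; ring.
  rewrite cu homM// hn.
  rewrite -/fm [fm _](_ : _ = F1 y' +i* F2 y'); last by rewrite /F1/F2; case: (fm _).
  have -> : T F1 y +i* T F2 y = ((1 + x * y) ^+ l)%:C * (F1 y' +i* F2 y') by rewrite /T; simpc.
  rewrite mulrA; congr (_ * _); rewrite /K; move: (hom lam alpha c) => C.
  rewrite -[LHS]mulrA -[RHS]mulrA; congr (_ * _).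
  rewrite -!rmorphM; apply: (f_equal (real_complex R)); rewrite exprMn exprD; field.
  by rewrite !expf_neq0.
rewrite /Dop !lie_jet_word -/fm.
rewrite -[embed (g * p)%g]mulg1 -[embed g]mulg1 -Nmx0 !jet21_line -/F1 -/F2.
(* Bol's identity is real, while K is complex: the real and the imaginary part of K z are each a
   real combination of the parts of z, and both are treated at once. *)
have nE (P : R[i] -> R) (a b : R) : (forall z, P (K * z) = a * complex.Re z + b * complex.Im z) ->
    derive1n l.+1 (fun t => P (fm (embed (g * p) * Nmx t 0)%g)) 0 =
    s ^+ l.+1 * (a * derive1n l.+1 F1 0 + b * derive1n l.+1 F2 0).
  move=> PE.
  rewrite (@near_eq_derive1n _ _ (fun y => a * T F1 y + b * T F2 y)); last first.
    by apply: filterS (open_nbhs_nbhs (conj oO O0)) => y Oy; rewrite key// PE.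
  rewrite (derive1n_comb a b l.+1 oO (sT _ sF1) (sT _ sF2) O0).
  rewrite /T !(@bol _ x s)//.
  by rewrite mulr0 addr0 expr1n invr1 mulr0 mul0r mulr1; ring.
rewrite (nE (@complex.Re R) (complex.Re K) (- complex.Im K)); last first.
  by move=> z; rewrite ReM mulNr.
rewrite (nE (@complex.Im R) (complex.Im K) (complex.Re K)); last first.
  by move=> z; rewrite ImM addrC.
have -> : hom lam alpha c * (c ^- (2 * l.+1 + m))%:C = K * (s ^+ l.+1)%:C.
  rewrite /K; move: (hom lam alpha c) => C; rewrite -mulrA; congr (_ * _).
  rewrite -rmorphM; apply: (f_equal (real_complex R)).
  by rewrite /s exprD exprM exprVn invfM mulrC.
exact: complex_mul_parts.
Qed.

(* The conditions under which [Dop a b] maps [I_triv lam alpha] to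
   [J_triv nu beta]; for [a > 0] this rests on Bol's identity. *)
Definition admissible (lam nu : R[i]) (alpha beta : bool) (a b : nat) :=
  [/\ nu = lam + (2 * a + b)%:R, beta = alpha (+) odd b &
      (a = 0)%N \/ lam = 1 - (a + b)%:R].

Lemma Dop_J lam nu alpha beta a b (f : SL R 3 -> R[i]^o) :
  admissible lam nu alpha beta a b -> I_triv lam alpha f -> J_triv nu beta (Dop a b f).
Proof.
move=> [nuE betaE ab] If; have [sf _] := (I_trivP _ _ _).1 If.
apply/J_trivP; split; first by apply: smooth_embed; exact: smooth_lie_jet.
move=> g p p0.
have c0 : SLmx p q0 q0 != 0.
  apply/eqP => c0; have := det_SL p; rewrite [SLmx p]mat2E det_mat2 p0 c0 mul0r mulr0 subr0.
  by move/eqP; rewrite eq_sym oner_eq0.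
have -> : hom nu beta (SLmx p q0 q0) =
    hom lam alpha (SLmx p q0 q0) * ((SLmx p q0 q0) ^- (2 * a + b))%:C.
  by rewrite hom_shift// nuE betaE oddD oddM.
case: a ab {nuE} => [|a] ab.
  exact: Dop0_right.
case: ab => // lamE; apply: DopS_right => //.
by rewrite lamE addnC.
Qed.

End DopEquivariance.

(** * The operators d_y^a d_z^b and their combinations as elements of [Diff] *)

Section LinearCombinations.
Variable R : realType.

(** The factor bounds the four products of real parts; its summand 1 keeps the inequality strict
    when both coefficients vanish. *)
Lemma cnear_comb (c1 c2 z z' w w' : R[i]) (e : R) : 0 < e ->
  cnear e z z' -> cnear e w w' ->
  cnear (e * (`|complex.Re c1| + `|complex.Im c1| + `|complex.Re c2| + `|complex.Im c2| + 1))
    (c1 * z + c2 * w) (c1 * z' + c2 * w').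
Proof.
case: c1 c2 z z' w w' => [a1 b1] [a2 b2] [x y] [x' y'] [u v] [u' v'] e0 [/= h1 h2] [h3 h4].
have B (k p q : R) : `|p - q| < e -> `|k * (p - q)| <= `|k| * e.
  by move=> /ltW h; rewrite normrM ler_wpM2l.
have T (s t p q : R) : `|s - t + p - q| <= `|s| + `|t| + `|p| + `|q|.
  rewrite (le_trans (ler_normB _ _))// lerD2r (le_trans (ler_normD _ _))// lerD2r.
  exact: ler_normB.
split => /=; rewrite mulrDr mulr1.
- rewrite (_ : _ - _ = a1 * (x - x') - b1 * (y - y') + a2 * (u - u') - b2 * (v - v')); last by ring.
  apply: (le_lt_trans (T _ _ _ _)); rewrite ltr_pwDr//.
  have := B a1 _ _ h1; have := B b1 _ _ h2; have := B a2 _ _ h3; have := B b2 _ _ h4.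
  by rewrite !mulrDr ![e * `|_|]mulrC => ? ? ? ?; rewrite !lerD.
- rewrite (_ : _ - _ = a1 * (y - y') - (- b1) * (x - x') + a2 * (v - v') - (- b2) * (u - u')); last by ring.
  apply: (le_lt_trans (T _ _ _ _)); rewrite ltr_pwDr//.
  have := B a1 _ _ h2; have := B (- b1) _ _ h1; have := B a2 _ _ h4; have := B (- b2) _ _ h3.
  by rewrite !mulrDr ![e * `|_|]mulrC !normrN => ? ? ? ?; rewrite !lerD.
Qed.

Lemma smooth_comb2 n (c1 c2 : R[i]) (f1 f2 : SL R n -> R[i]^o) :
  smooth f1 -> smooth f2 -> smooth (c1 *: f1 + c2 *: f2).
Proof.
move=> s1 s2; apply: smooth_comb => //.
(* Scaling is obtained from c f + f' by writing c f = (c - 1) f + f; the same device recurs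
   below. *)
have -> : c2 *: f2 = (c2 - 1) *: f2 + f2 by rewrite scalerBl scale1r subrK.
exact: smooth_comb.
Qed.

Lemma lie_jet_comb2 (c1 c2 : R[i]) (f1 f2 : SL R 3 -> R[i]^o) w :
  smooth f1 -> smooth f2 ->
  lie_jet (c1 *: f1 + c2 *: f2) w = c1 *: lie_jet f1 w + c2 *: lie_jet f2 w.
Proof.
move=> s1 s2.
have E : c2 *: f2 = (c2 - 1) *: f2 + f2 by rewrite scalerBl scale1r subrK.
have s2' : smooth (c2 *: f2) by rewrite E; exact: smooth_comb.
rewrite lie_jet_comb// E lie_jet_comb//; congr (_ + _).
by rewrite scalerBl scale1r subrK.
Qed.

Lemma I_triv_comb lam alpha (c : R[i]) (f1 f2 : SL R 3 -> R[i]^o) :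
  I_triv lam alpha f1 -> I_triv lam alpha f2 -> I_triv lam alpha (c *: f1 + f2).
Proof.
move=> /I_trivP[s1 h1] /I_trivP[s2 h2]; apply/I_trivP; split; first exact: smooth_comb.
move=> g h H1 H2; rewrite !fctE h1// h2// mulrDr; congr (_ + _).
by rewrite [LHS]mulrCA.
Qed.

Lemma I_triv_scale lam alpha (c : R[i]) (f : SL R 3 -> R[i]^o) :
  I_triv lam alpha f -> I_triv lam alpha (c *: f).
Proof.
move=> If; have -> : c *: f = (c - 1) *: f + f by rewrite scalerBl scale1r subrK.
exact: I_triv_comb.
Qed.

Lemma J_triv_comb2 nu beta (c1 c2 : R[i]) (f1 f2 : SL R 2 -> R[i]^o) :
  J_triv nu beta f1 -> J_triv nu beta f2 -> J_triv nu beta (c1 *: f1 + c2 *: f2).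
Proof.
move=> /J_trivP[s1 h1] /J_trivP[s2 h2]; apply/J_trivP; split; first exact: smooth_comb2.
move=> g h H1; rewrite !fctE h1// h2// mulrDr; congr (_ + _).
  by rewrite [LHS]mulrCA.
by rewrite [LHS]mulrCA.
Qed.

Lemma I_triv_ltranslate lam alpha (g : SL R 3) f :
  I_triv lam alpha f -> I_triv lam alpha (ltranslate g f).
Proof.
move=> /I_trivP[s h]; apply/I_trivP; split; first exact: smooth_ltranslate.
by move=> x q q1 q2; rewrite /ltranslate mulgA h.
Qed.

End LinearCombinations.

Section Locality.
Variable R : realType.

Lemma lie_jet_local n (O : set (SL R n)) (f : SL R n -> R[i]^o) w : open O ->
  (forall g, O g -> f g = 0) -> forall g, O g -> lie_jet f w g = 0.
Proof.
move=> oO fO; elim: w => [|X w IH] g Og; first exact: fO.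
have [C oC CE] := oO.
pose h := lie_jet f w.
rewrite -[lie_jet f (X :: w)]/(lie_derive (set_val X) h).
have CX : \forall t \near (0 : R), C (SLmx g *m expm (t *: set_val X)).
  have [/derivable1_diffP/differentiable_continuous + _] := is_derive_curve (SLmx g) (set_val X).
  rewrite /prop_for /continuous_at expm0 mulmx1 => /(_ C); apply.
  by apply: open_nbhs_nbhs; split=> //; move: Og; rewrite -CE.
have H : \forall t \near (0 : R), extend0 h (SLmx g *m expm (t *: set_val X)) = 0.
  apply: filterS CX => t Ct.
  have [d1|d1] := pselect (\det (SLmx g *m expm (t *: set_val X)) = 1); last exact: extend0_off.
  by rewrite extend0_mkSL; apply: IH; rewrite -CE.
have Z (P : R[i] -> R) : P 0 = 0 ->
    derive1 (fun t => P (extend0 h (SLmx g *m expm (t *: set_val X)))) 0 = 0.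
  move=> P0; rewrite derive1E (@near_eq_derive _ _ _ _ (cst 0)) ?derive_cst//.
  by apply: filterS H => t ->.
by rewrite /lie_derive (Z (@complex.Re R))// (Z (@complex.Im R)).
Qed.

Lemma PGP (q : SL R 3) : PG q <-> SLmx q o1 o0 = 0 /\ SLmx q o2 o0 = 0.
Proof.
split=> [[m [a [u [[h [dh mE]] [t aE] [x uE] qE]]]]|[q1 q2]].
  have E : SLmx q = mat3 (\det h)^-1 0 0 0 (h q0 q0) (h q0 q1) 0 (h q1 q0) (h q1 q1) *m
      mat3 (expR t) 0 0 0 (expR (- (t / 2))) 0 0 0 (expR (- (t / 2))) *m
      mat3 1 (x q0) (x q1) 0 1 0 0 0 1.
    by rewrite qE !SLmxM mE aE uE expm_H0 expm_N block_mat12.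
  rewrite !mul_mat3 !mul0r !mulr0 !addr0 !mulr1 in E.
  by rewrite E !mxE.
have [m [a [u [t [eps [Hm Ha Hu qE _]]]]]] := MG_decomp q1 q2.
by exists m, a, u; split=> //; exists t.
Qed.

Lemma PG'_lower (p : SL R 2) : PG' p -> SLmx p q1 q0 = 0.
Proof.
move=> [m [a [u [[eps [He mE]] [t aE] [x uE] ->]]]].
have E : SLmx (m * a * u)%g = mat2 eps 0 0 eps *m mat2 (expR t) 0 0 (expR (- t)) *m mat2 1 x 0 1.
  rewrite !SLmxM mE aE uE expm_H0' expm_N'; congr (_ *m _ *m _).
  by apply/matrixP; apply: ord2P; apply: ord2P; rewrite !mxE.
by rewrite !mul_mat2 !mul0r !mulr0 !addr0 !mulr1 in E; rewrite E !mxE.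
Qed.

Lemma PG_mul (p q : SL R 3) : PG p -> PG q -> PG (p * q)%g.
Proof.
move=> /PGP[p1 p2] /PGP[q1 q2]; apply/PGP; rewrite SLmxM !mxE !sum3 p1 p2 q1 q2.
by rewrite !mul0r !mulr0 !addr0.
Qed.

Lemma PG_inv (q : SL R 3) : PG q -> PG q^-1%g.
Proof.
move=> /PGP[h1 h2].
have E i : SLmx q^-1%g i o0 * SLmx q o0 o0 = (i == o0)%:R.
  have := congr1 (fun M : SL R 3 => SLmx M i o0) (mulVg q).
  by rewrite SLmxM mxE sum3 h1 h2 !mulr0 !addr0 => ->; rewrite mxE.
have c0 : SLmx q o0 o0 != 0.
  by apply/eqP => c0; have := E o0; rewrite c0 mulr0 => /eqP; rewrite eq_sym oner_eq0.
by apply/PGP; split; apply: (mulIf c0); rewrite E mul0r.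
Qed.

Lemma left_coset_mul (k q : SL R 3) : PG q -> left_coset (@PG R) (k * q)%g = left_coset (@PG R) k.
Proof.
move=> Pq; apply/seteqP; split=> x [p Pp <-].
  by exists (q * p)%g; [exact: PG_mul|rewrite mulgA].
exists (q^-1 * p)%g; first by apply: PG_mul => //; exact: PG_inv.
by rewrite mulgA mulgK.
Qed.

Lemma PG1 : PG (1%g : SL R 3).
Proof. by apply/PGP; rewrite SLmx1 !mxE. Qed.

Lemma PG'1 : PG' (1%g : SL R 2).
Proof.
exists 1%g, 1%g, 1%g; split; last by rewrite !mulg1.
- by exists 1; split; [left|rewrite SLmx1].
- by exists 0; rewrite expm0 SLmx1.
- by exists 0; rewrite expm0 SLmx1.
Qed.

(** An open set of G/P is pulled back to G'/P', which is meaningful because P' is sent into P. If f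
    vanished on all cosets of that open set, F would vanish on the pulled back set, against the
    choice of g in its support. *)
Lemma support_embed (f : SL R 3 -> R[i]^o) (F : SL R 2 -> R[i]^o) :
  (forall O : set (SL R 3), open O -> (forall k, O k -> f k = 0) ->
    forall h, O (embed h) -> F h = 0) ->
  forall g, Defs.support (@PG' R) F (left_coset (@PG' R) g) -> Defs.support (@PG R) f (left_coset (@PG R) (embed g)).
Proof.
move=> loc g [_ Hg]; split; first by exists (embed g).
move=> U oU Ug.
pose U' (x : set (SL R 2)) := exists h, x h /\ U (left_coset (@PG R) (embed h)).
have U'E h : U' (left_coset (@PG' R) h) <-> U (left_coset (@PG R) (embed h)).
  split=> [[_ [[p Pp <-]]]|Uh].
    rewrite embedM left_coset_mul//; apply/PGP; rewrite embedE PG'_lower// !mxE//.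
  exists h; split=> //; exists 1%g; [exact: PG'1|by rewrite mulg1].
have oU' : Defs.quotient_open (@PG' R) U'.
  rewrite /Defs.quotient_open (_ : [set _ | _] = @embed R @^-1` [set k | U (left_coset (@PG R) k)]).
    by move/continuousP : (@continuous_embed R); apply.
  by apply/seteqP; split=> h /U'E.
have [h [/U'E Uh Fh]] := Hg U' oU' ((U'E g).2 Ug).
apply: contrapT => noex; apply: Fh; apply: (loc _ oU) => // k Uk.
by apply: contrapT => fk; apply: noex; exists k.
Qed.

End Locality.

Section DifferentialOperators.
Variables (R : realType) (lam nu : R[i]) (alpha beta : bool).

(** The zero branch follows the encoding of operators in [Diff]. Two terms are enough because for
    fixed parameters at most one admissible pair has a > 0. *)
Definition Dcomb (c1 c2 : R[i]) (a1 b1 a2 b2 : nat) (f : SL R 3 -> R[i]^o) :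
    SL R 2 -> R[i]^o :=
  if pselect (I_triv lam alpha f) is left _ then c1 *: Dop a1 b1 f + c2 *: Dop a2 b2 f else 0.

Lemma DcombE c1 c2 a1 b1 a2 b2 f : I_triv lam alpha f ->
  Dcomb c1 c2 a1 b1 a2 b2 f = c1 *: Dop a1 b1 f + c2 *: Dop a2 b2 f.
Proof. by rewrite /Dcomb; case: pselect. Qed.

Lemma Dcomb_off c1 c2 a1 b1 a2 b2 f : ~ I_triv lam alpha f ->
  Dcomb c1 c2 a1 b1 a2 b2 f = 0.
Proof. by rewrite /Dcomb; case: pselect. Qed.

Lemma Dop_comb (c : R[i]) a b (f1 f2 : SL R 3 -> R[i]^o) : smooth f1 -> smooth f2 ->
  Dop a b (c *: f1 + f2) = c *: Dop a b f1 + Dop a b f2.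
Proof. by move=> s1 s2; apply/funext => g; rewrite /Dop lie_jet_comb. Qed.

Lemma Dop_ltranslate a b (f : SL R 3 -> R[i]^o) (g : SL R 2) :
  Dop a b (ltranslate (embed g) f) = ltranslate g (Dop a b f).
Proof.
by apply/funext => h; rewrite /Dop lie_jet_ltranslate /ltranslate embedM embedV.
Qed.

Lemma lie_jet_Dcomb c1 c2 a1 b1 a2 b2 f (w : seq (@sl R 2)) : I_triv lam alpha f ->
  lie_jet (Dcomb c1 c2 a1 b1 a2 b2 f) w = fun x =>
    c1 * lie_jet f (map (@embed_sl R) w ++ word R a1 b1) (embed x) +
    c2 * lie_jet f (map (@embed_sl R) w ++ word R a2 b2) (embed x).
Proof.
move=> If; have [sf _] := (I_trivP _ _ _).1 If.
rewrite DcombE//.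
rewrite -[_ + _]/((fun g => (c1 *: lie_jet f (word R a1 b1) + c2 *: lie_jet f (word R a2 b2)) (embed g))
  : SL R 2 -> R[i]^o).
rewrite lie_jet_embed lie_jet_comb2; [|exact: smooth_lie_jet|exact: smooth_lie_jet].
by apply/funext => x; rewrite /lie_jet !foldr_cat.
Qed.

(** A Lie derivative of the image along w is a Lie derivative of f along the embedded word followed
    by [word]. Each seminorm of the image on K is thus controlled by two seminorms of f on the
    compact image of K. *)
Lemma Dcomb_continuous c1 c2 a1 b1 a2 b2 :
  {within (I_triv lam alpha : set (Coo_topology R 3)), continuous
    (Dcomb c1 c2 a1 b1 a2 b2 : Coo_topology R 3 -> Coo_topology R 2)}.
Proof.
apply/subspace_continuousP => f If; apply/Coo_cvgP => w K e cK e0.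
have cK' : compact (@embed R @` K).
  by apply: continuous_compact => //; apply: continuous_subspaceT; exact: continuous_embed.
set M := `|complex.Re c1| + `|complex.Im c1| + `|complex.Re c2| + `|complex.Im c2| + 1.
have M0 : 0 < M by rewrite ltr_wpDl// !addr_ge0.
have eM : 0 < e / M by rewrite divr_gt0.
pose f' : Coo_topology R 3 := f.
have nf : nbhs f' --> f' by exact: cvg_id.
have H1 := (Coo_cvgP f' (nbhs_filter f')).1 nf (map (@embed_sl R) w ++ word R a1 b1) _ _ cK' eM.
have H2 := (Coo_cvgP f' (nbhs_filter f')).1 nf (map (@embed_sl R) w ++ word R a2 b2) _ _ cK' eM.
have H : \forall h \near f', I_triv lam alpha h -> forall x, K x ->
    cnear e (lie_jet (Dcomb c1 c2 a1 b1 a2 b2 f) w x) (lie_jet (Dcomb c1 c2 a1 b1 a2 b2 h) w x).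
  apply: filterS2 H1 H2 => h h1 h2 Ih x Kx; rewrite !lie_jet_Dcomb//.
  rewrite -[e](divfK (lt0r_neq0 M0)) /M; apply: cnear_comb => //.
    by apply: h1; exists x.
  by apply: h2; exists x.
exact: H.
Qed.

Lemma Dcomb_Diff c1 c2 a1 b1 a2 b2 :
  admissible lam nu alpha beta a1 b1 -> admissible lam nu alpha beta a2 b2 ->
  Diff (I_triv lam alpha) (J_triv nu beta) (Dcomb c1 c2 a1 b1 a2 b2).
Proof.
move=> A1 A2; split.
- move=> f If; rewrite DcombE//; apply: J_triv_comb2; exact: Dop_J If.
- by move=> f nIf; rewrite Dcomb_off.
- move=> c f1 f2 I1 I2.
  have [s1 _] := (I_trivP _ _ _).1 I1; have [s2 _] := (I_trivP _ _ _).1 I2.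
  rewrite !DcombE//; last exact: I_triv_comb.
  rewrite !Dop_comb// !scalerDr !scalerA addrACA.
  by rewrite [c1 * c]mulrC [c2 * c]mulrC.
- exact: Dcomb_continuous.
- split=> [f g If|f g If].
    rewrite !DcombE//; last exact: I_triv_ltranslate.
    by rewrite !Dop_ltranslate.
  apply: support_embed => O oO fO h Oh; rewrite DcombE//.
  rewrite -[LHS]/(c1 * lie_jet f (word R a1 b1) (embed h) + c2 * lie_jet f (word R a2 b2) (embed h)).
  by rewrite !(lie_jet_local _ oO fO)// !mulr0 addr0.
Qed.

End DifferentialOperators.

(** * Sections with prescribed germ at the base point *)

Section Bump.
Variable R : realType.

(** The powers t^(-n) are included because derivatives of e^(-1/t) produce them: the linear span of
    the family is closed under differentiation. *)
Definition theta (n : nat) (t : R) : R := if 0 < t then t ^- n * expR (- t^-1) else 0.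

Lemma theta_le0 n t : t <= 0 -> theta n t = 0.
Proof. by rewrite /theta ltNge => ->. Qed.

Lemma theta_ge0 n t : 0 <= theta n t.
Proof. by rewrite /theta; case: ltP => // t0; rewrite mulr_ge0 ?expR_ge0// invr_ge0 exprn_ge0// ltW. Qed.

(** With u = 1/t, e^u dominates u^(n+2) / (n+2)!. A quadratic bound is what makes the derivative at
    0 vanish. *)
Lemma theta_bound n t : `|theta n t| <= (n.+2)`!%:R * t ^+ 2.
Proof.
rewrite ger0_norm ?theta_ge0// /theta; case: ltP => t0; last by rewrite mulr_ge0// sqr_ge0.
have u0 : 0 < t^-1 by rewrite invr_gt0.
have := expR_ge1Dxn n.+1 (ltW u0) => H.
have {H} : (t^-1) ^+ n.+2 <= (n.+2)`!%:R * expR t^-1.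
  rewrite mulrC -ler_pdivrMr ?ltr0n ?fact_gt0//; apply: le_trans H.
  by rewrite lerDr.
move=> H; rewrite expRN ler_pdivrMr ?expR_gt0//.
have -> : t ^- n = (t^-1) ^+ n.+2 * t ^+ 2.
  by rewrite exprVn -addn2 exprD invfM divfK// expf_neq0// gt_eqF.
by rewrite [leRHS]mulrAC ler_wpM2r// sqr_ge0.
Qed.

Lemma is_derive_theta n (t : R) :
  is_derive t 1 (theta n) (theta n.+2 t - n%:R * theta n.+1 t).
Proof.
have [t0|t0|->] := ltgtP t 0.
- rewrite !theta_le0 ?(ltW t0)// mulr0 subr0.
  apply: (@near_eq_is_derive _ _ _ (cst (0 : R))).
  have := @open_nbhs_nbhs _ t [set u | u < 0]; case; first by split => //; exact: open_lt.
  by move=> e /= e0 H; exists e => // u /H /= u0; rewrite theta_le0// ltW.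
- have nt : \forall u \near t, 0 < u by exact: lt_nbhsr.
  have tn0 : t != 0 by rewrite gt_eqF.
  have dI : is_derive t 1 (fun u : R => u^-1) (- t ^- 2).
    by apply: is_derive_eq (@is_deriveV R id t _ 1 tn0 (is_derive_id _ _)) _; rewrite [LHS]mulr1.
  have dE : is_derive t 1 (fun u : R => expR (- u^-1)) (expR (- t^-1) * t ^- 2).
    apply: is_derive_comp1 (is_derive_expR _).
    by apply: is_derive_eq (is_deriveN dI) _; rewrite opprK.
  have dX : is_derive t 1 (fun u : R => (u^-1) ^+ n) (n%:R * (t^-1) ^+ n.-1 * - t ^- 2).
    by have := is_deriveX n dI; rewrite exprfctE.
  have D : is_derive t 1 (fun u : R => (u^-1) ^+ n * expR (- u^-1)) (theta n.+2 t - n%:R * theta n.+1 t).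
    apply: is_derive_eq (is_deriveM dX dE) _.
    rewrite /GRing.scale/= /theta t0 -!exprVn; case: n {dX} => [|n].
      by rewrite !mul0r !mulr0 addr0 subr0 expr0 mul1r mulrC.
    rewrite /= !exprS; ring.
  apply: near_eq_is_derive D.
  by apply: filterS nt => u u0; rewrite /theta u0 exprVn.
- rewrite !theta_le0// mulr0 subr0.
  have z : continuous (\0 : R -> R) by move=> u; exact: cvg_cst.
  have [|dF vF] := @differentiable_littleo R R R (theta n) 0 (\0 : {linear R -> R}) z.
    move=> e e0; pose d := e / (n.+2)`!%:R.
    have d0 : 0 < d by rewrite divr_gt0// ltr0n fact_gt0.
    apply/nbhs_normP; exists d => //= h /=; rewrite sub0r normrN => hd.
    rewrite addr0 (theta_le0 n (lexx 0)) !subr0 (le_trans (theta_bound n h))//.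
    rewrite -(real_normK (num_real h)) expr2 mulrA ler_wpM2r//.
    by rewrite mulrC -ler_pdivlMr ?ltr0n ?fact_gt0// ltW.
  by apply: DeriveDef; [exact: diff_derivable|rewrite deriveE// vF].
Qed.

Lemma Dk_theta k n t : Dk k (theta n) t.
Proof.
elim: k n t => // k IH n t; apply: DkS1.
  by near=> u; apply/derivable1_diffP; have [] := is_derive_theta n u.
rewrite (_ : derive1 _ = fun u => theta n.+2 u - n%:R * theta n.+1 u).
  by apply: DkB => //; apply: DkM => //; exact: Dk_cst.
by apply/funext => u; rewrite derive1E; have [_ ->] := is_derive_theta n u.
Unshelve. all: by end_near. Qed.

(** A smooth step by composition: the inner argument is constant for w <= 1 and nonpositive for w >=
    2, and the denominator is a constant that normalizes the value to 1. *)
Definition plateau (w : R) : R :=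
  theta 0 (theta 0 1 - theta 0 (w - 1)) / theta 0 (theta 0 1).

Lemma Dk_plateau k w : Dk k plateau w.
Proof.
apply: DkM; last exact: Dk_cst.
apply: (@Dk_comp1 _ _ (theta 0)); first exact: Dk_theta.
apply: DkB; first exact: Dk_cst.
apply: (@Dk_comp1 _ _ (theta 0)); first exact: Dk_theta.
by apply: DkB; [exact: Dk_id|exact: Dk_cst].
Qed.

Lemma theta0_gt0 t : 0 < t -> 0 < theta 0 t.
Proof. by move=> t0; rewrite /theta t0 mulr_gt0 ?expR_gt0// expr0 invr1. Qed.

Lemma plateau1 w : w <= 1 -> plateau w = 1.
Proof.
move=> w1; rewrite /plateau (@theta_le0 0 (w - 1)) ?subr_le0// subr0 divff//.
by rewrite gt_eqF// !theta0_gt0.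
Qed.

Lemma plateau0 w : 2 <= w -> plateau w = 0.
Proof.
move=> w2; rewrite /plateau theta_le0 ?mul0r// subr_le0.
have w1 : 1 <= w - 1 by rewrite lerBrDr.
have w0 : 0 < w - 1 by exact: lt_le_trans w1.
rewrite /theta w0 ltr01 !expr0 invr1 !mul1r ler_expR lerN2 invf_le1//.
Qed.

End Bump.

Section Sections.
Variables (R : realType) (lam : R[i]) (alpha : bool).

(** Near c the sign eps is constant, so there the function is a constant times the exponential of a
    multiple of ln (eps d). *)
Lemma Dk_hom (k : nat) (c : R) : c != 0 ->
  Dk k (fun c => complex.Re (hom lam alpha c)) c /\ Dk k (fun c => complex.Im (hom lam alpha c)) c.
Proof.
move=> c0; have [eps [He cE ee]] := sign_norm c0.
have e0 : eps != 0 by case: He => ->; rewrite ?oppr_eq0 oner_eq0.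
have ec : 0 < eps * c by rewrite cE mulrA ee mul1r expR_gt0.
have nc : \forall d \near c, 0 < eps * d.
  have Dl : Dk 1 (fun d : R => eps * d) c by apply: DkM; [exact: Dk_cst|exact: Dk_id].
  have := differentiable_continuous (nbhs_singleton Dl.1).
  by move=> /(_ [set u | 0 < u]); apply; exact: lt_nbhsr.
case lamE : (- lam) => [a b].
pose L d := ln (eps * d).
have hE d : 0 < eps * d -> hom lam alpha d = hom lam alpha eps *
    ((expR (a * L d) * cos (b * L d)) +i* (expR (a * L d) * sin (b * L d))).
  move=> ed; have d0 : d != 0 by apply/eqP => d0; rewrite d0 mulr0 ltxx in ed.
  rewrite -[in LHS](_ : eps * (eps * d) = d); last by rewrite mulrA ee mul1r.
  rewrite homM ?mulf_neq0//; congr (_ * _).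
  by rewrite hom_gt0// lamE /cexp /=; simpc.
have DL : Dk k L c.
  apply: (@Dk_comp1 _ _ (@ln R)); first exact: Dk_ln.
  by apply: DkM; [exact: Dk_cst|exact: Dk_id].
have Dc (x : R) : Dk k (fun d => x * L d) c by apply: DkM => //; exact: Dk_cst.
have De : Dk k (fun d => expR (a * L d)) c by apply: (@Dk_comp1 _ _ (@expR R)) => //; exact: Dk_expR.
have D1 : Dk k (fun d => expR (a * L d) * cos (b * L d)) c.
  by apply: DkM => //; apply: (@Dk_comp1 _ _ (@cos R)) => //; exact: (Dk_sin_cos _ _).2.
have D2 : Dk k (fun d => expR (a * L d) * sin (b * L d)) c.
  by apply: DkM => //; apply: (@Dk_comp1 _ _ (@sin R)) => //; exact: (Dk_sin_cos _ _).1.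
split.
- apply: near_eq_Dk; first by apply: filterS nc => d /hE ->; rewrite ReM; reflexivity.
  by apply: DkB; apply: DkM => //; exact: Dk_cst.
- apply: near_eq_Dk; first by apply: filterS nc => d /hE ->; rewrite ImM; reflexivity.
  by apply: DkD; apply: DkM => //; exact: Dk_cst.
Qed.

End Sections.

Section Families.
Variables (R : realType) (lam : R[i]) (alpha : bool).
Local Notation V := (R * 'M[R]_3)%type.

(** An open set of matrices containing SL(3,R). Functions of the first column are smooth on it,
    which provides the ambient representatives required by [smooth]. *)
Definition col0_neq0 : set 'M[R]_3 :=
  [set x | 0 < (x o1 o0) ^+ 2 + (x o2 o0) ^+ 2 + (x o0 o0) ^+ 2].

Lemma smooth_continuous (W : normedModType R) (F : W -> R) :
  (forall x k, Dk k F x) -> continuous F.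
Proof.
by move=> DF x; apply: differentiable_continuous; exact: (nbhs_singleton (DF x 1%N).1).
Qed.

Lemma open_col0_neq0 : open col0_neq0.
Proof.
have /smooth_continuous/continuousP : forall (x : 'M[R]_3) k,
    Dk k (fun x : 'M[R]_3 => (x o1 o0) ^+ 2 + (x o2 o0) ^+ 2 + (x o0 o0) ^+ 2) x.
  by move=> x k; apply: DkD; [apply: DkD|]; apply: Dk_exp; exact: Dk_coord.
by move=> /(_ [set u | 0 < u]); apply; exact: open_gt.
Qed.

Lemma SL_col0_neq0 (g : SL R 3) : col0_neq0 (SLmx g).
Proof.
rewrite /col0_neq0/= lt_neqAle !addr_ge0 ?sqr_ge0// andbT eq_sym.
apply/negP; rewrite !paddr_eq0 ?addr_ge0 ?sqr_ge0// !sqrf_eq0 => /andP[/andP[/eqP h1 /eqP h2] /eqP h3].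
have := det_SL g; rewrite [SLmx g]mat3E h1 h2 h3 det_mat3 => /eqP.
by rewrite eq_sym (_ : _ + _ = 0) ?oner_eq0//; ring.
Qed.

Lemma Dk_Mcoord k i j (p : V) : Dk k (fun p : V => p.2 i j) p.
Proof.
apply: Dk_linear; first by move=> a u v; rewrite /= !mxE.
move=> q; apply: (continuous_comp (f := snd) (g := fun x : 'M[R]_3 => x i j)).
  exact: cvg_snd.
exact: coord_continuous.
Qed.

Lemma Dk_Rcoord k (p : V) : Dk k (fun p : V => p.1) p.
Proof. by apply: Dk_linear => // q; exact: cvg_fst. Qed.

Definition ratio (x : 'M[R]_3) : R * R := (x o1 o0 / x o0 o0, x o2 o0 / x o0 o0).

Definition cutoff (x : 'M[R]_3) : R := plateau ((ratio x).1 ^+ 2 + (ratio x).2 ^+ 2).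

(** The parameter r and the matrix form one variable, so that derivatives in r and along matrices
    can be interchanged; P selects the real or the imaginary part. The value 0 at a vanishing corner
    entry is the smooth continuation, because [cutoff] is 0 nearby. *)
Definition fam (P : R[i] -> R) (Phi : R * (R * R) -> R) (p : V) : R :=
  if p.2 o0 o0 == 0 then 0 else
  P (hom lam alpha (p.2 o0 o0)) * cutoff p.2 * Phi (p.1, ratio p.2).

Definition Re_or_Im (P : R[i] -> R) := P = @complex.Re R \/ P = @complex.Im R.

Lemma smooth_fam P Phi (p : V) : Re_or_Im P -> (forall q, smooth_at Phi q) ->
  col0_neq0 p.2 -> smooth_at (fam P Phi) p.
Proof.
move=> HP SPhi Up k.
have nbhs_open (F : V -> R) (A : set R) : (forall q k, Dk k F q) -> open A -> A (F p) ->
    \forall q \near p, A (F q).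
  move=> DF oA Ap; have := smooth_continuous DF (x := p).
  by move=> /(_ A); apply; exact: open_nbhs_nbhs.
have [x0|x0] := eqVneq (p.2 o0 o0) 0.
  (* The factor 2 is the threshold of [plateau0]: where this inequality holds and the corner entry
     is nonzero, the argument of [plateau] is at least 2. The condition is open and holds at p as
     the first column is nonzero. *)
  have H : \forall q \near (p : V), 0 < ((q : V).2 o1 o0) ^+ 2 + (q.2 o2 o0) ^+ 2 - 2 * (q.2 o0 o0) ^+ 2.
    apply: (nbhs_open (fun q : V => (q.2 o1 o0) ^+ 2 + (q.2 o2 o0) ^+ 2 - 2 * (q.2 o0 o0) ^+ 2) [set u | 0 < u]).
    - move=> q j; apply: DkB; first by apply: DkD; apply: Dk_exp; exact: Dk_Mcoord.
      by apply: DkM; [exact: Dk_cst|apply: Dk_exp; exact: Dk_Mcoord].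
    - exact: open_gt.
    - by move: Up; rewrite /col0_neq0/= x0 expr0n/= mulr0 subr0 addr0.
  apply: (@near_eq_Dk _ _ _ (fun=> 0)); last exact: Dk_cst.
  apply: filterS H => q Hq; rewrite /fam; case: eqVneq => // q0.
  rewrite /cutoff plateau0 ?mulr0 ?mul0r//= !expr_div_n -mulrDl.
  by rewrite ler_pdivlMr ?exprn_even_gt0//= ltW// -subr_gt0.
have nx : \forall q \near (p : V), (q : V).2 o0 o0 != 0.
  apply: (nbhs_open (fun q : V => q.2 o0 o0) [set u : R | u != 0]) => //.
    by move=> q j; exact: Dk_Mcoord.
apply: (@near_eq_Dk _ _ _ (fun q : V => P (hom lam alpha (q.2 o0 o0)) * cutoff q.2 * Phi (q.1, ratio q.2))).
  by apply: filterS nx => q q0; rewrite /fam (negbTE q0).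
have Dinv : Dk k (fun q : V => (q.2 o0 o0)^-1) p.
  by apply: (@Dk_comp1 _ _ (fun u : R => u^-1)); [exact: Dk_inv|exact: Dk_Mcoord].
have D1 : Dk k (fun q : V => (ratio q.2).1) p by apply: DkM => //; exact: Dk_Mcoord.
have D2 : Dk k (fun q : V => (ratio q.2).2) p by apply: DkM => //; exact: Dk_Mcoord.
apply: DkM; first apply: DkM.
- apply: (@Dk_comp1 _ _ (fun c => P (hom lam alpha c))); last exact: Dk_Mcoord.
  by case: HP => ->; [exact: (Dk_hom _ _ _ x0).1|exact: (Dk_hom _ _ _ x0).2].
- apply: (@Dk_comp1 _ _ (@plateau R)); first exact: Dk_plateau.
  by apply: DkD; exact: Dk_exp.
- pose G (i : option bool) (q : V) : R :=
    match i with None => q.1 | Some true => (ratio q.2).1 | Some false => (ratio q.2).2 end.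
  pose e (i : option bool) : R * (R * R) :=
    match i with None => (1, (0, 0)) | Some true => (0, (1, 0)) | Some false => (0, (0, 1)) end.
  have E q : \sum_i G i q *: e i = (q.1, ratio q.2).
    rewrite (bigD1 None)//= (bigD1 (Some true))//= (bigD1 (Some false))//= big1; last by move=> [[]|].
    congr (_, (_, _)); rewrite /= ?scaler0 ?addr0 ?add0r; exact: mulr1.
  have := @Dk_comp R (option bool) V (R * (R * R))%type k Phi G e p.
  rewrite E => /(_ (SPhi _ k)).
  under [fun y => Phi _]eq_fun do rewrite E.
  by apply=> -[[]|] //; exact: Dk_Rcoord.
Qed.

(* A section that reads [Phi (r, (y, z))] in the chart [Nmx] near 0; the cutoff makes
   its homogeneous extension vanish near the hyperplane [x o0 o0 = 0]. *)
Definition Sfam (Phi : R * (R * R) -> R) (r : R) : SL R 3 -> R[i]^o := fun g =>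
  fam (@complex.Re R) Phi (r, SLmx g) +i* fam (@complex.Im R) Phi (r, SLmx g).

Lemma SfamE Phi r g : Sfam Phi r g = if SLmx g o0 o0 == 0 then 0 else
  hom lam alpha (SLmx g o0 o0) * (cutoff (SLmx g) * Phi (r, ratio (SLmx g)))%:C.
Proof.
rewrite /Sfam /fam /=; case: ifP => // _.
by case: (hom _ _ _) => a b; simpc; rewrite /= !mulrA.
Qed.

Lemma smooth_at_slice (F : V -> R) (r : R) (x : 'M[R]_3) :
  smooth_at F (r, x) -> smooth_at (fun y => F (r, y)) x.
Proof.
apply: (@smooth_at_affine _ _ _ _ F (fun y => (r, y)) (r, 0) (fun p => (0, delta_mx p.1 p.2))) => y.
rewrite -[y in LHS]sum_delta_mx.
have -> : \sum_(p : 'I_3 * 'I_3) y p.1 p.2 *: ((0, delta_mx p.1 p.2) : V) =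
    (0, \sum_(p : 'I_3 * 'I_3) y p.1 p.2 *: delta_mx p.1 p.2).
  elim/big_rec2 : _ => // p a b _ ->; congr pair.
  by rewrite /= scaler0 addr0.
by congr pair; rewrite /= ?addr0 ?add0r.
Qed.

Lemma local_rep_Sfam Phi r : (forall q, smooth_at Phi q) ->
  local_rep (Sfam Phi r) col0_neq0 (fun x => fam (@complex.Re R) Phi (r, x))
    (fun x => fam (@complex.Im R) Phi (r, x)).
Proof.
move=> SPhi; split=> //.
- exact: open_col0_neq0.
- by move=> x Ux; apply: smooth_at_slice; apply: smooth_fam => //; left.
- by move=> x Ux; apply: smooth_at_slice; apply: smooth_fam => //; right.
Qed.

Lemma Sfam_I Phi r : (forall q, smooth_at Phi q) -> I_triv lam alpha (Sfam Phi r).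
Proof.
move=> SPhi; apply/I_trivP; split.
  apply/smoothP => g; exists col0_neq0; do 2 eexists; split; first exact: SL_col0_neq0.
  exact: local_rep_Sfam.
move=> g h h1 h2; set c := SLmx h o0 o0.
have c0 : c != 0.
  apply/eqP => c0; have := SL_col0_neq0 h; rewrite /col0_neq0/= h1 h2 -/c c0.
  by rewrite expr0n/= !addr0 ltxx.
have E i : SLmx (g * h)%g i o0 = SLmx g i o0 * c.
  by rewrite SLmxM mxE sum3 h1 h2 !mulr0 !addr0.
have rE : SLmx g o0 o0 != 0 -> ratio (SLmx (g * h)%g) = ratio (SLmx g).
  by move=> g0; rewrite /ratio !E; congr pair; field; rewrite g0 c0.
rewrite !SfamE E mulf_eq0 (negbTE c0) orbF; case: (eqVneq (SLmx g o0 o0) 0) => [_|g0].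
  by rewrite mulr0.
by rewrite /cutoff rE// [SLmx g o0 o0 * c]mulrC homM// -[LHS]mulrA.
Qed.

Lemma Nmx_col y z : SLmx (Nmx y z : SL R 3) o0 o0 = 1 /\ ratio (SLmx (Nmx y z)) = (y, z).
Proof. by rewrite /ratio /Nmx mkSLE !mxE/= !divr1. Qed.

Lemma Sfam_Nmx Phi r y z : y ^+ 2 + z ^+ 2 <= 1 ->
  Sfam Phi r (Nmx y z) = (Phi (r, (y, z)))%:C.
Proof.
move=> yz; have [n0 nr] := Nmx_col y z.
by rewrite SfamE n0 oner_eq0 /cutoff nr plateau1// hom1 !mul1r.
Qed.

End Families.

(** * Differentiating an operator along a smooth family of sections *)

Section JetsOfFamilies.
Variables (R : realType).
Local Notation V := (R * 'M[R]_3)%type.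
Local Notation U := (@col0_neq0 R).

Lemma derive_slice (F : V -> R) (r : R) (x w : 'M[R]_3) :
  'D_w (fun y => F (r, y)) x = 'D_((0 : R), w) F (r, x).
Proof.
rewrite /derive; congr (lim (_ @ 0^')); apply/funext => h /=.
by congr (_ *: (F _ - _)); congr pair; rewrite /= scaler0 add0r.
Qed.

(** The left-invariant vector field of X in the matrix variable at fixed r, as an operator on real
    functions of both variables. *)
Definition LX (X : 'M[R]_3) (F : V -> R) (p : V) : R := 'D_((0 : R), p.2 *m X) F p.

Lemma derive_delta_snd (F : V -> R) (p : V) (w : 'M[R]_3) : differentiable F p ->
  'D_((0 : R), w) F p = \sum_(q : 'I_3 * 'I_3) w q.1 q.2 * 'D_((0 : R), delta_mx q.1 q.2) F p.
Proof.
move=> dF; rewrite deriveE//.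
have -> : ((0, w) : V) = \sum_(q : 'I_3 * 'I_3) w q.1 q.2 *: ((0, delta_mx q.1 q.2) : V).
  rewrite -{1}[w]sum_delta_mx.
  elim/big_rec2 : _ => // q a b _ <-; congr pair.
  by rewrite /= scaler0 addr0.
by rewrite linear_sum/=; apply: eq_bigr => q _; rewrite linearZ/= deriveE.
Qed.

Lemma near_snd (p : V) : U p.2 -> \forall q \near p, U q.2.
Proof.
move=> Up; have c : snd @ p --> p.2 by exact: cvg_snd.
by apply: (c U); apply: open_nbhs_nbhs; split=> //; exact: open_col0_neq0.
Qed.

Definition smooth_on (F : V -> R) := forall p : V, U p.2 -> smooth_at F p.

Lemma smooth_LX X F : smooth_on F -> smooth_on (LX X F).
Proof.
move=> SF p Up k.
apply: (@near_eq_Dk _ _ _ (fun p : V => \sum_(q : 'I_3 * 'I_3)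
    (\sum_l p.2 q.1 l * X l q.2) * 'D_((0 : R), delta_mx q.1 q.2) F p)).
  apply: filterS (near_snd Up) => q Uq.
  rewrite /LX [RHS]derive_delta_snd; last exact/smooth_at_differentiable/SF.
  by apply: eq_bigr => i _; rewrite mxE.
apply: Dk_sum => q; apply: DkM; last exact: (SF p Up k.+1).2.
by apply: Dk_sum => l; apply: DkM; [exact: Dk_Mcoord|exact: Dk_cst].
Qed.

Definition dR (F : V -> R) : V -> R := 'D_((1 : R), (0 : 'M[R]_3)) F.

Lemma smooth_dR F : smooth_on F -> smooth_on (dR F).
Proof. by move=> SF p Up k; exact: (SF p Up k.+1).2. Qed.

Lemma derive_fst (F : V -> R) r x : dR F (r, x) = 'D_1 (fun s => F (s, x)) r.
Proof.
rewrite /dR /derive; congr (lim (_ @ 0^')); apply/funext => h /=.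
by congr (_ *: (F _ - _)); congr pair; rewrite /= scaler0 add0r.
Qed.

(** At a fixed matrix x the direction x X does not depend on r, so the interchange is the symmetry
    of second derivatives along two constant directions. *)
Lemma dR_LX X F p : smooth_on F -> U p.2 -> dR (LX X F) p = LX X (dR F) p.
Proof.
case: p => r x SF Ux; rewrite derive_fst /LX /=.
have := derive_fst ('D_((0 : R), x *m X) F) r x; rewrite /dR => <-.
have S := SF (r, x) Ux.
have [dF DF] := S 2%N.
have dd v : differentiable ('D_v F) (r, x) by exact: nbhs_singleton (DF v).1.
exact: derive_comm.
Qed.

Lemma eq_LX X F G p : (forall p : V, U p.2 -> F p = G p) -> U p.2 -> LX X F p = LX X G p.
Proof.
move=> FG Up; apply: near_eq_derive; apply: filterS (near_snd Up) => q; exact: FG.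
Qed.

Fixpoint Lw (w : seq (@sl R 3)) (F : V -> R) : V -> R :=
  if w is X :: w' then LX (set_val X) (Lw w' F) else F.

Lemma smooth_Lw w F : smooth_on F -> smooth_on (Lw w F).
Proof. by elim: w => //= X w IH SF; exact/smooth_LX/IH. Qed.

Lemma eq_Lw w F G : (forall p : V, U p.2 -> F p = G p) ->
  forall p, U p.2 -> Lw w F p = Lw w G p.
Proof. by move=> FG; elim: w => //= X w IH p Up; apply: eq_LX. Qed.

Lemma dR_Lw w F : smooth_on F -> forall p, U p.2 -> dR (Lw w F) p = Lw w (dR F) p.
Proof.
move=> SF; elim: w => [//|X w IH] p Up.
rewrite -[Lw (X :: w) F]/(LX (set_val X) (Lw w F)) dR_LX//; last exact: smooth_Lw.
exact: eq_LX.
Qed.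

(** Iterated Lie derivatives of a slice are slices of functions of both variables, and there the
    derivative in r is available. *)
Lemma lie_jet_family (h : SL R 3 -> R[i]^o) (F1 F2 : V -> R) r w :
  smooth_on F1 -> smooth_on F2 ->
  (forall g, h g = F1 (r, SLmx g) +i* F2 (r, SLmx g)) ->
  forall g, lie_jet h w g = Lw w F1 (r, SLmx g) +i* Lw w F2 (r, SLmx g).
Proof.
move=> S1 S2 hE; elim: w => [//|X w IH] g.
rewrite -[lie_jet h (X :: w)]/(lie_derive (set_val X) (lie_jet h w)).
have rep : local_rep (lie_jet h w) U (fun x => Lw w F1 (r, x)) (fun x => Lw w F2 (r, x)).
  split=> //; first exact: open_col0_neq0.
  - by move=> x Ux; apply: smooth_at_slice; exact: smooth_Lw.
  - by move=> x Ux; apply: smooth_at_slice; exact: smooth_Lw.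
rewrite (local_rep_lie_deriveE (unimodular_sl X) (SL_col0_neq0 g) rep).
by rewrite !derive_slice.
Qed.

(* This makes the difference quotients of a smooth family of sections converge in
   [Coo_topology], so that a continuous operator may be differentiated in a parameter. *)
Lemma uniform_difference_quotient (G : V -> R) (r : R) (K : set (SL R 3)) (e : R) :
  smooth_on G -> compact K -> 0 < e ->
  \forall s \near (0 : R)^', forall g, K g ->
    `|dR G (r, SLmx g) - s^-1 * (G (s + r, SLmx g) - G (r, SLmx g))| < e.
Proof.
move=> SG cK e0.
have /compact_near_coveringP nc := cK.
(* Compactness makes the continuity of dR G in r uniform over K. By the mean value theorem the
   difference quotient is dR G at a parameter within |s| of r, so this bound is all that is
   needed. *)
have H : \forall s \near (0 : R), K `<=` [set g | forall c, `|c| <= `|s| ->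
    `|dR G (r, SLmx g) - dR G (c + r, SLmx g)| < e].
  apply: (nc R (nbhs (0 : R)) (fun s g => forall c, `|c| <= `|s| ->
    `|dR G (r, SLmx g) - dR G (c + r, SLmx g)| < e)) => g Kg.
  have cG : {for (r, SLmx g), continuous (dR G)}.
    apply: differentiable_continuous; apply: smooth_at_differentiable.
    by apply: smooth_dR => //; exact: SL_col0_neq0.
  have e20 : 0 < e / 2 by rewrite divr_gt0.
  have /cvgrPdist_lt/(_ _ e20) := cG.
  move=> [[A B] [/= Ar Bg] AB].
  have [d d0 dA] := near_ball_norm Ar.
  have nB : \forall g' \near g, B (SLmx g') by exact: (@continuous_SLmx R 3 g _ Bg).
  exists ([set g' | B (SLmx g')], [set s | `|s| < d]) => /=.
    split=> //; apply/nbhs_normP; exists d => //= s /=; by rewrite sub0r normrN.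
  move=> [g' s] [/= Bg' sd] c cs.
  have h1 := AB (r, SLmx g'); have h2 := AB (c + r, SLmx g').
  have {}h1 : `|dR G (r, SLmx g) - dR G (r, SLmx g')| < e / 2.
    by apply: h1; split=> //=; exact: nbhs_singleton Ar.
  have {}h2 : `|dR G (r, SLmx g) - dR G (c + r, SLmx g')| < e / 2.
    by apply: h2; split=> //=; apply: dA; exact: le_lt_trans cs sd.
  rewrite -(subrKA (dR G (r, SLmx g))) [e]splitr (le_lt_trans (ler_normD _ _))// ltrD//.
  by rewrite distrC.
have H' : \forall s \near (0 : R)^', K `<=` [set g | forall c, `|c| <= `|s| ->
    `|dR G (r, SLmx g) - dR G (c + r, SLmx g)| < e] by exact: cvg_within H.
have n0 : \forall s \near (0 : R)^', s != 0 by exact: nbhs_dnbhs_neq.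
apply: filterS2 H' n0 => s Hs s0 g Kg.
have [c [cs E]] : exists c : R, `|c| <= `|s| /\
    G (s *: (1, 0) + (r, SLmx g)) - G (r, SLmx g) =
    'D_((1 : R), (0 : 'M[R]_3)) G (c *: (1, 0) + (r, SLmx g)) * s.
  apply: MVT_line => t ts; apply/diff_derivable/smooth_at_differentiable/SG.
  by rewrite /= scaler0 add0r; exact: SL_col0_neq0.
have pE (t : R) : t *: ((1, 0) : V) + (r, SLmx g) = (t + r, SLmx g).
  by congr pair; rewrite /= ?scaler0 ?add0r//; congr (_ + _); exact: mulr1.
rewrite !pE in E; rewrite E mulrCA mulVf// mulr1.
exact: Hs.
Qed.

End JetsOfFamilies.

Section FamilyDerivative.
Variables (R : realType) (lam : R[i]) (alpha : bool).
Local Notation Sfam := (Sfam lam alpha).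
Local Notation fam := (fam lam alpha).

Definition dPhi (Phi : R * (R * R) -> R) : R * (R * R) -> R :=
  'D_((1 : R), ((0 : R), (0 : R))) Phi.

Lemma dR_fam P Phi p : (forall q, smooth_at Phi q) -> Re_or_Im P ->
  dR (fam P Phi) p = fam P (dPhi Phi) p.
Proof.
case: p => r x SPhi HP; rewrite derive_fst /fam /=; case: ifP => x0.
  exact: (@derive_cst R R R (0 : R) r 1).
set k := _ * cutoff x.
have E : (fun h => h^-1 *: (((fun s => Phi (s, ratio x)) \o shift r) (h *: 1) - Phi (r, ratio x))) =
  (fun h : R => h^-1 *: ((Phi \o shift (r, ratio x)) (h *: (1, (0, 0))) - Phi (r, ratio x))).
  apply/funext => h /=; congr (_ *: (Phi _ - _)); congr (_, (_, _));
  by rewrite /= ?scaler0 ?add0r.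
have dP : is_derive r 1 (fun s => Phi (s, ratio x)) (dPhi Phi (r, ratio x)).
  have := @diff_derivable _ _ _ Phi (r, ratio x) (1, (0, 0)) (smooth_at_differentiable (SPhi _)).
  rewrite /derivable -E => dP; apply: DeriveDef => //.
  by rewrite /derive E.
by have [_ ->] := @is_deriveZ _ _ _ (fun s => Phi (s, ratio x)) k _ _ _ dP.
Qed.

Lemma smooth_dPhi Phi : (forall q, smooth_at Phi q) -> forall q, smooth_at (dPhi Phi) q.
Proof. by move=> S q k; exact: (S q k.+1).2. Qed.

(** The difference quotient of the family is formed as a combination of two sections, so that D can
    be applied to it. *)
Definition quotS Phi r (s : R) : SL R 3 -> R[i]^o :=
  (s^-1)%:C *: Sfam Phi (s + r) + (- (s^-1)%:C) *: Sfam Phi r.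

(** Each seminorm involves a word w. Lie derivatives along w commute with dR, so the estimate is
    [uniform_difference_quotient] for the real and imaginary parts of the family differentiated
    along w. *)
Lemma quotS_cvg Phi r : (forall q, smooth_at Phi q) ->
  (quotS Phi r s : Coo_topology R 3) @[s --> (0 : R)^'] --> (Sfam (dPhi Phi) r : Coo_topology R 3).
Proof.
move=> SPhi; apply/Coo_cvgP => w K e cK e0.
have SF P Phi' : Re_or_Im P -> (forall q, smooth_at Phi' q) -> smooth_on (fam P Phi').
  by move=> HP S p Up; exact: smooth_fam.
have cRe : Re_or_Im (@complex.Re R) by left.
have cIm : Re_or_Im (@complex.Im R) by right.
have S1 := SF _ _ cRe SPhi; have S2 := SF _ _ cIm SPhi.
have SI s : smooth (Sfam Phi s) by exact: ((I_trivP _ _ _).1 (Sfam_I lam alpha s SPhi)).1.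
have J0 s := lie_jet_family w S1 S2 (h := Sfam Phi s) (r := s) (fun=> erefl).
have SP' := smooth_dPhi SPhi.
have J1 := lie_jet_family w (SF _ _ cRe SP') (SF _ _ cIm SP') (h := Sfam (dPhi Phi) r) (r := r) (fun=> erefl).
have E P g : Re_or_Im P ->
    Lw w (fam P (dPhi Phi)) (r, SLmx g) = dR (Lw w (fam P Phi)) (r, SLmx g).
  move=> HP; have SLg := SL_col0_neq0 g.
  by rewrite dR_Lw//; [apply: eq_Lw => // p _; rewrite dR_fam|exact: SF].
have H1 := uniform_difference_quotient r (smooth_Lw w S1) cK e0.
have H2 := uniform_difference_quotient r (smooth_Lw w S2) cK e0.
have H : \forall s \near (0 : R)^', forall g, K g ->
    cnear e (lie_jet (Sfam (dPhi Phi) r) w g) (lie_jet (quotS Phi r s) w g).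
  apply: filterS2 H1 H2 => s h1 h2 g Kg.
  rewrite J1 /quotS lie_jet_comb2// -[(_ + _) g]/(_ * lie_jet _ w g + _ * lie_jet _ w g) !J0.
  split => /=.
    rewrite E// [X in _ - X](_ : _ = s^-1 * (Lw w (fam (@complex.Re R) Phi) (s + r, SLmx g) -
      Lw w (fam (@complex.Re R) Phi) (r, SLmx g))); last by ring.
    exact: h1.
  rewrite E// [X in _ - X](_ : _ = s^-1 * (Lw w (fam (@complex.Im R) Phi) (s + r, SLmx g) -
      Lw w (fam (@complex.Im R) Phi) (r, SLmx g))); last by ring.
  exact: h2.
exact: H.
Qed.

End FamilyDerivative.

Section OperatorDerivative.
Variables (R : realType) (lam nu : R[i]) (alpha beta : bool).
Variable D : (SL R 3 -> R[i]^o) -> (SL R 2 -> R[i]^o).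
Hypothesis DD : Diff (I_triv lam alpha) (J_triv nu beta) D.
Local Notation Sfam := (Sfam lam alpha).

Lemma Diff_scale (c : R[i]) f : I_triv lam alpha f -> D (c *: f) = c *: D f.
Proof.
move=> If; have [_ _ lin _ _] := DD.
have -> : c *: f = (c - 1) *: f + f by rewrite scalerBl scale1r subrK.
by rewrite lin// scalerBl scale1r subrK.
Qed.

Lemma Diff_comb2 (c1 c2 : R[i]) f1 f2 : I_triv lam alpha f1 -> I_triv lam alpha f2 ->
  D (c1 *: f1 + c2 *: f2) = c1 *: D f1 + c2 *: D f2.
Proof.
move=> I1 I2; have [_ _ lin _ _] := DD.
by rewrite lin//; [rewrite Diff_scale|exact: I_triv_scale].
Qed.

(** The quotients lie in the representation and converge in [Coo_topology], so continuity of D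
    within that subspace carries the limit over; linearity identifies the image as a difference
    quotient of values of D. *)
Lemma is_derive_Sfam Phi (r : R) : (forall q, smooth_at Phi q) ->
  is_derive r 1 (fun r => complex.Re (D (Sfam Phi r) 1%g)) (complex.Re (D (Sfam (dPhi Phi) r) 1%g)) /\
  is_derive r 1 (fun r => complex.Im (D (Sfam Phi r) 1%g)) (complex.Im (D (Sfam (dPhi Phi) r) 1%g)).
Proof.
move=> SPhi; have [_ _ _ cD _] := DD.
have SP' := smooth_dPhi SPhi.
have I0 : I_triv lam alpha (Sfam (dPhi Phi) r) by exact: Sfam_I.
have Iq s : I_triv lam alpha (quotS lam alpha Phi r s).
  by rewrite /quotS; apply: I_triv_comb; [|apply: I_triv_scale]; exact: Sfam_I.
have c1 := (subspace_continuousP _ _).1 cD _ I0.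
have c2 : (quotS lam alpha Phi r s : Coo_topology R 3) @[s --> (0 : R)^'] -->
    within (I_triv lam alpha) (nbhs (Sfam (dPhi Phi) r : Coo_topology R 3)).
  move=> A /= WA.
  have W1 : \forall s \near (0 : R)^', I_triv lam alpha (quotS lam alpha Phi r s) ->
      A (quotS lam alpha Phi r s) by exact: (@quotS_cvg R lam alpha Phi r SPhi _ WA).
  have W2 : \forall s \near (0 : R)^', A (quotS lam alpha Phi r s).
    by apply: filterS W1 => s; apply; exact: Iq.
  exact: W2.
have c3 := cvg_comp _ _ c2 c1.
have K1 : compact [set (1%g : SL R 2)] by exact: compact_set1.
have c4 (e : R) : 0 < e -> \forall s \near (0 : R)^',
    cnear e (D (Sfam (dPhi Phi) r) 1%g) (D (quotS lam alpha Phi r s) 1%g).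
  (* Evaluation at the identity is the seminorm of the empty word on the compact set consisting of
     that point. *)
  move=> e0; have H := (Coo_cvgP _ _).1 c3 [::] _ e K1 e0.
  have {}H : \forall s \near (0 : R)^', forall x, [set 1%g] x ->
     cnear e (lie_jet (D (Sfam (dPhi Phi) r)) [::] x) (lie_jet (D (quotS lam alpha Phi r s)) [::] x).
    exact: H.
  by apply: filterS H => s /(_ 1%g); apply.
have Eq s : D (quotS lam alpha Phi r s) 1%g =
    (s^-1)%:C * D (Sfam Phi (s + r)) 1%g + (- (s^-1)%:C) * D (Sfam Phi r) 1%g.
  by rewrite /quotS Diff_comb2//; exact: Sfam_I.
have lim1 (P : R[i] -> R) : (P = @complex.Re R \/ P = @complex.Im R) ->
  is_derive r 1 (fun r => P (D (Sfam Phi r) 1%g)) (P (D (Sfam (dPhi Phi) r) 1%g)).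
  move=> HP.
  have cv : (fun h => h^-1 *: (((fun r => P (D (Sfam Phi r) 1%g)) \o shift r) (h *: 1) -
      P (D (Sfam Phi r) 1%g))) h @[h --> (0 : R)^'] --> P (D (Sfam (dPhi Phi) r) 1%g).
    apply/cvgrPdist_lt => e e0; apply: filterS (c4 e e0) => s [].
    rewrite Eq /= [s%:A]mulr1.
    case: HP => ->; move: (D (Sfam Phi (s + r)) 1%g) (D (Sfam Phi r) 1%g) => [a b] [a' b'] /=.
      move=> + _; rewrite [X in _ - X](_ : _ = s^-1 *: (a - a'))//.
      by rewrite /GRing.scale/=; ring.
    move=> _; rewrite [X in _ - X](_ : _ = s^-1 *: (b - b'))//.
    by rewrite /GRing.scale/=; ring.
  apply: DeriveDef; first by apply/cvg_ex; eexists; exact: cv.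
  exact: cvg_lim cv.
by split; apply: lim1; [left|right].
Qed.

End OperatorDerivative.

(** * Smooth solutions of Euler's equation *)

Section EulerEquation.
Variable R : realType.

(* With u_k = P_k + i Q_k the k-th derivative of u_0, the hypothesis is Euler's equation
   r u' = (a + i b) u, whose solutions r^(a + i b) are smooth at 0 only if a + i b is a
   natural number k. Indeed r u_(k+1) = (a + i b - k) u_k, so |u_k|^2 is nonincreasing
   for r > 0 once k >= a, and u_k vanishes with u_k(0). *)
Lemma euler_ode (P Q : nat -> R -> R) (a b : R) :
  (forall k (r : R), is_derive r 1 (P k) (P k.+1 r)) ->
  (forall k (r : R), is_derive r 1 (Q k) (Q k.+1 r)) ->
  (forall r, r * P 1%N r = a * P 0%N r - b * Q 0%N r) ->
  (forall r, r * Q 1%N r = a * Q 0%N r + b * P 0%N r) ->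
  (exists k : nat, [/\ a = k%:R, b = 0, P 0%N 1 = P k 0 / k`!%:R & Q 0%N 1 = Q k 0 / k`!%:R]) \/
  ((forall k : nat, ~ (a = k%:R /\ b = 0)) /\ P 0%N 1 = 0 /\ Q 0%N 1 = 0).
Proof.
move=> dP dQ HP HQ.
have step (F G : nat -> R -> R) (c : R) k : (forall k (r : R), is_derive r 1 (F k) (F k.+1 r)) ->
    (forall k (r : R), is_derive r 1 (G k) (G k.+1 r)) ->
    (forall r, r * F k.+1 r = (a - k%:R) * F k r + c * G k r) ->
    forall r, r * F k.+2 r = (a - k.+1%:R) * F k.+1 r + c * G k.+1 r.
  move=> dF dG IH r.
  have [_ v1] := is_deriveM (is_derive_id r 1) (dF k.+1 r).
  have [_ v2] := is_deriveD (is_deriveZ (a - k%:R) (dF k r)) (is_deriveZ c (dG k r)).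
  have E : id * F k.+1 = (a - k%:R) *: F k + c *: G k by apply/funext.
  rewrite E v2 /GRing.scale/= mulr1 in v1; rewrite -natr1; lra.
have H k : (forall r, r * P k.+1 r = (a - k%:R) * P k r - b * Q k r) /\
           (forall r, r * Q k.+1 r = (a - k%:R) * Q k r + b * P k r).
  elim: k => [|k [IHP IHQ]]; first by rewrite subr0.
  by split=> r; rewrite -?mulNr; apply: step => // u; rewrite ?IHP ?IHQ ?mulNr.
have inj k x y : ~ (a = k%:R /\ b = 0) ->
    (a - k%:R) * x - b * y = 0 -> (a - k%:R) * y + b * x = 0 -> x = 0 /\ y = 0.
  move=> nk h1 h2.
  (* The determinant of the real linear system representing multiplication by a + i b - k. *)
  have n0 : (a - k%:R) ^+ 2 + b ^+ 2 != 0.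
    apply/negP; rewrite paddr_eq0 ?sqr_ge0// !sqrf_eq0 subr_eq0 => /andP[/eqP ? /eqP ?].
    by apply: nk.
  split; apply: (mulfI n0); rewrite mulr0.
    have -> : ((a - k%:R) ^+ 2 + b ^+ 2) * x = (a - k%:R) * ((a - k%:R) * x - b * y)
       + b * ((a - k%:R) * y + b * x) by ring.
    by rewrite h1 h2 !mulr0 addr0.
  have -> : ((a - k%:R) ^+ 2 + b ^+ 2) * y = (a - k%:R) * ((a - k%:R) * y + b * x)
     - b * ((a - k%:R) * x - b * y) by ring.
  by rewrite h1 h2 !mulr0 subr0.
have at0 k : ~ (a = k%:R /\ b = 0) -> P k 0 = 0 /\ Q k 0 = 0.
  by move=> nk; apply: inj nk _ _; rewrite -?(H k).1 -?(H k).2 mul0r.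
have decay k r : a <= k%:R -> P k 0 = 0 -> Q k 0 = 0 -> 0 <= r -> P k r = 0 /\ Q k r = 0.
  move=> ak p0 q0 r0; pose N r := P k r ^+ 2 + Q k r ^+ 2.
  have dN (s : R) : is_derive s 1 N (2 * (P k s * P k.+1 s + Q k s * Q k.+1 s)).
    have dP2 := is_deriveM (dP k s) (dP k s); have dQ2 := is_deriveM (dQ k s) (dQ k s).
    have -> : N = (fun s => P k s * P k s + Q k s * Q k s) by apply/funext => u; rewrite /N !expr2.
    by apply: is_derive_eq (is_deriveD dP2 dQ2) _; rewrite /GRing.scale/=; ring.
  have : N r <= 0.
    have cN : {within `[0, r], continuous N}.
      by apply: derivable_within_continuous => u _; have [] := dN u.
    have [s] := MVT_segment r0 (fun s _ => dN s) cN.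
    rewrite in_itv/= => /andP[s0 sr] E.
    have N0 : N 0 = 0 by rewrite /N p0 q0 expr0n/= addr0.
    rewrite N0 !subr0 in E; rewrite E.
    have [->|s1] := eqVneq s 0.
      by rewrite p0 q0 !mul0r addr0 mulr0 mul0r.
    have sp : 0 < s by rewrite lt_neqAle eq_sym s1.
    rewrite pmulr_lle0 ?(lt_le_trans sp)// -(pmulr_rle0 _ sp).
    have -> : s * (2 * (P k s * P k.+1 s + Q k s * Q k.+1 s)) =
      2 * (a - k%:R) * (P k s ^+ 2 + Q k s ^+ 2).
      have := (H k).1 s; have := (H k).2 s => h2 h1.
      have -> : s * (2 * (P k s * P k.+1 s + Q k s * Q k.+1 s)) =
        2 * (P k s * (s * P k.+1 s) + Q k s * (s * Q k.+1 s)) by ring.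
      by rewrite h1 h2; ring.
    by rewrite mulr_le0_ge0 ?addr_ge0 ?sqr_ge0// mulr_ge0_le0// subr_le0.
  rewrite /N => N0; have : P k r ^+ 2 + Q k r ^+ 2 == 0 by rewrite eq_le N0 addr_ge0 ?sqr_ge0.
  by rewrite paddr_eq0 ?sqr_ge0// !sqrf_eq0 => /andP[/eqP -> /eqP ->].
have [[k [ak b0]]|nk] := pselect (exists k : nat, a = k%:R /\ b = 0).
  left; exists k.
  have n1 : ~ (a = k.+1%:R /\ b = 0).
    by rewrite ak => -[/eqP]; rewrite eqr_nat => /eqP; lia.
  have [p1 q1] := at0 _ n1.
  have dec r : 0 <= r -> P k.+1 r = 0 /\ Q k.+1 r = 0.
    by apply: decay => //; rewrite ak ler_nat.
  have cst1 (F : nat -> R -> R) : (forall k (r : R), is_derive r 1 (F k) (F k.+1 r)) ->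
      (forall r, 0 <= r -> F k.+1 r = 0) -> F k 1 = F k 0.
    move=> dF F0.
    have cF : {within `[0, 1], continuous (F k)}.
      by apply: derivable_within_continuous => u _; have [] := dF k u.
    have [s] := MVT_segment ler01 (fun s _ => dF k s) cF.
    by rewrite in_itv/= => /andP[s0 _]; rewrite F0// mul0r => /eqP; rewrite subr_eq0 => /eqP.
  have desc (F : nat -> R -> R) : (forall j r, r * F j.+1 r = (a - j%:R) * F j r) ->
      F k 1 = k`!%:R * F 0%N 1.
    move=> HF.
    (* At r = 1 the equation reads u_(j+1) = (k - j) u_j, whence the falling factorials and finally
       k!. *)
    have : forall j, (j <= k)%N -> F j 1 = (k ^_ j)%:R * F 0%N 1.
      elim=> [|j IH] jk; first by rewrite ffactn0 mul1r.
      rewrite -[LHS]mul1r HF IH ?(ltnW jk)// ffactnSr natrM natrB ?(ltnW jk)// ak; ring.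
    by move=> /(_ k (leqnn k)); rewrite ffactnn.
  have f0 : k`!%:R != 0 :> R by rewrite pnatr_eq0 -lt0n fact_gt0.
  split=> //.
  - rewrite -(cst1 P dP (fun r r0 => (dec r r0).1)) desc; first by rewrite mulrC mulKf.
    by move=> j r; rewrite (H j).1 b0 mul0r subr0.
  - rewrite -(cst1 Q dQ (fun r r0 => (dec r r0).2)) desc; first by rewrite mulrC mulKf.
    by move=> j r; rewrite (H j).2 b0 mul0r addr0.
right; split; first by move=> k hk; apply: nk; exists k.
have nk' k : ~ (a = k%:R /\ b = 0) by move=> hk; apply: nk; exists k.
(* For this K the decay argument gives u_K = 0 at 1. As no factor a + i b - i vanishes, the equation
   at r = 1 then carries the zero down from u_K to u_0. *)
pose K := (Num.truncn `|a|).+1.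
have aK : a <= K%:R by rewrite (le_trans (ler_norm a))// ltW// truncnS_gt.
have [pK qK] := at0 _ (nk' K).
have : forall j, P (K - j)%N 1 = 0 /\ Q (K - j)%N 1 = 0.
  elim=> [|j [IHp IHq]]; first by rewrite subn0; apply: decay.
  have [Kj|jK] := leqP K j.
    by move: IHp IHq; rewrite (_ : (K - j)%N = 0)%N; [rewrite (_ : (K - j.+1)%N = 0)%N//; lia|lia].
  set i := (K - j.+1)%N; have iE : (K - j)%N = i.+1 by rewrite /i; lia.
  rewrite iE in IHp IHq.
  by apply: inj (nk' i) _ _; rewrite -?(H i).1 -?(H i).2 ?IHp ?IHq mulr0.
by move=> /(_ K); rewrite subnn.
Qed.

End EulerEquation.

(** * Iterated r-derivatives of phi(r^2 y, r z) *)

Section Taylor.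
Variable R : realType.
Implicit Types phi : R * R -> R.

Lemma near_eq_iterD a b (F G : R * R -> R) p : (\near p, F p = G p) -> iterD a b F p = iterD a b G p.
Proof.
move=> FG; have : \forall q \near p, iterD a b F q = iterD a b G q.
  rewrite /iterD; elim: a => [|a IH].
    elim: b => [//|b IH] /=.
    by apply: filterS (near_join IH) => q; exact: near_eq_derive.
  by apply: filterS (near_join IH) => q; exact: near_eq_derive.
exact: nbhs_singleton.
Qed.

Lemma smooth_iterD a b phi : (forall p, smooth_at phi p) -> forall p, smooth_at (iterD a b phi) p.
Proof.
move=> S; rewrite /iterD; elim: a => [|a IH].
  by elim: b => [//|b IH] p k /=; exact: (IH p k.+1).2.
by move=> p k; exact: (IH p k.+1).2.
Qed.

(** [iterD] keeps the y-derivatives outermost; a new z-derivative is moved inside by symmetry of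
    second derivatives. *)
Lemma iterD_snd a b phi : (forall p, smooth_at phi p) -> forall p,
  'D_((0 : R), (1 : R)) (iterD a b phi) p = iterD a b.+1 phi p.
Proof.
move=> S; elim: a => [//|a IH] p.
rewrite /iterD !iterS -!/(iterD a _ phi).
have [dF DF] := smooth_iterD a b S p 2%N.
rewrite derive_comm//; [|exact: nbhs_singleton (DF _).1|exact: nbhs_singleton (DF _).1].
congr derive; apply/funext => q; exact: IH.
Qed.

Lemma is_derive_curve2 (F : R * R -> R) (f g : R -> R) (r df dg : R) :
  differentiable F (f r, g r) -> is_derive r 1 f df -> is_derive r 1 g dg ->
  is_derive r 1 (fun s => F (f s, g s))
    (df * 'D_((1 : R), (0 : R)) F (f r, g r) + dg * 'D_((0 : R), (1 : R)) F (f r, g r)).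
Proof.
move=> dF [df1 vf] [dg1 vg].
have df' := (derivable1_diffP _ _).1 df1; have dg' := (derivable1_diffP _ _).1 dg1.
have dfg := differentiable_pair df' dg'.
have dc := differentiable_comp dfg dF.
apply: DeriveDef; first exact: diff_derivable.
rewrite [LHS]deriveE// (diff_comp dfg dF)/= (diff_pair df' dg').
rewrite -!deriveE// vf vg.
have -> : (df, dg) = df *: ((1 : R), (0 : R)) + dg *: ((0 : R), (1 : R)).
  by congr pair; rewrite /= ?scaler0 ?addr0 ?add0r; exact: esym (mulr1 _).
by rewrite !deriveE// linearD !linearZ.
Qed.

(* Iterated r-derivatives of phi(r^2 y, r z): a term (c, i, j) of the list at
   level k stands for c r^(2i+j-k) y^i z^j (d_y^i d_z^j phi)(r^2 y, r z). *)
Definition wterm k phi (t : R * nat * nat) (q : R * (R * R)) : R :=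
  let: (c, i, j) := t in let: (r, (y, z)) := q in
  c * r ^+ (2 * i + j - k) * (y ^+ i * z ^+ j) * iterD i j phi (r ^+ 2 * y, r * z).

(** The three terms of the product rule: the power of r, then the two arguments of phi. When the
    exponent of r is 0 the first term is zero and is left out; this preserves the bound k <= 2 i + j
    that the truncated subtraction in [wterm] relies on. *)
Definition wstep k (t : R * nat * nat) : seq (R * nat * nat) :=
  let: (c, i, j) := t in
  (if (2 * i + j == k)%N then [::] else [:: (c * (2 * i + j - k)%:R, i, j)]) ++
  [:: (2 * c, i.+1, j); (c, i, j.+1)].

Fixpoint wlist k : seq (R * nat * nat) :=
  if k is k'.+1 then flatten (map (wstep k') (wlist k')) else [:: (1, 0%N, 0%N)].

Lemma wlist_weight k : all (fun t : R * nat * nat => k <= 2 * t.1.2 + t.2)%N (wlist k).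
Proof.
elim: k => [//|k /allP IH]; apply/allP => s /flattenP[l /mapP[[[c i] j] tin ->] sin].
have /= kij := IH _ tin.
move: s sin; apply/allP; rewrite /wstep all_cat/= andbT.
apply/and3P; split; [|lia|lia].
by case: eqP => //= ?; rewrite andbT; lia.
Qed.

Lemma is_derive_wterm k phi (t : R * nat * nat) (r y z : R) :
  (forall p, smooth_at phi p) -> (k <= 2 * t.1.2 + t.2)%N ->
  is_derive r 1 (fun r => wterm k phi t (r, (y, z)))
    (\sum_(s <- wstep k t) wterm k.+1 phi s (r, (y, z))).
Proof.
case: t => [[c i] j] S /= kij.
have dy : is_derive r 1 (fun r : R => r ^+ 2 * y) (2 * r * y).
  by apply: is_derive_eq; rewrite /GRing.scale/=; ring.
have dz : is_derive r 1 (fun r : R => r * z) z.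
  by apply: is_derive_eq; rewrite /GRing.scale/=; ring.
have SD := smooth_iterD i j S (r ^+ 2 * y, r * z).
have dI := @is_derive_curve2 (iterD i j phi) (fun r => r ^+ 2 * y) (fun r => r * z) r _ _
  (smooth_at_differentiable SD) dy dz.
rewrite iterD_snd// in dI.
set n := (2 * i + j - k)%N.
have dn : is_derive r 1 (fun r : R => c * r ^+ n * (y ^+ i * z ^+ j)) (c * (n%:R * r ^+ n.-1) * (y ^+ i * z ^+ j)).
  have dX : is_derive r 1 (fun r : R => r ^+ n) (n%:R * r ^+ n.-1).
    have := is_deriveX n (is_derive_id r 1); rewrite exprfctE => H.
    by apply: is_derive_eq H _; exact: mulr1.
  have -> : (fun r : R => c * r ^+ n * (y ^+ i * z ^+ j)) = (c * (y ^+ i * z ^+ j)) *: (fun r : R => r ^+ n).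
    by apply/funext => u; rewrite /= -[RHS]/(_ * _); ring.
  by apply: is_derive_eq (is_deriveZ _ dX) _; rewrite /GRing.scale/=; ring.
apply: is_derive_eq (is_deriveM dn dI) _.
have e2 : (2 * i.+1 + j - k.+1 = n.+1)%N by rewrite /n; lia.
have e3 : (2 * i + j.+1 - k.+1 = n)%N by rewrite /n; lia.
rewrite /wstep big_cat/= !big_cons big_nil /wterm e2 e3.
rewrite -[iterD i.+1 j phi _]/('D_((1 : R), (0 : R)) (iterD i j phi) _).
have -> : \sum_(s <- if (2 * i + j == k)%N then [::] else [:: (c * n%:R, i, j)])
   wterm k.+1 phi s (r, (y, z)) = c * (n%:R * r ^+ n.-1) * (y ^+ i * z ^+ j) * iterD i j phi (r ^+ 2 * y, r * z).
  case: eqP => [nk|nk].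
    by rewrite big_nil (_ : n = 0)%N; [ring|rewrite /n; lia].
  rewrite big_seq1 /wterm (_ : (2 * i + j - k.+1)%N = n.-1); last by rewrite /n; lia.
  by ring.
by rewrite /GRing.scale/= !exprS; ring.
Qed.

Definition wfun k phi (q : R * (R * R)) : R := \sum_(t <- wlist k) wterm k phi t q.

Lemma wfun0 phi r y z : wfun 0 phi (r, (y, z)) = phi (r ^+ 2 * y, r * z).
Proof. by rewrite /wfun/= big_seq1 /wterm/= !expr0 !mul1r. Qed.

Lemma is_derive_wfun k phi (r y z : R) : (forall p, smooth_at phi p) ->
  is_derive r 1 (fun r => wfun k phi (r, (y, z))) (wfun k.+1 phi (r, (y, z))).
Proof.
move=> S; rewrite /wfun.
have -> : \sum_(t <- wlist k.+1) wterm k.+1 phi t (r, (y, z)) =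
    \sum_(t <- wlist k) \sum_(s <- wstep k t) wterm k.+1 phi s (r, (y, z)).
  by rewrite /= big_flatten big_map.
have := wlist_weight k; elim: (wlist k) => [_|t L IH] /=.
  rewrite big_nil (_ : (fun r => _) = cst 0); first exact: is_derive_cst.
  by apply/funext => u; rewrite big_nil.
move=> /andP[wt /IH dL]; rewrite big_cons.
rewrite (_ : (fun r => _) = (fun r => wterm k phi t (r, (y, z))) +
    (fun r => \sum_(t <- L) wterm k phi t (r, (y, z)))); last first.
  by apply/funext => u; rewrite big_cons.
by apply: is_deriveD => //; exact: is_derive_wterm.
Qed.

Lemma smooth_wterm k phi t : (forall p, smooth_at phi p) ->
  forall q, smooth_at (wterm k phi t) q.
Proof.
case: t => [[c i] j] S q l.
have D1 : Dk l (fun q : R * (R * R) => q.1) q by apply: Dk_linear => // u; exact: cvg_fst.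
have D2 : Dk l (fun q : R * (R * R) => q.2.1) q.
  apply: Dk_linear => // u.
  by apply: (continuous_comp (f := snd) (g := fst)); [exact: cvg_snd|exact: cvg_fst].
have D3 : Dk l (fun q : R * (R * R) => q.2.2) q.
  apply: Dk_linear => // u.
  by apply: (continuous_comp (f := snd) (g := snd)); [exact: cvg_snd|exact: cvg_snd].
have -> : wterm k phi (c, i, j) = (fun q : R * (R * R) => c * q.1 ^+ (2 * i + j - k) *
    (q.2.1 ^+ i * q.2.2 ^+ j) * iterD i j phi (q.1 ^+ 2 * q.2.1, q.1 * q.2.2)).
  by apply/funext => -[r [y z]].
apply: DkM.
  apply: DkM; first by apply: DkM; [exact: Dk_cst|exact: Dk_exp].
  by apply: DkM; exact: Dk_exp.
apply: (@Dk_comp2 R (R * (R * R))%type (iterD i j phi) (fun q => q.1 ^+ 2 * q.2.1)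
  (fun q => q.1 * q.2.2) l q); [exact: smooth_iterD| |exact: DkM].
by apply: DkM => //; exact: Dk_exp.
Qed.

Lemma smooth_wfun k phi : (forall p, smooth_at phi p) -> forall q, smooth_at (wfun k phi) q.
Proof.
move=> S q l; rewrite (_ : wfun k phi = fun q => \sum_(t <- wlist k) wterm k phi t q)//.
elim: (wlist k) => [|t L IH].
  rewrite (_ : (fun q => _) = fun=> 0); first exact: Dk_cst.
  by apply/funext => u; rewrite big_nil.
rewrite (_ : (fun q => _) = fun q => wterm k phi t q + \sum_(t <- L) wterm k phi t q); last first.
  by apply/funext => u; rewrite big_cons.
by apply: DkD => //; exact: smooth_wterm.
Qed.

Lemma dPhi_wfun k phi : (forall p, smooth_at phi p) -> dPhi (wfun k phi) = wfun k.+1 phi.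
Proof.
move=> S; apply/funext => -[r [y z]]; have [_ <-] := is_derive_wfun k r y z S.
rewrite /dPhi /derive; congr (lim (_ @ 0^')); apply/funext => h /=.
by congr (_ *: (wfun k phi _ - _)); congr (_, (_, _)); rewrite /= ?scaler0 ?add0r.
Qed.

End Taylor.

(** * The value of an operator at the identity as a combination of jets *)

Section JetFormula.
Variables (R : realType) (lam nu : R[i]) (alpha beta : bool).
Variable D : (SL R 3 -> R[i]^o) -> (SL R 2 -> R[i]^o).
Hypothesis DD : Diff (I_triv lam alpha) (J_triv nu beta) D.
Local Notation I := (I_triv lam alpha).
Local Notation Sfam := (Sfam lam alpha).

Lemma I_ratio f (g : SL R 3) : I f -> SLmx g o0 o0 != 0 ->
  f g = hom lam alpha (SLmx g o0 o0) * f (Nmx (ratio (SLmx g)).1 (ratio (SLmx g)).2).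
Proof.
move=> /I_trivP[_ Hf] c0; set y := (ratio _).1; set z := (ratio _).2.
have E : SLmx (Nmx (- y) (- z) * g)%g = mat3 1 0 0 (- y) 1 0 (- z) 0 1 *m
   mat3 (SLmx g o0 o0) (SLmx g o0 o1) (SLmx g o0 o2)
  (SLmx g o1 o0) (SLmx g o1 o1) (SLmx g o1 o2) (SLmx g o2 o0) (SLmx g o2 o1) (SLmx g o2 o2).
  by rewrite SLmxM -mat3E.
rewrite mul_mat3 in E.
have gE : g = (Nmx y z * (Nmx (- y) (- z) * g))%g.
  by rewrite mulgA NmxM !subrr Nmx0 mul1g.
rewrite {1}gE Hf E ?mxE/= ?mul1r ?mul0r ?addr0//.
  by rewrite /y /ratio/=; field.
by rewrite /z /ratio/=; field.
Qed.

(** If D f did not vanish at 1, the base point would lie in the support of f. The cone x10^2 + x20^2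
    < d x00^2 is stable under P on the right and defines an open neighbourhood of the base point, on
    which f vanishes by homogeneity. *)
Lemma Diff_local f (d : R) : I f -> 0 < d ->
  (forall y z, y ^+ 2 + z ^+ 2 < d -> f (Nmx y z) = 0) -> D f 1%g = 0.
Proof.
move=> If d0 f0; have [_ _ _ _ [_ loc]] := DD.
apply: contrapT => Df.
have S1 : Defs.support (@PG' R) (D f) (left_coset (@PG' R) 1%g).
  by split; [exists 1%g|move=> U _ U1; exists 1%g].
have [_ S] := loc f 1%g If S1.
pose C (x : 'M[R]_3) := 0 < d * (x o0 o0) ^+ 2 - ((x o1 o0) ^+ 2 + (x o2 o0) ^+ 2).
have Cmul (g q : SL R 3) : PG q -> C (SLmx (g * q)%g) -> C (SLmx g).
  move=> /PGP[q1 q2]; rewrite /C SLmxM !mxE !sum3 q1 q2 !mulr0 !addr0 !exprMn.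
  rewrite mulrA -mulrDl -mulrBl; have := sqr_ge0 (SLmx q o0 o0).
  by rewrite le_eqVlt => /orP[/eqP <-|q0]; rewrite ?mulr0 ?ltxx// pmulr_lgt0.
pose U (x : set (SL R 3)) := exists g, x g /\ C (SLmx g).
have UE g : U (left_coset (@PG R) g) <-> C (SLmx g).
  split=> [[_ [[q Pq <-]]]|Cg]; first exact: Cmul.
  by exists g; split=> //; exists 1%g; [exact: PG1|rewrite mulg1].
have oU : Defs.quotient_open (@PG R) U.
  rewrite /Defs.quotient_open (_ : [set _ | _] = @SLmx R 3 @^-1` [set x | C x]); last first.
    by apply/seteqP; split=> g /UE.
  move/continuousP : (@continuous_SLmx R 3); apply.
  have /smooth_continuous/continuousP : forall (x : 'M[R]_3) k,
    Dk k (fun x : 'M[R]_3 => d * (x o0 o0) ^+ 2 - ((x o1 o0) ^+ 2 + (x o2 o0) ^+ 2)) x.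
    move=> x k; apply: DkB; last by apply: DkD; apply: Dk_exp; exact: Dk_coord.
    by apply: DkM; [exact: Dk_cst|apply: Dk_exp; exact: Dk_coord].
  by move=> /(_ [set u | 0 < u]); apply; exact: open_gt.
have U1 : U (left_coset (@PG R) (embed 1%g)).
  by apply/UE; rewrite embed1 SLmx1 /C !mxE/= expr1n expr0n/= addr0 subr0 mulr1.
have [g [/UE Cg fg]] := S U oU U1; apply: fg.
have g0 : SLmx g o0 o0 != 0.
  apply/eqP => g0; move: Cg; rewrite /C g0 expr0n/= mulr0 sub0r oppr_gt0 ltNge.
  by rewrite addr_ge0// sqr_ge0.
rewrite (I_ratio If g0) f0 ?mulr0//.
rewrite /ratio/= !expr_div_n -mulrDl ltr_pdivrMr ?exprn_even_gt0//.
by rewrite -subr_gt0.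
Qed.

Lemma Diff_germ f1 f2 (d : R) : I f1 -> I f2 -> 0 < d ->
  (forall y z, y ^+ 2 + z ^+ 2 < d -> f1 (Nmx y z) = f2 (Nmx y z)) -> D f1 1%g = D f2 1%g.
Proof.
move=> I1 I2 d0 E; have [_ _ lin _ _] := DD.
have I12 : I (-1 *: f2 + f1) by exact: I_triv_comb.
have : D (-1 *: f2 + f1) 1%g = 0.
  apply: (Diff_local I12 d0) => y z yz.
  by rewrite -[LHS]/(-1 * f2 (Nmx y z) + f1 (Nmx y z)) E// mulN1r addNr.
rewrite lin// -[X in X = _ -> _]/(-1 * D f2 1%g + D f1 1%g) mulN1r addrC => /eqP.
by rewrite subr_eq0 => /eqP.
Qed.

Lemma Diff_translate f (a : SL R 2) : I f -> SLmx a q1 q0 = 0 ->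
  D (ltranslate (embed a^-1%g) f) 1%g = hom nu beta (SLmx a q0 q0) * D f 1%g.
Proof.
move=> If a0; have [DJ _ _ _ [eq _]] := DD.
rewrite eq// /ltranslate invgK mulg1.
have /J_trivP[_ HJ] := DJ _ If.
by rewrite -[in LHS](mul1g a) HJ.
Qed.

(* The torus diag(e^(-tau), e^tau, 1) scales the chart by (e^(2 tau), e^tau). *)
Lemma Sfam_scale phi (tau s : R) : (forall p, smooth_at phi p) ->
  D (Sfam (wfun 0 phi) (expR tau * s)) 1%g =
  cexp ((nu - lam) * tau%:C) * D (Sfam (wfun 0 phi) s) 1%g.
Proof.
move=> S; set f := Sfam (wfun 0 phi) s; set f' := Sfam _ (expR tau * s).
have SW := smooth_wfun 0 S.
have If : I f by exact: Sfam_I.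
have If' : I f' by exact: Sfam_I.
have ee : expR (- tau) * expR tau = 1 by rewrite -expRD addNr expR0.
have da : \det (mat2 (expR (- tau)) 0 0 (expR tau)) = 1 by rewrite det_mat2 ee mulr0 subr0.
pose a : SL R 2 := mkSL da.
have aE : SLmx a = mat2 (expR (- tau)) 0 0 (expR tau) by [].
have := @Diff_translate f a If; rewrite aE !mxE/= => /(_ erefl).
pose K := hom lam alpha (expR (- tau)).
(* On the disc y^2 + z^2 < 1/M both (y, z) and its image (e^(2 tau) y, e^tau z) lie in the unit
   disc, where the cutoff equals 1. *)
pose M := expR tau ^+ 4 + expR tau ^+ 2 + 1.
have M0 : 0 < M by rewrite ltr_wpDl// addr_ge0// exprn_ge0// expR_ge0.
have IK : I (K *: f') by exact: I_triv_scale.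
rewrite (@Diff_germ _ (K *: f') M^-1); [|exact: I_triv_ltranslate|by []|by rewrite invr_gt0|]; last first.
  move=> y z yz.
  rewrite /ltranslate embedV invgK -[RHS]/(K * f' (Nmx y z)).
  have E : SLmx (embed a * Nmx y z)%g = mat3 (expR (- tau)) 0 0 (expR tau * y) (expR tau) 0 z 0 1.
    rewrite SLmxM embedE aE !mxE/= mkSLE mul_mat3.
    by congr (mat3 _ _ _ _ _ _ _ _ _); ring.
  have e0 : expR (- tau) != 0 by rewrite gt_eqF// expR_gt0.
  have en : (expR (- tau))^-1 = expR tau by apply: (mulfI e0); rewrite ee mulfV.
  have rE : ratio (SLmx (embed a * Nmx y z)%g) = (expR tau ^+ 2 * y, expR tau * z).
    by rewrite /ratio E !mxE/= en; congr pair; ring.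
  rewrite (I_ratio If); last by rewrite E mxE.
  rewrite rE E mxE/= -/K; congr (_ * _).
  have y2 := sqr_ge0 y; have z2 := sqr_ge0 z.
  have e2 : 0 <= expR tau ^+ 2 by rewrite exprn_ge0// expR_ge0.
  have e4 : 0 <= expR tau ^+ 4 by rewrite exprn_ge0// expR_ge0.
  have yzM : (y ^+ 2 + z ^+ 2) * M < 1 by rewrite -ltr_pdivlMr// mul1r.
  rewrite /f /f' !Sfam_Nmx ?wfun0.
  - by congr ((phi (_, _))%:C); ring.
  - by move: yzM; rewrite /M; nra.
  - have -> : (expR tau ^+ 2 * y) ^+ 2 + (expR tau * z) ^+ 2 =
        expR tau ^+ 4 * y ^+ 2 + expR tau ^+ 2 * z ^+ 2 by ring.
    by move: yzM; rewrite /M; nra.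
rewrite (Diff_scale DD K If') -[X in X = _ -> _]/(K * D f' 1%g).
rewrite /K !hom_expR => H.
have c0 := cexp_neq0 (- lam * (- tau)%:C).
apply: (mulfI c0); rewrite H mulrA -cexpD; congr (cexp _ * _).
by rewrite rmorphN; ring.
Qed.

(** A family that is constant in its parameter, so that everything shown for [Sfam] applies to a
    single profile phi. *)
Definition Sec phi := Sfam (fun q : R * (R * R) => phi q.2) 0.

Lemma smooth_snd phi : (forall p, smooth_at phi p) ->
  forall q, smooth_at (fun q : R * (R * R) => phi q.2) q.
Proof.
move=> S q k.
have D2 : Dk k (fun q : R * (R * R) => q.2.1) q.
  apply: Dk_linear => // u.
  by apply: (continuous_comp (f := snd) (g := fst)); [exact: cvg_snd|exact: cvg_fst].
have D3 : Dk k (fun q : R * (R * R) => q.2.2) q.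
  apply: Dk_linear => // u.
  by apply: (continuous_comp (f := snd) (g := snd)); [exact: cvg_snd|exact: cvg_snd].
rewrite (_ : (fun q => _) = fun q : R * (R * R) => phi (q.2.1, q.2.2)); last first.
  by apply/funext => -[r [y z]].
by apply: Dk_comp2 => //; rewrite -surjective_pairing; exact: S.
Qed.

Lemma Sec_I phi : (forall p, smooth_at phi p) -> I (Sec phi).
Proof. by move=> S; apply: Sfam_I; exact: smooth_snd. Qed.

Lemma Sec_Nmx phi y z : y ^+ 2 + z ^+ 2 <= 1 -> Sec phi (Nmx y z) = (phi (y, z))%:C.
Proof. by move=> yz; rewrite /Sec Sfam_Nmx. Qed.

Definition monom i j (p : R * R) : R := p.1 ^+ i * p.2 ^+ j.

Lemma smooth_monom i j p : smooth_at (monom i j) p.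
Proof.
move=> k; apply: DkM; apply: Dk_exp; apply: Dk_linear => // u; [exact: cvg_fst|exact: cvg_snd].
Qed.

(** At r = 0 only terms without a power of r survive, and there the jet of phi is taken at the
    origin: near the base point the section is a combination of monomials. This is the step that
    yields finite order. *)
Lemma Sfam_wlist k phi (L : seq (R * nat * nat)) : (forall p, smooth_at phi p) ->
  all (fun t : R * nat * nat => k <= 2 * t.1.2 + t.2)%N L ->
  D (Sfam (fun q => \sum_(t <- L) wterm k phi t q) 0) 1%g =
  \sum_(t <- L | (2 * t.1.2 + t.2 == k)%N)
    (t.1.1 * iterD t.1.2 t.2 phi (0, 0))%:C * D (Sec (monom t.1.2 t.2)) 1%g.
Proof.
move=> S.
have SL (L' : seq (R * nat * nat)) q : smooth_at (fun q => \sum_(t <- L') wterm k phi t q) q.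
  move=> l; elim: L' => [|t L' IH].
    rewrite (_ : (fun q => _) = fun=> 0); first exact: Dk_cst.
    by apply/funext => u; rewrite big_nil.
  rewrite (_ : (fun q => _) = fun q => wterm k phi t q + \sum_(t <- L') wterm k phi t q); last first.
    by apply/funext => u; rewrite big_cons.
  by apply: DkD => //; exact: smooth_wterm.
elim: L => [_|[[c i] j] L IH] /=.
  rewrite big_nil; apply: (@Diff_local _ 1) => //; first exact: Sfam_I.
  by move=> y z /ltW yz; rewrite Sfam_Nmx// big_nil.
move=> /andP[kij /IH DL]; rewrite big_cons/=.
set m : R[i] := if (2 * i + j == k)%N then (c * iterD i j phi (0, 0))%:C else 0.
have IL : I (Sfam (fun q => \sum_(t <- L) wterm k phi t q) 0) by exact: Sfam_I.
have IM : I (Sec (monom i j)) by apply: Sec_I; exact: smooth_monom.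
have [_ _ lin _ _] := DD.
rewrite (@Diff_germ _ (m *: Sec (monom i j) + Sfam (fun q => \sum_(t <- L) wterm k phi t q) 0) 1) //.
- rewrite lin// -[LHS]/(m * D (Sec (monom i j)) 1%g + _) DL /m.
  by case: eqP => // _; rewrite mul0r add0r.
- exact: Sfam_I.
- exact: I_triv_comb.
- move=> y z /ltW yz.
  rewrite -[RHS]/(m * Sec (monom i j) (Nmx y z) + Sfam _ 0 (Nmx y z)).
  rewrite Sec_Nmx// !Sfam_Nmx// big_cons rmorphD; congr (_ + _).
  rewrite /wterm /m expr0n/= !mul0r /monom/= expr0n subn_eq0.
  have -> : (2 * i + j <= k)%N = (2 * i + j == k)%N by rewrite eqn_leq kij andbT.
  case: eqP => _ /=; last by rewrite mulr0 !mul0r.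
  by rewrite mul0r -rmorphM; congr (_%:C); ring.
Qed.

(** Pairs (i, j) may be repeated in the list; on the given weight j is determined by i, so they are
    collected by i. The coefficients M are chosen before x, since they must not depend on the
    section. *)
Lemma sum_by_weight k (L : seq (R[i] * nat * nat)) : exists M : nat -> R[i],
  forall x : nat -> nat -> R[i],
  \sum_(t <- L | (2 * t.1.2 + t.2 == k)%N) t.1.1 * x t.1.2 t.2 =
  \sum_(i < k.+1 | (2 * i <= k)%N) M i * x i (k - 2 * i)%N.
Proof.
elim: L => [|[[c i] j] L [M HM]].
  by exists (fun=> 0) => x; rewrite big_nil big1// => i _; rewrite mul0r.
have [ijk|ijk] := eqVneq (2 * i + j)%N k; last first.
  by exists M => x; rewrite big_cons/= (negbTE ijk) HM.
exists (fun l => (if l == i then c else 0) + M l) => x; rewrite big_cons/= ijk eqxx HM.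
under [RHS]eq_bigr do rewrite mulrDl.
rewrite big_split/=; congr (_ + _).
have ik : (i < k.+1)%N by lia.
rewrite (bigD1 (Ordinal ik))/=; last by lia.
rewrite eqxx (_ : (k - 2 * i)%N = j); last by lia.
rewrite big1 ?addr0// => l /andP[_ li].
by rewrite (_ : (val l == i) = false) ?mul0r//; apply/negbTE; apply: contraNneq li => li; apply/eqP/val_inj.
Qed.

(** Differentiating [Sfam_scale] at tau = 0 gives Euler's equation with exponent nu - lam for the
    value of D along phi(r^2 y, r z). At r = 1 this is the value on phi itself; for an integral
    exponent k it equals 1/k! times the k-th derivative at 0, which [Sfam_wlist] evaluates. *)
Lemma Sec_formula :
  (exists k : nat, nu = lam + k%:R /\ exists M : nat -> R[i], forall phi, (forall p, smooth_at phi p) ->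
    D (Sec phi) 1%g = \sum_(i < k.+1 | (2 * i <= k)%N) M i * (iterD i (k - 2 * i) phi (0, 0))%:C) \/
  ((forall k : nat, nu <> lam + k%:R) /\ forall phi, (forall p, smooth_at phi p) -> D (Sec phi) 1%g = 0).
Proof.
case kE : (nu - lam) => [a b].
have ode phi : (forall p, smooth_at phi p) ->
    let P k r := complex.Re (D (Sfam (wfun k phi) r) 1%g) in
    let Q k r := complex.Im (D (Sfam (wfun k phi) r) 1%g) in
    (exists k : nat, [/\ a = k%:R, b = 0, P 0%N 1 = P k 0 / k`!%:R & Q 0%N 1 = Q k 0 / k`!%:R]) \/
    ((forall k : nat, ~ (a = k%:R /\ b = 0)) /\ P 0%N 1 = 0 /\ Q 0%N 1 = 0).
  move=> S P Q.
  have dPQ k (r : R) : is_derive r 1 (P k) (P k.+1 r) /\ is_derive r 1 (Q k) (Q k.+1 r).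
    have := is_derive_Sfam DD r (smooth_wfun k S).
    by rewrite dPhi_wfun.
  have dP k (r : R) := (dPQ k r).1; have dQ k (r : R) := (dPQ k r).2.
  have sc tau s : P 0%N (expR tau * s) = expR (a * tau) * cos (b * tau) * P 0%N s
        - expR (a * tau) * sin (b * tau) * Q 0%N s /\
      Q 0%N (expR tau * s) = expR (a * tau) * sin (b * tau) * P 0%N s
        + expR (a * tau) * cos (b * tau) * Q 0%N s.
    rewrite /P /Q Sfam_scale// kE /cexp /=; case: (D _ _) => x y /=.
    by rewrite !mulr0 !mul0r !subr0 !addr0 !add0r; split; ring.
  have dE : is_derive (0 : R) 1 (fun tau => expR (a * tau)) a.
    apply: is_derive_eq (is_derive_comp1 (F := fun tau => a * tau) (d := a) _ (is_derive_expR _)) _.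
      by apply: is_derive_eq; rewrite /GRing.scale/=; ring.
    by rewrite mulr0 expR0 mul1r.
  have db : is_derive (0 : R) 1 (fun tau => b * tau) b.
    by apply: is_derive_eq; rewrite /GRing.scale/=; ring.
  have dC : is_derive (0 : R) 1 (fun tau => cos (b * tau)) 0.
    apply: is_derive_eq (is_derive_comp1 db (is_derive_cos _)) _.
    by rewrite mulr0 sin0 oppr0 mul0r.
  have dS : is_derive (0 : R) 1 (fun tau => sin (b * tau)) b.
    apply: is_derive_eq (is_derive_comp1 db (is_derive_sin _)) _.
    by rewrite mulr0 cos0 mul1r.
  have dl (F : nat -> R -> R) s : (forall k (r : R), is_derive r 1 (F k) (F k.+1 r)) ->
      is_derive (0 : R) 1 (fun tau => F 0%N (expR tau * s)) (F 1%N s * s).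
    move=> dF; have d1 : is_derive (0 : R) 1 (fun tau => expR tau * s) s.
      by apply: is_derive_eq; rewrite /GRing.scale/= expR0; ring.
    have := is_derive_comp1 d1 (dF 0%N (expR 0 * s)).
    by rewrite expR0 mul1r.
  apply: euler_ode => // s.
    have [_ <-] : is_derive (0 : R) 1 (fun tau => P 0%N (expR tau * s)) (s * P 1%N s).
      by rewrite mulrC; exact: dl.
    rewrite (_ : (fun tau => _) = (fun tau => expR (a * tau) * cos (b * tau) * P 0%N s
        - expR (a * tau) * sin (b * tau) * Q 0%N s)); last first.
      by apply/funext => tau; rewrite (sc tau s).1.
    have dd := is_deriveB (is_deriveM (is_deriveM dE dC) (@is_derive_cst R R R (P 0%N s) (0 : R) 1))
      (is_deriveM (is_deriveM dE dS) (@is_derive_cst R R R (Q 0%N s) (0 : R) 1)).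
    have [_ ->] := dd.
    by rewrite /GRing.scale/= !fctE/= !mulr0 expR0 cos0 sin0 /cst; ring.
  have [_ <-] : is_derive (0 : R) 1 (fun tau => Q 0%N (expR tau * s)) (s * Q 1%N s).
    by rewrite mulrC; exact: dl.
  rewrite (_ : (fun tau => _) = (fun tau => expR (a * tau) * sin (b * tau) * P 0%N s
      + expR (a * tau) * cos (b * tau) * Q 0%N s)); last first.
    by apply/funext => tau; rewrite (sc tau s).2.
  have dd := is_deriveD (is_deriveM (is_deriveM dE dS) (@is_derive_cst R R R (P 0%N s) (0 : R) 1))
    (is_deriveM (is_deriveM dE dC) (@is_derive_cst R R R (Q 0%N s) (0 : R) 1)).
  have [_ ->] := dd.
  by rewrite /GRing.scale/= !fctE/= !mulr0 expR0 cos0 sin0 /cst; ring.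
(* The two sections differ only by their dependence on the parameter and have the same germ at r =
   1. *)
have Sec1 phi : (forall p, smooth_at phi p) -> D (Sec phi) 1%g = D (Sfam (wfun 0 phi) 1) 1%g.
  move=> S; apply: (@Diff_germ _ _ 1) => //.
  - exact: Sec_I.
  - by apply: Sfam_I; exact: smooth_wfun.
  - by move=> y z /ltW yz; rewrite Sec_Nmx// Sfam_Nmx// wfun0 expr1n !mul1r.
have nat_eq (k : nat) : nu = lam + k%:R <-> a = k%:R /\ b = 0.
  have nuE : nu = lam + (a +i* b) by rewrite -kE addrC subrK.
  have kC : k%:R = (k%:R : R) +i* 0 :> R[i] by rewrite -[RHS]/((k%:R)%:C) rmorph_nat.
  rewrite nuE; split=> [/addrI|[-> ->]]; last by rewrite kC.
  by rewrite kC => -[].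
have [[k [ak b0]]|nk] := pselect (exists k : nat, a = k%:R /\ b = 0); last first.
  right; split=> [k /nat_eq hk|phi S]; first by apply: nk; exists k.
  have [[k [ak b0 _ _]]|[_ [p0 q0]]] := ode phi S; first by case: nk; exists k.
  by rewrite Sec1//; apply/eqP; rewrite eq_complex p0 q0 /= !eqxx.
left; exists k; split; first exact/nat_eq.
(* The coefficients consist of k!, the combinatorial constants of [wlist] and the values of D on
   monomials, none of which involves phi. *)
pose L : seq (R[i] * nat * nat) := [seq (((t.1.1 / k`!%:R)%:C * D (Sec (monom t.1.2 t.2)) 1%g), t.1.2, t.2)
  | t : R * nat * nat <- wlist R k].
have [M HM] := sum_by_weight k L; exists M => phi S.
rewrite -(HM (fun i j => (iterD i j phi (0, 0))%:C)) Sec1//.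
have [[k' [ak' _ p0 q0]]|[n _]] := ode phi S; last by case: (n k).
have kk : k' = k by apply/eqP; rewrite -(eqr_nat R) -ak -ak'.
subst k'.
have -> : D (Sfam (wfun 0 phi) 1) 1%g = (k`!%:R^-1)%:C * D (Sfam (wfun k phi) 0) 1%g.
  rewrite [LHS](_ : _ = complex.Re (D (Sfam (wfun 0 phi) 1) 1%g) +i* complex.Im (D (Sfam (wfun 0 phi) 1) 1%g)); last first.
    by case: (D _ _).
  rewrite p0 q0; case: (D (Sfam (wfun k phi) 0) 1%g) => x y; simpc.
  by congr (_ +i* _); rewrite mulrC.
rewrite (Sfam_wlist S (wlist_weight R k)) mulr_sumr big_map; apply: eq_bigr => t _ /=.
rewrite !rmorphM/=; ring.
Qed.

(** Near the base point a complex section is p1 + i p2 with real profiles, so the formula extends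
    from profiles by linearity and dependence on the germ. *)
Lemma jet_formula :
  (exists k : nat, nu = lam + k%:R /\ exists M : nat -> R[i], forall f, I f ->
    D f 1%g = \sum_(i < k.+1 | (2 * i <= k)%N) M i * Dop i (k - 2 * i) f 1%g) \/
  ((forall k : nat, nu <> lam + k%:R) /\ forall f, I f -> D f 1%g = 0).
Proof.
have split_f f : I f -> exists p1 p2 : R * R -> R, [/\ forall p, smooth_at p1 p,
    forall p, smooth_at p2 p, D f 1%g = 'i * D (Sec p2) 1%g + D (Sec p1) 1%g &
    forall i j, Dop i j f 1%g = 'i * (iterD i j p2 (0, 0))%:C + (iterD i j p1 (0, 0))%:C].
  move=> If; have [sf _] := (I_trivP _ _ _).1 If.
  exists (fun p => complex.Re (f (1 * Nmx p.1 p.2)%g)), (fun p => complex.Im (f (1 * Nmx p.1 p.2)%g)).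
  have s1 p := (smooth_chart 1%g p sf).1; have s2 p := (smooth_chart 1%g p sf).2.
  split=> //.
  - have [_ _ lin _ _] := DD.
    rewrite -[RHS]/(('i *: D (Sec _) + D (Sec _)) 1%g) -lin; [|exact: Sec_I|exact: Sec_I].
    apply: (@Diff_germ _ _ 1) => //; first by apply: I_triv_comb; exact: Sec_I.
    move=> y z /ltW yz; rewrite -[RHS]/('i * Sec _ (Nmx y z) + Sec _ (Nmx y z)) !Sec_Nmx// mul1g.
    by rewrite [LHS]complexE addrC.
  - move=> i j; rewrite /Dop embed1 -[X in lie_jet _ _ X]mulg1 -Nmx0 lie_jet_chart.
    by rewrite [LHS]complexE addrC.
have [[k [nuE [M HM]]]|[nk D0]] := Sec_formula.
  left; exists k; split=> //; exists M => f If.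
  have [p1 [p2 [s1 s2 -> jf]]] := split_f f If.
  rewrite !HM// mulr_sumr -big_split/=; apply: eq_bigr => i _.
  by rewrite jf mulrDr mulrCA.
right; split=> // f If.
by have [p1 [p2 [s1 s2 -> _]]] := split_f f If; rewrite !D0// mulr0 addr0.
Qed.

End JetFormula.

(** * Jets of test functions and the conditions on the coefficients *)

Section Jets.
Variable R : realType.

Lemma derive1Zl (c : R) (F : R -> R) x : smooth_at F x ->
  derive1 (fun y => c * F y) x = c * derive1 F x.
Proof.
move=> /is_derive_smooth dF; exact: is_derive_derive1.
Qed.

Lemma derive1n_exp (n j : nat) (x : R) :
  derive1n n (fun y : R => y ^+ j) x = (j ^_ n)%:R * x ^+ (j - n).
Proof.
elim: n x => [|n IH] x; first by rewrite ffactn0 mul1r subn0.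
rewrite derive1nS (_ : derive1n n _ = fun x => (j ^_ n)%:R * x ^+ (j - n)); last exact/funext.
rewrite derive1Zl; last by move=> k; apply: Dk_exp; exact: Dk_id.
by rewrite exp_derive1 ffactnSr natrM subnS /GRing.scale/= mulrA.
Qed.

Lemma derive1n_exp0 (n j : nat) :
  derive1n n (fun y : R => y ^+ j) 0 = (if n == j then j`! else 0)%:R.
Proof.
rewrite derive1n_exp; have [nj|nj|->] := ltngtP n j.
- by rewrite expr0n subn_eq0 leqNgt nj mulr0.
- by rewrite ffact_small// mul0r.
- by rewrite subnn expr0 mulr1 ffactnn.
Qed.

(** In y^n s(y) the coefficient of y^(n+1) is s'(0). The function s need only be smooth near 0, as
    it will be a power of 1 + y. *)
Lemma derive1n_expM (s : R -> R) (O : set R) n : open O -> O 0 ->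
  (forall y, O y -> smooth_at s y) ->
  derive1n n.+1 (fun y => y ^+ n * s y) 0 = (n.+1)`!%:R * derive1 s 0.
Proof.
move=> oO O0 sO; elim: n => [|n IH].
  by rewrite mul1r; congr (derive1 _ 0); apply/funext => y; rewrite expr0 mul1r.
rewrite (_ : (fun y => _) = fun y => (0 + 1 * y) * (y ^+ n * s y)); last first.
  by apply/funext => y; rewrite exprS; ring.
rewrite (leibniz_affine (O := O)) => [|//|y Oy k|//]; last first.
  by apply: DkM; [apply: Dk_exp; exact: Dk_id|exact: sO].
by rewrite IH mulr0 addr0 mul0r add0r mulr1 mulrA -natrM -factS.
Qed.

(** The first factor is restricted to an open set for the sake of powers of 1 + y, which are
    singular at -1. *)
Lemma iterD_prod (O : set R) (A B : R -> R) a b : open O ->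
  (forall y, O y -> smooth_at A y) -> (forall z, smooth_at B z) ->
  forall y z, O y -> iterD a b (fun p => A p.1 * B p.2) (y, z) = derive1n a A y * derive1n b B z.
Proof.
move=> oO sA sB y z; elim: a y => [|a IH] y Oy.
  elim: b z => [//|b IH] z.
  rewrite /iterD /= -!/(iterD 0 b _) -derive1_snd.
  rewrite (_ : (fun t => _) = fun t => A y * derive1n b B (z + t)); last by apply/funext => t; exact: IH.
  by rewrite (derive1_shift0 (fun u => A y * derive1n b B u)) derive1Zl//; exact: smooth_at_derive1n.
rewrite /iterD iterS -!/(iterD a b _) -derive1_fst.
have -> : derive1 (fun t => iterD a b (fun p => A p.1 * B p.2) (y + t, z)) 0 =
    derive1 (fun t => derive1n b B z * derive1n a A t) y.
  rewrite -[RHS]derive1_shift0 !derive1E; apply: near_eq_derive.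
  have c : (fun t : R => y + t) @ 0 --> y.
    rewrite -[X in _ --> X]addr0; apply: cvgD; [exact: cvg_cst|exact: cvg_id].
  have nO : nbhs (0 : R) [set t | O (y + t)] := c _ (open_nbhs_nbhs (conj oO Oy)).
  by apply: filterS nO => t Ot; rewrite IH// mulrC.
by rewrite derive1Zl 1?mulrC//; exact/smooth_at_derive1n/sA.
Qed.

End Jets.

Section UnipotentTest.
Variables (R : realType) (mu : R[i]) (eps : bool).

Lemma smooth_hom_shift (y : R) : 0 < 1 + y ->
  smooth_at (fun y : R => complex.Re (hom mu eps (1 + y))) y /\
  smooth_at (fun y : R => complex.Im (hom mu eps (1 + y))) y.
Proof.
move=> y0; have y1 := lt0r_neq0 y0.
have d1 k : Dk k (fun y : R => 1 + y) y by apply: DkD; [exact: Dk_cst|exact: Dk_id].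
by split=> k; have [D1 D2] := Dk_hom mu eps k y1;
  [exact: Dk_comp1 D1 (d1 k)|exact: Dk_comp1 D2 (d1 k)].
Qed.

Lemma derive1_hom_shift :
  derive1 (fun y : R => complex.Re (hom mu eps (1 + y))) 0 +i*
  derive1 (fun y : R => complex.Im (hom mu eps (1 + y))) 0 = - mu.
Proof.
rewrite (derive1_shift0 (fun y => complex.Re (hom mu eps y))).
rewrite (derive1_shift0 (fun y => complex.Im (hom mu eps y))).
have nO : \forall y \near (1 : R), 0 < y by exact: (lt_nbhsr ltr01).
case muE : (- mu) => [a b].
have dl (c : R) : is_derive (1 : R) 1 (fun y => c * ln y) c.
  have := is_deriveZ c (is_derive1_ln (ltr01 : 0 < 1 :> R)).
  by rewrite invr1 /GRing.scale/= mulr1.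
have dE := is_derive_comp1 (dl a) (is_derive_expR _).
have dC := is_derive_comp1 (dl b) (is_derive_cos _).
have dS := is_derive_comp1 (dl b) (is_derive_sin _).
rewrite ln1 mulr0 expR0 mul1r in dE; rewrite ln1 mulr0 sin0 oppr0 mul0r in dC.
rewrite ln1 mulr0 cos0 mul1r in dS.
have hE y : 0 < y -> hom mu eps y =
    (expR (a * ln y) * cos (b * ln y)) +i* (expR (a * ln y) * sin (b * ln y)).
  move=> y0; rewrite hom_gt0// muE /cexp /=; simpc.
  by congr (expR _ * cos _ +i* (expR _ * sin _)); ring.
congr (_ +i* _).
  rewrite derive1E (near_eq_derive (g := fun y => expR (a * ln y) * cos (b * ln y))); last first.
    by apply: filterS nO => y y0; rewrite hE.
  have [_ ->] := is_deriveM dE dC.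
  by rewrite ln1 !mulr0 expR0 cos0 /GRing.scale/=; ring.
rewrite derive1E (near_eq_derive (g := fun y => expR (a * ln y) * sin (b * ln y))); last first.
  by apply: filterS nO => y y0; rewrite hE.
have [_ ->] := is_deriveM dE dS.
by rewrite ln1 !mulr0 expR0 sin0 /GRing.scale/=; ring.
Qed.

End UnipotentTest.

Section ChartJets.
Variables (R : realType) (lam : R[i]) (alpha : bool).

Lemma Dop_germ a b (f : SL R 3 -> R[i]^o) (p1 p2 : R * R -> R) (d : R) : 0 < d ->
  (forall y z, y ^+ 2 + z ^+ 2 < d -> f (Nmx y z) = p1 (y, z) +i* p2 (y, z)) ->
  Dop a b f 1%g = iterD a b p1 (0, 0) +i* iterD a b p2 (0, 0).
Proof.
move=> d0 E; rewrite /Dop embed1 -[X in lie_jet _ _ X]mulg1 -Nmx0 lie_jet_chart.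
have nd : \forall p \near ((0, 0) : R * R), p.1 ^+ 2 + p.2 ^+ 2 < d.
  have : {for ((0, 0) : R * R), continuous (fun p : R * R => p.1 ^+ 2 + p.2 ^+ 2)}.
    have D2 : Dk 1 (fun p : R * R => p.1 ^+ 2 + p.2 ^+ 2) (0, 0).
      by apply: DkD; apply: Dk_exp; apply: Dk_linear => // u; [exact: cvg_fst|exact: cvg_snd].
    exact: differentiable_continuous (nbhs_singleton D2.1).
  move=> /(_ [set u | u < d]); apply; apply: lt_nbhsl.
  by rewrite /= expr0n/= addr0.
by congr (_ +i* _); apply: near_eq_iterD; apply: filterS nd => -[y z] /= yz;
  rewrite NmxM !add0r E.
Qed.

Lemma Dop_Sec a b (phi : R * R -> R) : Dop a b (Sec lam alpha phi) 1%g = (iterD a b phi (0, 0))%:C.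
Proof.
rewrite (@Dop_germ a b _ phi (fun=> 0) 1) //; last by move=> y z /ltW yz; rewrite Sec_Nmx.
congr (_ +i* _).
rewrite (_ : (fun=> 0) = fun p : R * R => (fun=> 0) p.1 * (fun=> 0) p.2); last first.
  by apply/funext => p; rewrite mul0r.
rewrite (@iterD_prod R setT (fun=> 0) (fun=> 0)) //; [|exact: openT|by move=> y _ k; exact: Dk_cst|by move=> y k; exact: Dk_cst].
have -> : derive1n a (fun=> (0 : R)) = fun=> 0.
  by elim: a => [//|a IH]; rewrite derive1nS IH; apply/funext => y; rewrite derive1_cst.
by rewrite mul0r.
Qed.

Lemma iterD_monom a b i j :
  iterD a b (@monom R i j) (0, 0) = (if (a == i) && (b == j) then i`! * j`! else 0)%:R.
Proof.
rewrite /monom (@iterD_prod R setT (fun y => y ^+ i) (fun z => z ^+ j)) //; first 1 last.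
- exact: openT.
- by move=> y _ k; apply: Dk_exp; exact: Dk_id.
- by move=> y k; apply: Dk_exp; exact: Dk_id.
rewrite !derive1n_exp0; case: eqP => _; last by rewrite mul0r.
by case: eqP => _; rewrite ?mulr0// natrM.
Qed.

End ChartJets.

Section Classification.
Variables (R : realType) (lam nu : R[i]) (alpha beta : bool).
Variable D : (SL R 3 -> R[i]^o) -> (SL R 2 -> R[i]^o).
Hypothesis DD : Diff (I_triv lam alpha) (J_triv nu beta) D.
Local Notation I := (I_triv lam alpha).
Local Notation Sec := (Sec lam alpha).

(** The element -1 of G' sends the chart point (y, z) to (y, - z) and multiplies sections by the
    sign of alpha, so on the monomial it acts by a sign depending on alpha and j; on the target it
    acts by the sign of beta. *)
Lemma Diff_parity i j : D (Sec (@monom R i j)) 1%g != 0 -> beta = alpha (+) odd j.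
Proof.
move=> D0; set f := Sec _ in D0.
have If : I f by apply: Sec_I; exact: smooth_monom.
have da : \det (mat2 (-1) 0 0 (-1) : 'M[R]_2) = 1 by rewrite det_mat2 mulrNN mulr1 mulr0 subr0.
pose a : SL R 2 := mkSL da.
have aE : SLmx a = mat2 (-1) 0 0 (-1) by [].
have := @Diff_translate _ _ _ _ _ D DD f a If; rewrite aE !mxE/= => /(_ erefl).
pose K : R[i] := (-1) ^+ (alpha (+) odd j).
have IK : I (K *: f) by exact: I_triv_scale.
rewrite (@Diff_germ _ _ _ _ _ D DD _ (K *: f) 1) //; [|exact: I_triv_ltranslate|]; last first.
  move=> y z /ltW yz.
  rewrite /ltranslate embedV invgK -[RHS]/(K * f (Nmx y z)).
  have E : SLmx (embed a * Nmx y z)%g = mat3 (-1) 0 0 (- y) (-1) 0 z 0 1.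
    rewrite SLmxM embedE aE !mxE/= mkSLE mul_mat3.
    by congr (mat3 _ _ _ _ _ _ _ _ _); ring.
  have rE : ratio (SLmx (embed a * Nmx y z)%g) = (y, - z).
    by rewrite /ratio E !mxE/= invrN1 !mulrN1 opprK.
  rewrite (I_ratio If); last by rewrite E mxE oppr_eq0 oner_eq0.
  rewrite rE E mxE/= homN1 /f !Sec_Nmx ?sqrrN//.
  have N1 : ((-1) ^+ j)%:C = (-1) ^+ j :> R[i] by rewrite rmorphXn/= rmorphN rmorph1.
  rewrite /monom/= (exprNn z) /K signr_addb signr_odd !rmorphM/= N1.
  ring.
rewrite (Diff_scale DD K If) homN1 -[X in X = _ -> _]/(K * _) => /(mulIf D0) /eqP.
by rewrite (inj_eq (@signr_inj _)) => /eqP.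
Qed.

Section JetExpansion.
Variables (k : nat) (M : nat -> R[i]).
Hypothesis nuE : nu = lam + k%:R.
Hypothesis jets : forall f, I f ->
  D f 1%g = \sum_(i < k.+1 | (2 * i <= k)%N) M i * Dop i (k - 2 * i) f 1%g.

Lemma D_monom i j : D (Sec (@monom R i j)) 1%g =
  if (2 * i + j == k)%N then M i * (i`! * j`!)%:R else 0.
Proof.
rewrite jets; last by apply: Sec_I; exact: smooth_monom.
under eq_bigr do rewrite Dop_Sec iterD_monom.
case: eqP => ijk; last first.
  rewrite big1// => l lk; case: ifP => [/andP[/eqP li /eqP lj]|_]; last by rewrite mulr0.
  by exfalso; apply: ijk; lia.
have ik : (i < k.+1)%N by lia.
rewrite (bigD1 (Ordinal ik))/=; last by lia.
rewrite eqxx (_ : (k - 2 * i == j)%N); last by lia.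
rewrite rmorph_nat big1 ?addr0// => l /andP[_ li].
by rewrite (_ : (val l == i) = false) ?mulr0//; apply/negbTE; apply: contraNneq li => li; apply/eqP/val_inj.
Qed.

Lemma coefficient_parity i : (2 * i <= k)%N -> M i != 0 -> beta = alpha (+) odd k.
Proof.
move=> ik Mi; have := @Diff_parity i (k - 2 * i).
rewrite D_monom (_ : (2 * i + (k - 2 * i) == k)%N = true); last by lia.
rewrite mulf_eq0 (negbTE Mi)/= pnatr_eq0 muln_eq0.
rewrite negb_or -!lt0n !fact_gt0 => /(_ isT) ->.
by rewrite oddB// mul2n odd_double addbF.
Qed.

(* On the germ y^i z^j the operator vanishes for reasons of weight, while on its translate
   by the upper unipotent element a only the term of index i + 1 contributes. *)
Lemma coefficient_weight i : (2 * i.+1 <= k)%N -> M i.+1 != 0 -> lam = 1 - (k - i.+1)%:R.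
Proof.
move=> ik Mi; pose j := (k - 2 * i.+1)%N; set f := Sec (@monom R i j).
have If : I f by apply: Sec_I; exact: smooth_monom.
have da : \det (mat2 1 1 0 1 : 'M[R]_2) = 1 by rewrite det_mat2 mulr1 mulr0 subr0.
pose a : SL R 2 := mkSL da.
have aE : SLmx a = mat2 1 1 0 1 by [].
have := @Diff_translate _ _ _ _ _ D DD f a If; rewrite aE !mxE/= => /(_ erefl).
rewrite D_monom (_ : (2 * i + j == k)%N = false); last by rewrite /j; lia.
rewrite mulr0 jets; last exact: I_triv_ltranslate.
(* The element a sends (y, z) to (y / (1 + y), z / (1 + y)) with corner entry 1 + y. The
   denominators of the monomial shift weight and parity by i + j, so the translate has the germ y^i
   z^j [hom mu eps (1 + y)]. *)
pose mu := lam + (i + j)%:R; pose eps := alpha (+) odd (i + j).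
pose s1 (y : R) := complex.Re (hom mu eps (1 + y)).
pose s2 (y : R) := complex.Im (hom mu eps (1 + y)).
pose O := [set y : R | 0 < 1 + y].
have oO : open O.
  rewrite (_ : O = [set y | -1 < y]); first exact: open_gt.
  by apply/seteqP; split=> y; rewrite /O/= -ltrBlDl sub0r.
have O0 : O 0 by rewrite /O/= addr0.
have jE a' b' : Dop a' b' (ltranslate (embed a^-1%g) f) 1%g =
    (derive1n a' (fun y : R => y ^+ i * s1 y) 0 * derive1n b' (fun z : R => z ^+ j) 0) +i*
    (derive1n a' (fun y : R => y ^+ i * s2 y) 0 * derive1n b' (fun z : R => z ^+ j) 0).
  have sm (y : R) : O y -> smooth_at (fun y : R => y ^+ i * s1 y) y /\ smooth_at (fun y : R => y ^+ i * s2 y) y.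
    move=> Oy; have [h1 h2] := smooth_hom_shift mu eps Oy.
    by split=> l; (apply: DkM; first by apply: Dk_exp; exact: Dk_id).
  have sj (z : R) : smooth_at (fun z : R => z ^+ j) z by move=> l; apply: Dk_exp; exact: Dk_id.
  rewrite -(iterD_prod a' b' oO (fun y Oy => (sm y Oy).1) sj 0 O0).
  rewrite -(iterD_prod a' b' oO (fun y Oy => (sm y Oy).2) sj 0 O0).
  (* On this disc |y| < 1/8, so 1 + y is positive and the image point stays in the unit disc. *)
  apply: (@Dop_germ _ _ _ _ _ _ ((1 / 8) ^+ 2)) => [|y z yz]; first by rewrite exprn_gt0// divr_gt0.
  rewrite /ltranslate embedV invgK.
  have E : SLmx (embed a * Nmx y z)%g = mat3 (1 + y) 1 0 y 1 0 z 0 1.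
    rewrite SLmxM embedE aE !mxE/= mkSLE mul_mat3.
    by congr (mat3 _ _ _ _ _ _ _ _ _); ring.
  have y8 : - (1 / 8) < y by have := sqr_ge0 z; move: yz; nra.
  have y0 : 0 < 1 + y by lra.
  have yN0 := lt0r_neq0 y0.
  have rE : ratio (SLmx (embed a * Nmx y z)%g) = (y / (1 + y), z / (1 + y)) by rewrite /ratio E !mxE/=.
  rewrite (I_ratio If); last by rewrite E mxE.
  rewrite rE E mxE/= /f Sec_Nmx; last first.
    have y2 : (1 + y) ^+ 2 * 2 >= 1 by move: y8; nra.
    rewrite !expr_div_n -mulrDl ler_pdivrMr ?exprn_gt0// mul1r.
    by move: yz y2; nra.
  rewrite /monom/= !expr_div_n.
  have -> : y ^+ i / (1 + y) ^+ i * (z ^+ j / (1 + y) ^+ j) = (1 + y) ^- (i + j) * (y ^+ i * z ^+ j).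
    by rewrite exprD invfM mulrACA mulrC.
  rewrite rmorphM mulrA hom_shift//.
  rewrite -/mu -/eps /s1 /s2; case: (hom mu eps (1 + y)) => u v; simpc.
  by congr (_ +i* _); rewrite /=; ring.
have ik1 : (i.+1 < k.+1)%N by lia.
rewrite (bigD1 (Ordinal ik1))/=; last by lia.
(* Other indices take a number of z-derivatives different from j, and these annihilate z^j at 0. *)
rewrite big1 ?addr0; last first.
  move=> l /andP[lk li]; rewrite jE !derive1n_exp0 (_ : (_ == j) = false) ?mulr0 ?mulr0//.
  apply/negbTE; apply: contraNneq li => lj; apply/eqP/val_inj => /=; rewrite /j in lj; lia.
rewrite jE -/j derive1n_exp0 eqxx.
have sm y (Oy : O y) := smooth_hom_shift mu eps Oy.
rewrite (derive1n_expM i oO O0 (fun y Oy => (sm y Oy).1)).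
rewrite (derive1n_expM i oO O0 (fun y Oy => (sm y Oy).2)).
have := derive1_hom_shift mu eps; rewrite -/s1 -/s2.
set d1 := derive1 s1 0; set d2 := derive1 s2 0 => dE.
rewrite (_ : _ +i* _ = (i.+1`!%:R * j`!%:R)%:C * (d1 +i* d2)); last first.
  by simpc; congr (_ +i* _); ring.
rewrite dE mulrN mulrN => /eqP; rewrite oppr_eq0 !mulf_eq0 (negbTE Mi)/=.
have /negbTE -> : (i.+1`!%:R * j`!%:R)%:C != 0 :> R[i].
  by rewrite fmorph_eq0 mulf_neq0// pnatr_eq0 -lt0n fact_gt0.
(* What is left is mu = 0, that is lam = - (i + j), while k - (i + 1) = i + j + 1. *)
move=> /eqP m0; apply/eqP; rewrite -subr_eq0 -m0 /mu.
have -> : (k - i.+1 = (i + j).+1)%N by rewrite /j; lia.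
by apply/eqP; rewrite -natr1; ring.
Qed.

End JetExpansion.

(** Both sides commute with translations by G', so the values at the identity determine them. *)
Lemma Dcomb_eq c1 c2 a1 b1 a2 b2 :
  (forall f, I f -> D f 1%g = c1 * Dop a1 b1 f 1%g + c2 * Dop a2 b2 f 1%g) ->
  D = Dcomb lam alpha c1 c2 a1 b1 a2 b2.
Proof.
move=> H; have [_ off _ _ [eq _]] := DD; apply/funext => f.
have [If|nIf] := pselect (I f); last by rewrite off// Dcomb_off.
rewrite DcombE//; apply/funext => g.
have E (F : SL R 2 -> R[i]^o) : F g = ltranslate g^-1%g F 1%g by rewrite /ltranslate invgK mulg1.
rewrite [LHS]E -eq// H; last exact: I_triv_ltranslate.
by rewrite !Dop_ltranslate -!E.
Qed.

(** Every nonzero coefficient M i comes with an admissible pair (i, k - 2 i). For i > 0 the weight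
    condition lam = 1 - (k - i) determines i, so besides the purely normal term at most one
    survives. *)
Lemma Diff_form : D <> 0 -> exists k c1 c2 l m,
  [/\ D = Dcomb lam alpha c1 c2 0 k l m, admissible lam nu alpha beta 0 k &
      c2 = 0 \/ (0 < l)%N /\ admissible lam nu alpha beta l m].
Proof.
move=> D0; have [[k [nuE [M HM]]]|[_ H]] := jet_formula DD; last first.
  exfalso; apply: D0; rewrite (@Dcomb_eq 0 0 0 0 0 0).
    apply/funext => f; rewrite /Dcomb; case: pselect => // If.
    by rewrite !scale0r addr0.
  by move=> f If; rewrite H// !mul0r addr0.
have adm i : (2 * i <= k)%N -> M i != 0 -> admissible lam nu alpha beta i (k - 2 * i).
  move=> ik Mi; split.
  - by rewrite nuE; congr (_ + _%:R); lia.
  - by rewrite (coefficient_parity HM ik Mi) oddB// mul2n odd_double addbF.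
  - case: i ik Mi => [|i] ik Mi; [by left|right].
    by rewrite (coefficient_weight HM ik Mi); congr (1 - _%:R); lia.
exists k; exists (M 0%N).
have [[i [i0 ik Mi]]|nM] := pselect (exists i, [/\ (0 < i)%N, (2 * i <= k)%N & M i != 0]).
  exists (M i), i, (k - 2 * i)%N; have Ai := adm _ ik Mi; split; last by right.
    apply: Dcomb_eq => f If; rewrite HM// big_mkcond big_ord_recl/= muln0 subn0; congr (_ + _).
    have ik' : (i.-1 < k)%N by lia.
    rewrite (bigD1 (Ordinal ik'))//= /bump add1n prednK// ik big1 ?addr0// => l li.
    rewrite add1n; case: ifP => // lk.
    have [->|Ml] := eqVneq (M l.+1) 0; first by rewrite mul0r.
    (* Two positive indices with nonzero coefficients would express the same lam, hence coincide. *)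
    have := coefficient_weight HM lk Ml; case: i i0 ik Mi {Ai} ik' li => // i _ ik Mi ik' li.
    rewrite (coefficient_weight HM ik Mi) => /addrI/oppr_inj/eqP.
    rewrite eqr_nat => /eqP il; case/eqP: li; apply: val_inj => /=; lia.
  have [b a _] := Ai; split; last by left.
    by rewrite nuE.
  by rewrite (coefficient_parity HM ik Mi).
(* No tangential term occurs; the second operator is a placeholder with coefficient 0. *)
exists 0, 0%N, 0%N.
have DE : D = Dcomb lam alpha (M 0%N) 0 0 k 0 0.
  apply: Dcomb_eq => f If; rewrite HM// big_mkcond big_ord_recl/= muln0 subn0 mul0r; congr (_ + _).
  rewrite big1// => l _; case: ifP => // lk.
  have [->|Ml] := eqVneq (M (bump 0 l)) 0; first by rewrite mul0r.
  by exfalso; apply: nM; exists (bump 0 l).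
split=> //; last by left.
(* Here [M 0] is the last coefficient left, so it is nonzero unless D = 0, and then (0, k) is
   admissible. *)
have [M0|M0] := eqVneq (M 0%N) 0; last by have := adm 0%N (leq0n _) M0; rewrite muln0 subn0.
exfalso; apply: D0; rewrite DE; apply/funext => f; rewrite /Dcomb; case: pselect => // If.
by rewrite M0 !scale0r addr0.
Qed.

End Classification.

(** * Dimension count *)

Section Dimension.
Variables (K : fieldType) (V : lmodType K).
Implicit Types (W : set V) (u v : V).

Lemma has_dim_neq0 W d : has_dim W d.+1 -> W <> [set 0].
Proof.
move=> [e [ind ->]] W0.
have : [set \sum_(i < d.+1) c i *: e i | c in [set: 'I_d.+1 -> K]] (e ord0).
  exists (fun i => (i == ord0)%:R) => //.
  rewrite (bigD1 ord0)//= scale1r big1 ?addr0// => i /negbTE ->.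
  by rewrite scale0r.
rewrite W0 => e0.
have /ind/(_ ord0) : \sum_(i < d.+1) (i == ord0)%:R *: e i = 0.
  rewrite (bigD1 ord0)//= scale1r e0 add0r big1// => i /negbTE ->.
  by rewrite scale0r.
by move/eqP; rewrite eqxx oner_eq0.
Qed.

Lemma has_dim1 W u : u <> 0 -> W = [set c *: u | c in setT] -> has_dim W 1.
Proof.
move=> u0 WE; exists (fun=> u); split=> [c|].
  rewrite big_ord1 => /eqP; rewrite scaler_eq0 => /orP[/eqP c0 i|/eqP//].
  by rewrite ord1.
rewrite WE; apply/seteqP; split=> _ [c _ <-].
  by exists (fun=> c); rewrite ?big_ord1.
by exists (c ord0); rewrite ?big_ord1.
Qed.

Lemma has_dim2 W u v : (forall a b : K, a *: u + b *: v = 0 -> a = 0 /\ b = 0) ->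
  W = [set c.1 *: u + c.2 *: v | c in [set: K * K]] -> has_dim W 2.
Proof.
move=> ind WE; pose e (i : 'I_2) := if i == ord0 then u else v.
have eE c : \sum_(i < 2) c i *: e i = c ord0 *: u + c (lift ord0 ord0) *: v.
  by rewrite big_ord_recl big_ord1.
exists e; split=> [c|].
  rewrite eE => /ind[c0 c1] i; case: (unliftP ord0 i) => [j ->|->//].
  by rewrite (ord1 j).
rewrite WE; apply/seteqP; split=> _ [c _ <-].
  by exists (fun i => if i == ord0 then c.1 else c.2); rewrite ?eE.
by exists (c ord0, c (lift ord0 ord0)); rewrite ?eE.
Qed.

Lemma has_dim2_line W u : W = [set c *: u | c in setT] -> ~ has_dim W 2.
Proof.
move=> WE [e [ind]].
have mem (i : 'I_2) : [set \sum_(i < 2) c i *: e i | c in [set: 'I_2 -> K]] (e i).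
  exists (fun j => (j == i)%:R) => //.
  by rewrite (bigD1 i)//= eqxx scale1r big1 ?addr0// => j /negbTE ->; rewrite scale0r.
rewrite WE => We; have := mem ord0; have := mem (lift ord0 ord0); rewrite -We.
move=> [b _ eb] [a _ ea].
(* Two multiples a u and b u of one vector satisfy b (a u) - a (b u) = 0; independence forces a = 0,
   so the first basis vector would vanish. *)
pose c (i : 'I_2) := if i == ord0 then b else - a.
have /ind c0 : \sum_(i < 2) c i *: e i = 0.
  by rewrite big_ord_recl big_ord1 /c/= -ea -eb scaleNr !scalerA mulrC subrr.
have a0 : a = 0 by apply/eqP; rewrite -oppr_eq0; apply/eqP; exact: (c0 (lift ord0 ord0)).
have e0 : e ord0 = 0 by rewrite -ea a0 scale0r.
have /ind/(_ ord0)/eqP : \sum_(i < 2) (i == ord0)%:R *: e i = 0.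
  by rewrite big_ord_recl big_ord1/= e0 scaler0 scale0r addr0.
by rewrite eqxx oner_eq0.
Qed.

End Dimension.

Section Spanning.
Variables (R : realType) (lam nu : R[i]) (alpha beta : bool).
Local Notation I := (I_triv lam alpha).
Local Notation J := (J_triv nu beta).
Local Notation Dc := (Dcomb lam alpha).
Local Notation adm := (admissible lam nu alpha beta).

Lemma J_triv0 : J 0.
Proof.
apply/J_trivP; split; last by move=> g h _; rewrite [RHS]mulr0.
move=> g; exists setT; split=> //; first exact: openT.
by exists (fun=> 0), (fun=> 0); split=> // k; apply: Dk_Ck_on => x _; exact: Dk_cst.
Qed.

Lemma Diff0 : Diff I J 0.
Proof.
split=> //; first by move=> f _; exact: J_triv0.
- by move=> c f1 f2 _ _; rewrite scaler0 addr0.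
- by apply: continuous_subspaceT; exact: cst_continuous.
split=> [f g _|f g _ [_ /(_ setT)[||h [_ []]//]]] //.
exact: openT.
Qed.

(** A purely normal operator of the same weight and parity always accompanies one with tangential
    derivatives; hence an admissible pair with a > 0 makes the dimension two. *)
Lemma admissible0 a b : adm a b -> adm 0 (2 * a + b).
Proof.
move=> [nuE bE _]; split; [by rewrite nuE|by rewrite bE oddD mul2n odd_double|by left].
Qed.

(** The weight fixes 2 a + b, and for a > 0 the condition on lam fixes a + b as well. *)
Lemma admissible_uniq a b a' b' : adm a b -> adm a' b' ->
  (0 < a)%N = (0 < a')%N -> (a, b) = (a', b').
Proof.
move=> [nuE _ h] [nuE' _ h'] aa'.
have e1 : (2 * a + b = 2 * a' + b')%N.
  by move: nuE'; rewrite nuE => /addrI/eqP; rewrite eqr_nat => /eqP.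
have [a0|a0] := posnP a.
  by move: e1; have a'0 : a' = 0%N by [lia]; rewrite a0 a'0 !muln0 !add0n => ->.
case: h => [h|lamE]; first by rewrite h in a0.
case: h' => [h'|]; first by rewrite h' a0 in aa'.
rewrite lamE => /addrI/oppr_inj/eqP; rewrite eqr_nat => /eqP e2.
congr pair; lia.
Qed.

Lemma Dcomb_Sec c1 c2 a1 b1 a2 b2 i j :
  Dc c1 c2 a1 b1 a2 b2 (Sec lam alpha (@monom R i j)) 1%g =
  (if (a1 == i) && (b1 == j) then c1 else 0) * (i`! * j`!)%:R +
  (if (a2 == i) && (b2 == j) then c2 else 0) * (i`! * j`!)%:R.
Proof.
rewrite DcombE; last by apply: Sec_I; exact: smooth_monom.
rewrite -[LHS]/(c1 * Dop a1 b1 _ 1%g + c2 * Dop a2 b2 _ 1%g) !Dop_Sec !iterD_monom !rmorph_nat.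
by do 2!case: ifP => _; rewrite ?mulr0 ?mul0r.
Qed.

Definition Dsingle a b := Dc 1 0 a b 0 0.

Lemma Dcomb_single c1 c2 a1 b1 a2 b2 :
  Dc c1 c2 a1 b1 a2 b2 = c1 *: Dsingle a1 b1 + c2 *: Dsingle a2 b2.
Proof.
apply/funext => f; rewrite -[RHS]/(c1 *: Dsingle a1 b1 f + c2 *: Dsingle a2 b2 f).
rewrite /Dsingle /Dcomb; case: pselect => // If; last by rewrite !scaler0 addr0.
by rewrite !scale1r !scale0r !addr0.
Qed.

(** The sections with germ y^i z^j are, up to factorials, dual to the jets, so each coefficient is
    read off from one monomial. *)
Lemma Dsingle_indep a1 b1 a2 b2 (c1 c2 : R[i]) : (a1, b1) <> (a2, b2) ->
  c1 *: Dsingle a1 b1 + c2 *: Dsingle a2 b2 = 0 -> c1 = 0 /\ c2 = 0.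
Proof.
move=> ne; rewrite -Dcomb_single => E.
have f0 i j : (i`! * j`!)%:R != 0 :> R[i] by rewrite pnatr_eq0 -lt0n muln_gt0 !fact_gt0.
have D1 := Dcomb_Sec c1 c2 a1 b1 a2 b2 a1 b1; have D2 := Dcomb_Sec c1 c2 a1 b1 a2 b2 a2 b2.
have n21 : (a2 == a1) && (b2 == b1) = false.
  by apply/negbTE/negP => /andP[/eqP h1 /eqP h2]; apply: ne; rewrite h1 h2.
have n12 : (a1 == a2) && (b1 == b2) = false by rewrite eq_sym [b1 == b2]eq_sym.
rewrite E n21 !eqxx/= mul0r addr0 in D1; rewrite E n12 !eqxx/= mul0r add0r in D2.
split; apply/eqP; [move/esym/eqP: D1|move/esym/eqP: D2]; by rewrite mulf_eq0 (negbTE (f0 _ _)) orbF.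
Qed.

Lemma Dsingle_neq0 a b : Dsingle a b <> 0.
Proof.
(* Independence from any other operator excludes zero; the pair (a, b + 1) is an arbitrary such
   partner. *)
move=> E; have ne : (a, b) <> (a, b.+1) by case=> /n_Sn.
have := @Dsingle_indep a b a b.+1 1 0 ne; rewrite E scaler0 scale0r addr0.
by move=> /(_ erefl)[/eqP]; rewrite oner_eq0.
Qed.

Lemma Diff_trivial : (forall k, ~ adm 0 k) -> Diff I J = [set 0].
Proof.
move=> n; apply/seteqP; split=> [D DD|_ ->]; last exact: Diff0.
apply: contrapT => /(Diff_form DD)[k [c1 [c2 [l [m [_ Ak _]]]]]]; exact: n Ak.
Qed.

Lemma Diff_line k : adm 0 k -> (forall a b, (0 < a)%N -> ~ adm a b) ->
  Diff I J = [set c *: Dsingle 0 k | c in setT].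
Proof.
move=> Ak n; apply/seteqP; split=> [D DD|_ [c _ <-]]; last first.
  have -> : c *: Dsingle 0 k = Dc c 0 0 k 0 k by rewrite Dcomb_single scale0r addr0.
  exact: Dcomb_Diff.
have [->|/eqP D0] := eqVneq D 0; first by exists 0; rewrite ?scale0r.
have [k' [c1 [c2 [l [m [-> Ak' h]]]]]] := Diff_form DD D0.
have [->] := admissible_uniq Ak Ak' erefl.
have c20 : c2 = 0 by case: h => // -[l0 /n]; case.
by exists c1; rewrite ?Dcomb_single ?c20 ?scale0r ?addr0.
Qed.

Lemma Diff_plane k a b : adm 0 k -> (0 < a)%N -> adm a b ->
  Diff I J = [set c.1 *: Dsingle 0 k + c.2 *: Dsingle a b | c in [set: R[i] * R[i]]].
Proof.
move=> Ak a0 Ab; apply/seteqP; split=> [D DD|_ [c _ <-]]; last first.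
  by rewrite -Dcomb_single; exact: Dcomb_Diff.
have [->|/eqP D0] := eqVneq D 0; first by exists (0, 0); rewrite ?scale0r ?addr0.
have [k' [c1 [c2 [l [m [-> Ak' h]]]]]] := Diff_form DD D0.
have [->] := admissible_uniq Ak Ak' erefl.
case: h => [->|[l0 Al]].
  by exists (c1, 0); rewrite ?Dcomb_single /= ?scale0r ?addr0.
have [-> ->] := admissible_uniq Ab Al (etrans a0 (esym l0)).
by exists (c1, c2); rewrite ?Dcomb_single.
Qed.

End Spanning.

Theorem theorem4p11 (R : realType) (alpha beta : bool) (lam nu : R[i]) :
  let D := Diff (I_triv lam alpha) (J_triv nu beta) in
  [/\ (D <> [set 0]) <-> (has_dim D 1 \/ has_dim D 2),
      (has_dim D 1 \/ has_dim D 2) <->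
        (exists m : nat, beta = alpha (+) odd m /\ nu = lam + m%:R) &
      has_dim D 2 <->
        (exists m l : nat, [/\ (1 <= l)%N, beta = alpha (+) odd m,
           lam = 1 - (m + l)%:R & nu = 1 + l%:R])].
Proof.
move=> D.
have condE : (exists m : nat, beta = alpha (+) odd m /\ nu = lam + m%:R) <->
    exists k, admissible lam nu alpha beta 0 k.
  split=> [[m [bE nE]]|[m [nE bE _]]]; exists m; split=> //; last by left.
(* The dictionary is a = l and b = m: with lam = 1 - (m + l), the weight lam + 2 l + m equals 1 +
   l. *)
have cond2E : (exists m l : nat, [/\ (1 <= l)%N, beta = alpha (+) odd m,
      lam = 1 - (m + l)%:R & nu = 1 + l%:R]) <->
    exists a b, (0 < a)%N /\ admissible lam nu alpha beta a b.
  have E m l : lam = 1 - (l + m)%:R -> lam + (2 * l + m)%:R = 1 + l%:R.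
    by move=> ->; rewrite mul2n -addnn -addnA [(l + (l + m))%:R]natrD; ring.
  split=> [[m [l [l0 bE lE nE]]]|[l [m [l0 [nE bE h]]]]].
    exists l, m; rewrite addnC in lE; split=> //; split=> //; last by right.
    by rewrite (E m).
  case: h => [h|lE]; first by rewrite h in l0.
  by exists m, l; split=> //; rewrite ?nE ?(E m)// addnC.
rewrite (propext condE) (propext cond2E).
have D1 : has_dim D 1 -> D <> [set 0] := @has_dim_neq0 _ _ _ _.
have D2 : has_dim D 2 -> D <> [set 0] := @has_dim_neq0 _ _ _ _.
(* The three cases, an admissible pair with a > 0, only pairs with a = 0, or none, give dimension
   two, one and zero. *)
have [[a [b [a0 Ab]]]|nab] := pselect (exists a b, (0 < a)%N /\ admissible lam nu alpha beta a b).
  have Ak := admissible0 Ab.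
  have d2 : has_dim D 2.
    apply: has_dim2 (Diff_plane Ak a0 Ab) => c1 c2; apply: Dsingle_indep => -[h _].
    by rewrite -h in a0.
  split; split=> // _; [by right|by exact: D2|by exists (2 * a + b)%N|by right|by exists a, b].
have [[k Ak]|nk] := pselect (exists k, admissible lam nu alpha beta 0 k).
  have n a b : (0 < a)%N -> ~ admissible lam nu alpha beta a b.
    by move=> a0 Ab; apply: nab; exists a, b.
  have DE : D = _ := Diff_line Ak n.
  have d1 : has_dim D 1 by apply: has_dim1 DE; exact: Dsingle_neq0.
  have d2 := has_dim2_line DE.
  by split; split=> // _; [left|exact: D1|exists k|left].
have D0 : D = [set 0] by apply: Diff_trivial => k Ak; apply: nk; exists k.
split; split=> //.
- by case.
- by case=> [/D1|/D2].
- by move/D2.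
Qed.
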